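(* Consider the correlated Gaussian model with correlation coefficient $\rho=\rho_n>0$, and let $\epsilon>0$ be an arbitrarily small fixed constant. (i) If $\rho^2\ge \frac{(4+\epsilon)\log n}{n}$, then $\mathbb{P}\{\mathrm{overlap}(\hat\pi_{\mathrm{ML}},\pi)=1\}=1-o(1)$. (ii) Conversely, if $\rho^2\le\frac{(4-\epsilon)\log n}{n}$, then for any estimator $\hat\pi=\hat\pi(A,B)$ and any fixed constant $\delta>0$, $\mathbb{P}\{\mathrm{overlap}(\hat\pi,\pi)\le\delta\}=1-o(1)$.
   Context: Let $\mathcal S_n$ be the set of permutations of $[n]=\{1,\dots,n\}$ and let the latent permutation $\pi$ be uniform on $\mathcal S_n$. The observations are two vectors $A=(A_{ij})_{1\le i<j\le n}$ and $B=(B_{ij})_{1\le i<j\le n}$ indexed by unordered pairs (so $A_{ij}=A_{ji}$, $B_{ij}=B_{ji}$) such that, conditionally on $\pi$, the pairs $(A_{\pi(i)\pi(j)},B_{ij})$, $1\le i<j\le n$, are i.i.d. with joint law $P$. In the Gaussian model, $P$ is the joint law of two standard Gaussian random variables with correlation coefficient $\rho$, where $\rho$ may depend on $n$. For $\pi'\in\mathcal S_n$ write $A^{\pi'}_{ij}=A_{\pi'(i)\pi'(j)}$ and $\langle A^{\pi'},B\rangle=\sum_{i<j}A_{\pi'(i)\pi'(j)}B_{ij}$. The maximum likelihood estimator is $\hat\pi_{\mathrm{ML}}\in\arg\max_{\pi'\in\mathcal S_n}\langle A^{\pi'},B\rangle$. For $\pi,\hat\pi\in\mathcal S_n$, $\mathrm{overlap}(\pi,\hat\pi)=\frac1n|\{i\in[n]:\pi(i)=\hat\pi(i)\}|$.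 An estimator is a function of $(A,B)$ with values in $\mathcal S_n$. Asymptotics are as $n\to\infty$; $\log$ is the natural logarithm. *)

(* Defs.v *)
From HB Require Import structures.
From mathcomp Require Import all_boot all_order all_algebra all_fingroup.
From mathcomp Require Import all_classical all_reals all_analysis.

Set Implicit Arguments.
Unset Strict Implicit.
Unset Printing Implicit Defensive.

Import Order.TTheory GRing.Theory Num.Theory.
Import numFieldNormedType.Exports.

Local Open Scope classical_set_scope.
Local Open Scope ring_scope.

HB.instance Definition _ (T : finType) := isPointed.Build (perm_type T) (perm_one T).
HB.instance Definition _ (T : finType) :=
  @isMeasurable.Build default_measure_display (perm_type T) discrete_measurable
    discrete_measurable0 discrete_measurableC discrete_measurableU.

(* Unordered pairs {i, j} with i != j. *)
Definition edge (n : nat) := {e : {set 'I_n} | #|e| == 2%N}.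

Lemma perm_edge_subproof n (s : 'S_n) (e : edge n) : #|s @: val e| == 2%N.
Proof. by rewrite card_imset ?(valP e)//; exact: perm_inj. Qed.

Definition perm_edge n (s : 'S_n) (e : edge n) : edge n :=
  Sub (s @: val e) (perm_edge_subproof s e).

(* Vectors indexed by edges, encoded as tuples along the enumeration of edges,
   so that they carry the product sigma-algebra of [tuple]. *)
Notation obs n R := (#|{: edge n}|.-tuple R).

Definition entry n (R : Type) (x : obs n R) (e : edge n) : R :=
  tnth x (enum_rank e).

Definition inner n (R : realType) (s : 'S_n) (a b : obs n R) : R :=
  \sum_(e : edge n) entry a (perm_edge s e) * entry b e.

Definition overlap n (R : realType) (s t : 'S_n) : R :=
  #|[pred i : 'I_n | s i == t i]|%:R / n%:R.

Notation estimator n R := {mfun (obs n R * obs n R)%type >-> 'S_n}.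

(* Any measurable selection of the argmax qualifies, whatever its tie-breaking. *)
Definition is_ML n (R : realType) (est : estimator n R) : Prop :=
  forall (a b : obs n R) (s : 'S_n), inner s a b <= inner (est (a, b)) a b.

(* Centred Gaussian law on the plane with unit variances and correlation rho:
   the law of (X, rho X + sqrt (1 - rho^2) Z) for X, Z independent standard
   Gaussians. It is meant for |rho| <= 1, and rho = 1 (a law without density)
   is allowed. *)
Definition bivariate_normal (R : realType) (rho : R) : set (R * R) -> \bar R :=
  pushforward (normal_prob (0 : R) 1 \x normal_prob (0 : R) 1)%E
    (fun z : R * R => (z.1, rho * z.1 + Num.sqrt (1 - rho ^+ 2) * z.2)).

Section model.
Local Open Scope ereal_scope.

(* The second clause is the product rule for the pairs (A_{pi e}, B_e) under
   the conditional law given pi = s, multiplied through by P (pi = s). *)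
Definition correlated_gaussian (R : realType) n (d : measure_display)
    (T : measurableType d) (P : probability T R) (rho : R)
    (pi : {RV P >-> 'S_n}) (A B : {RV P >-> obs n R}) : Prop :=
  (forall s : 'S_n, P [set w | pi w = s] = ((n`!)%:R^-1)%:E) /\
  (forall (s : 'S_n) (F : edge n -> set (R * R)),
    (forall e, measurable (F e)) ->
    P [set w | pi w = s /\ forall e : edge n,
                 F e (entry (A w) (perm_edge s e), entry (B w) e)] =
    P [set w | pi w = s] * \prod_(e : edge n) bivariate_normal rho (F e)).

End model.

(* Main.v *)
From HB Require Import structures.
Require Import Defs.
From mathcomp Require Import all_boot all_order all_algebra all_fingroup.
From mathcomp Require Import all_classical all_reals all_analysis.
From mathcomp Require Import measurable_realfun.
From mathcomp Require Import ring lra.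

Set Implicit Arguments.
Unset Strict Implicit.
Unset Printing Implicit Defensive.

Import Order.TTheory GRing.Theory Num.Theory.
Import numFieldNormedType.Exports.

Local Open Scope classical_set_scope.
Local Open Scope ring_scope.

(** Why the theorem is true.

Write L = log n. Given pi = s, the pairs (A_(s e), B_e) over the edges e form an
i.i.d. family with the law [W], the power of [bivariate rho]; both halves are
estimates about [W] and about the edge action of permutations.

Recovery above the threshold. Relabelling by pi reduces an error of the maximum
likelihood estimator to the event that, for i.i.d. pairs (X_e, Y_e) of law [W],
some t <> 1 satisfies sum_e X_e Y_e <= sum_e X_(t e) Y_e ([ml_error_le]). Given X
the Y_e are independent Gaussians, so every exponential moment of a sum
sum_e u_e(X) Y_e becomes that of a quadratic form in X ([mgf_correlate]); products
X_e X_(t e) along a permutation are split by a 3-colouring into three independent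
families of disjoint pairs ([three_coloring], [mgf_form]). The resulting Chernoff
bound for a single t moving k points has exponent about k (2 n - k) rho^2 / 8. For
k <= e n / 16, where e = min(eps, 1), this is at least (1 + e / 16) k L and beats
the n^k permutations moving k points. For larger k the factor 2 n - k loses too
much. There the two sums, restricted to the set D of the edges that are not
contained in the set of fixed points of t, are both compared with the constant
rho |D| (1 - e / 64) ([beaten_subset]): the exponent for the wrong sum to exceed it
is about twice the previous one, and the event that the true sum falls below it
depends only on the set of moved points, so that 2^n events suffice for its union
bound.

Impossibility below the threshold. Under the law [G2] of independent standard
Gaussian vectors a and b, the joint law of (pi, A, B) has density
w_s = likelihood_s / n! ([joint_density]); with Z = sum_s w_s, the weights w_s / Z are
the posterior law of pi. If the permutations s with overlap(est, s) > delta carry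
posterior mass p, then two independent posterior samples overlap on average on a
fraction at least (delta p)^2 of the points, by Cauchy-Schwarz over the points
([overlap_mass_sqr]). So it suffices that two posterior samples rarely overlap on
more than a small fraction y of the points, that is, that the integral of
sum_(overlap(s, t) >= y) w_s w_t / Z is small. The denominator costs nothing: the
part where Z <= x contributes at most x, and elsewhere 1 / Z <= 1 / x
([near_mass_split]).

The second moment of the likelihood is dominated by rare observations, so it is
truncated: [good] observations are those where, for every set S of at least y n
points, the likelihood of the edges inside S is at most exp ([threshold] S), a
little more than exp (|S|^2 v / 4), the typical value at the largest allowed
rho^2 = v = (4 - e) L / n. On good observations the likelihood of the edges where s
and t agree is paid for by the threshold ([good_pair]), and what remains has
expectation exp (o (n L)), because the kernels [lratio] compose ([integral_lratio2],
[integral_cross_likelihood]). A fraction at most 1 / |S|! = exp (- |S| L + O (n)) of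
the permutations agrees with s exactly on S, while threshold S <= (1 - e / 8) |S| L.
Hence the truncated second moment tends to 0 ([cross_small]), and so does the
probability of bad observations ([atypical_small]). *)

(** * Densities and powers of a probability *)

Section density.
Import HBNNSimple.
Context d (T : measurableType d) (R : realType) (mu : {measure set T -> \bar R}).
Variable g : T -> R.
Hypothesis (g0 : forall x, 0 <= g x) (mg : measurable_fun setT g).
Local Open Scope ereal_scope.

Let dens (A : set T) := \int[mu]_(x in A) (g x)%:E.

Let dens0 : dens set0 = 0. Proof. by rewrite /dens integral_set0. Qed.

Let dens_ge0 A : 0 <= dens A.
Proof. by apply: integral_ge0 => x _; rewrite lee_fin g0. Qed.

Let dens_sigma_additive : semi_sigma_additive dens.
Proof.
move=> F mF tF mUF; rewrite /dens ge0_integral_bigcup//; last 2 first.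
- by apply/measurable_EFinP; exact: measurable_funTS.
- by move=> x _; rewrite lee_fin g0.
apply: is_cvg_ereal_nneg_natsum_cond => n _ _.
by apply: integral_ge0 => x _; rewrite lee_fin g0.
Qed.

HB.instance Definition _ := isMeasure.Build _ _ _ dens dens0 dens_ge0 dens_sigma_additive.

(** The measure of density [g], together with its integration rule, obtained by
    approximating the integrand by simple functions and monotone convergence. *)
Lemma exists_density : exists m : {measure set T -> \bar R},
  (forall A, measurable A -> m A = \int[mu]_(x in A) (g x)%:E) /\
  (forall f : T -> R, measurable_fun setT f -> (forall x, (0 <= f x)%R) ->
     \int[m]_x (f x)%:E = \int[mu]_x (f x * g x)%:E).
Proof.
exists dens; split => // f mf f0.
have mEf : measurable_fun setT (EFin \o f) by exact/measurable_EFinP.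
have f0E x : setT x -> 0 <= (EFin \o f) x by move=> _; rewrite /= lee_fin.
pose h := nnsfun_approx measurableT mEf.
have cvgE x (k : R) : (fun n => (h n x * k)%:E) @ \oo --> (f x * k)%:E.
  have hx := cvg_nnsfun_approx measurableT mEf f0E (I : setT x).
  under eq_fun do rewrite EFinM.
  by rewrite EFinM; apply: cvgeZr.
have nd : forall x, {homo (fun n => h n x) : n m / (n <= m)%N >-> (n <= m)%R}.
  by move=> x n m nm; exact/lefP/nd_nnsfun_approx.
transitivity (limn (fun n => \int[dens]_x (h n x)%:E)).
  rewrite -monotone_convergence//; last 3 first.
  - by move=> n; apply/measurable_EFinP.
  - by move=> n x _; rewrite lee_fin.
  - by move=> x _ n m nm; rewrite lee_fin; exact: nd.
  apply: eq_integral => x _; apply/esym/cvg_lim => //.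
  by have := cvgE x 1%R; rewrite mulr1; under eq_fun do rewrite mulr1.
transitivity (limn (fun n => \int[mu]_x (h n x * g x)%:E)); last first.
  rewrite -monotone_convergence//; last 3 first.
  - by move=> n; apply/measurable_EFinP/measurable_funM.
  - by move=> n x _; rewrite lee_fin mulr_ge0.
  - by move=> x _ n m nm; rewrite lee_fin ler_wpM2r//; exact: nd.
  by apply: eq_integral => x _; apply/cvg_lim => //; exact: cvgE.
congr (limn _); apply/funext => n.
have hE x : h n x = (\sum_(r \in range (h n)) (r * \1_(h n @^-1` [set r]) x))%R.
  exact: (fimfunE (h n)).
transitivity (\int[dens]_x
   (\sum_(r \in range (h n)) (r * \1_(h n @^-1` [set r]) x)%:E)).
  by apply: eq_integral => x _; rewrite {1}hE fsumEFin.
transitivity (\int[mu]_x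
   (\sum_(r \in range (h n)) (r * \1_(h n @^-1` [set r]) x * g x)%:E)); last first.
  by apply: eq_integral => x _; rewrite [in RHS]hE mulr_fsuml fsumEFin.
rewrite !ge0_integral_fsum//=.
- apply: eq_fsbigr => r _.
  rewrite integralZl_indic_nnsfun// integral_indic// setIT.
  under [RHS]eq_integral do rewrite -mulrA EFinM.
  case: (leP 0%R r) => r0; last first.
    rewrite preimage_nnfun0// measure0 mule0.
    by under eq_integral do rewrite indicE in_set0 mul0r mule0; rewrite integral0.
  rewrite ge0_integralZl//.
  - congr (_ * _); rewrite /= /dens integral_mkcond; apply: eq_integral => x _.
    by rewrite patchE indicE; case: ifP => _; rewrite ?mul1r ?mul0r.
  - by apply/measurable_EFinP/measurable_funM.
  - by move=> x _; rewrite lee_fin mulr_ge0.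
- by move=> r; apply/measurable_EFinP/measurable_funM => //; exact: measurable_funM.
- move=> r x _; rewrite lee_fin mulr_ge0//.
  by rewrite -lee_fin; exact: nnfun_muleindic_ge0.
- by move=> r; apply/measurable_EFinP; exact: measurable_funM.
- by move=> r x _; exact: nnfun_muleindic_ge0.
Qed.

End density.

Section power.
Context d (T : measurableType d) (R : realType) (p : probability T R).
Local Open Scope ereal_scope.

Lemma emeasurable_prod d' (S : measurableType d') (I : Type) (r : seq I)
    (f : I -> S -> \bar R) : (forall i, measurable_fun setT (f i)) ->
  measurable_fun setT (fun t => \prod_(i <- r) f i t).
Proof.
move=> mf; elim: r => [|i r IH].
  by under eq_fun do rewrite big_nil; exact: measurable_cst.
by under eq_fun do rewrite big_cons; exact: emeasurable_funM.
Qed.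

Lemma measurable_prod_tuple N (f : 'I_N -> T -> \bar R) :
  (forall i, measurable_fun setT (f i)) ->
  measurable_fun setT (fun t : N.-tuple T => \prod_(i < N) f i (tnth t i)).
Proof.
move=> mf; apply: emeasurable_prod => i.
by apply: measurableT_comp => //; exact: measurable_tnth.
Qed.

(** Built by adding one coordinate at a time. The product rule for integrals, rather
    than for boxes, is what Fubini propagates along the recursion. *)
Lemma exists_power N : exists m : probability (N.-tuple T) R,
  forall f : 'I_N -> T -> \bar R, (forall i, measurable_fun setT (f i)) ->
    (forall i x, 0 <= f i x) ->
  \int[m]_t (\prod_(i < N) f i (tnth t i)) = \prod_(i < N) \int[p]_x f i x.
Proof.
elim: N => [|N [m IH]].
  exists (dirac ([tuple] : 0.-tuple T)) => f mf f0.
  rewrite integral_dirac//; last exact: measurable_prod_tuple.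
  by rewrite diracT mul1e !big_ord0.
pose X (z : T * N.-tuple T) : N.+1.-tuple T := [the N.+1.-tuple T of z.1 :: z.2].
have mX : measurable_fun setT X by exact: measurable_cons.
pose Xm : {mfun (T * N.-tuple T)%type >-> N.+1.-tuple T} :=
  HB.pack X (isMeasurableFun.Build _ _ _ _ X mX).
exists (distribution (p \x m)%E Xm) => f mf f0.
have mF := measurable_prod_tuple mf.
rewrite ge0_integral_distribution//; last by move=> t; exact: prode_ge0.
have mR := measurable_prod_tuple (fun i => mf (lift ord0 i)).
under eq_integral => z _.
  rewrite /= big_ord_recl/=; under eq_bigr do rewrite tnthS.
  over.
rewrite fubini_tonelli1//=; last 2 first.
- apply: emeasurable_funM; first exact: (measurableT_comp (mf ord0) measurable_fst).
  exact: (measurableT_comp mR measurable_snd).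
- by move=> z; rewrite mule_ge0// prode_ge0.
rewrite /fubini_F big_ord_recl/= -IH//.
rewrite -ge0_integralZr//=; last by apply: integral_ge0 => t _; exact: prode_ge0.
apply: eq_integral => x _; rewrite -ge0_integralZl//=.
by move=> t _; exact: prode_ge0.
Qed.

Definition power N : probability (N.-tuple T) R := sval (cid (exists_power N)).

Lemma integral_power N (f : 'I_N -> T -> \bar R) :
  (forall i, measurable_fun setT (f i)) -> (forall i x, 0 <= f i x) ->
  \int[power N]_t (\prod_(i < N) f i (tnth t i)) = \prod_(i < N) \int[p]_x f i x.
Proof. by rewrite /power; case: cid => m /= mE mf f0; exact: mE. Qed.

Lemma prod_indic N (F : 'I_N -> set T) (t : N.-tuple T) :
  (\prod_(i < N) \1_(F i) (tnth t i) = \1_[set t | forall i, F i (tnth t i)] t :> R)%R.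
Proof.
rewrite indicE; case: (pselect (forall i, F i (tnth t i))) => h.
  by rewrite mem_set//= big1// => i _; rewrite indicE mem_set.
rewrite memNset//=; move/boolp.existsNP: h => [i Fi].
by rewrite (bigD1 i)//= indicE memNset ?mul0r.
Qed.

Lemma measurable_box N (F : 'I_N -> set T) : (forall i, measurable (F i)) ->
  measurable [set t : N.-tuple T | forall i, F i (tnth t i)].
Proof.
move=> mF; rewrite (_ : mkset _ = \bigcap_i (fun t => tnth t i) @^-1` (F i)).
  apply: fin_bigcap_measurable => // i _.
  by rewrite -[X in measurable X]setTI; exact: measurable_tnth.
by apply/seteqP; split => t /= h i => [_|]; [exact: h|exact: (h i I)].
Qed.

Lemma power_box N (F : 'I_N -> set T) : (forall i, measurable (F i)) ->
  power N [set t | forall i, F i (tnth t i)] = \prod_(i < N) p (F i).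
Proof.
move=> mF.
transitivity (\int[power N]_t (\prod_(i < N) (\1_(F i) (tnth t i) : R)%:E)).
  under eq_integral do rewrite prodEFin prod_indic.
  by rewrite integral_indic ?setIT//; exact: measurable_box.
rewrite (@integral_power _ (fun i => EFin \o \1_(F i))).
- by apply: eq_bigr => i _; rewrite integral_indic ?setIT.
- by move=> i; exact/measurable_EFinP.
- by move=> i x; rewrite lee_fin.
Qed.

Lemma tuple_measurableE N : (measurable : set (set (N.-tuple T))) =
  <<s [set B | exists F : 'I_N -> set T, (forall i, measurable (F i)) /\
        B = [set t | forall i, F i (tnth t i)]] >>.
Proof.
apply/seteqP; split => A.
  move=> mA B [sB GB]; move: A mA; apply: smallest_sub; first exact: sB.
  move=> A; rewrite -bigcup_seq => -[i _] [C mC <-]; apply: GB.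
  exists (fun j => if j == i then C else setT); split.
    by move=> j; case: ifP.
  apply/seteqP; split => t /=.
    by move=> [_ Ct] j; case: eqVneq => [->|].
  by move=> /(_ i); rewrite eqxx.
move: A; apply: smallest_sub; first exact: sigma_algebra_measurable.
by move=> _ [F [mF ->]]; exact: measurable_box.
Qed.

(** The pi-lambda theorem. The factor [k] allows it to be applied to a law restricted to
    an event, such as a fixed value of the latent permutation. *)
Lemma power_unique N (k : {nonneg R}) (m : {measure set (N.-tuple T) -> \bar R}) :
  (forall F : 'I_N -> set T, (forall i, measurable (F i)) ->
    m [set t | forall i, F i (tnth t i)] = k%:num%:E * \prod_(i < N) p (F i)) ->
  forall A, measurable A -> m A = k%:num%:E * power N A.
Proof.
move=> mE A mA; rewrite -[RHS]/(mscale k (power N) A).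
pose C := [set B | exists F : 'I_N -> set T, (forall i, measurable (F i)) /\
        B = [set t | forall i, F i (tnth t i)]].
apply: (measure_unique C (fun=> setT)) => //.
- exact: tuple_measurableE.
- move=> _ _ [F [mF ->]] [F' [mF' ->]].
  exists (fun i => F i `&` F' i); split; first by move=> i; exact: measurableI.
  apply/seteqP; split => t /=; first by move=> [h h'] i.
  by move=> h; split => i; have [] := h i.
- by move=> _; exists (fun=> setT); split => //; apply/seteqP.
- by rewrite bigcup_const//; exists 0%N.
- by move=> _ [F [mF ->]]; rewrite mE// /mscale/=; congr (_ * _); exact/esym/power_box.
- move=> _; have := mE (fun=> setT) (fun=> measurableT).
  under eq_bigr do rewrite probability_setT.
  rewrite big1_eq mule1 (_ : mkset _ = setT); last by apply/seteqP.
  by move=> /= ->; exact: ltry.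
Qed.

End power.

(** * Independent families indexed by a finite type *)

Lemma integral_prob_cst d (T : measurableType d) (R : realType)
    (P : probability T R) (c : \bar R) : (\int[P]_x c = c)%E.
Proof.
rewrite integral_cst// -[RHS]mule1; congr (_ * _)%E; exact: probability_setT.
Qed.

Section family.
Context d (T : measurableType d) (R : realType) (p : probability T R) (E : finType).
Local Open Scope ereal_scope.

Notation fam S := (#|{: E}|.-tuple S).

Definition coord (S : Type) (x : fam S) (e : E) : S := tnth x (enum_rank e).

Definition of_fun (S : Type) (f : E -> S) : fam S := [tuple f (enum_val i) | i < #|{: E}|].

Lemma coord_of_fun S (f : E -> S) e : coord (of_fun f) e = f e.
Proof. by rewrite /coord tnth_mktuple enum_rankK. Qed.

Lemma of_fun_coord S (x : fam S) : of_fun (coord x) = x.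
Proof. by apply: eq_from_tnth => i; rewrite tnth_mktuple /coord enum_valK. Qed.

Lemma measurable_coord d' (S : measurableType d') (e : E) :
  measurable_fun setT (fun x : fam S => coord x e).
Proof. exact: measurable_tnth. Qed.

Lemma measurable_of_fun d1 (X : measurableType d1) d2 (S : measurableType d2)
    (f : X -> E -> S) : (forall e, measurable_fun setT (f ^~ e)) ->
  measurable_fun setT (fun x => of_fun (f x)).
Proof.
move=> mf; apply/measurable_fun_tnthP => i.
rewrite (_ : _ \o _ = fun x => f x (enum_val i)); first exact: mf.
by apply/funext => x; rewrite /= tnth_mktuple.
Qed.

Lemma big_coord (S : Type) (x : fam S) (M : Type) (idx : M) (op : Monoid.com_law idx)
    (F : E -> S -> M) :
  \big[op/idx]_e F e (coord x e) =
  \big[op/idx]_(i < #|{: E}|) F (enum_val i) (tnth x i).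
Proof.
rewrite (reindex_onto (@enum_val E predT) enum_rank)/=; last by move=> e _; exact: enum_rankK.
by apply: eq_big => [i|i _]; rewrite ?enum_valK ?eqxx// /coord enum_valK.
Qed.

Lemma integral_power_coord (f : E -> T -> \bar R) :
  (forall e, measurable_fun setT (f e)) -> (forall e x, 0 <= f e x) ->
  \int[power p #|{: E}|]_t (\prod_e f e (coord t e)) = \prod_e \int[p]_x f e x.
Proof.
move=> mf f0; under eq_integral do rewrite big_coord.
rewrite (@integral_power _ _ _ _ _ (fun i => f (enum_val i)))//.
rewrite [RHS](reindex_onto (@enum_val E predT) enum_rank)/=; last first.
  by move=> e _; exact: enum_rankK.
by apply: eq_bigl => i; rewrite enum_valK eqxx.
Qed.

Lemma measurable_coord_box (F : E -> set T) : (forall e, measurable (F e)) ->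
  measurable [set t : fam T | forall e, F e (coord t e)].
Proof.
move=> mF; rewrite (_ : mkset _ = [set t : fam T | forall i, F (enum_val i) (tnth t i)]).
  exact: (measurable_box (fun i => mF (enum_val i))).
apply/seteqP; split => t /= h => [i|e]; last by have := h (enum_rank e); rewrite enum_rankK.
by have := h (enum_val i); rewrite /coord enum_valK.
Qed.

Lemma power_coord_unique (k : {nonneg R}) (m : {measure set (fam T) -> \bar R}) :
  (forall F : E -> set T, (forall e, measurable (F e)) ->
    m [set t | forall e, F e (coord t e)] = k%:num%:E * \prod_e p (F e)) ->
  forall A, measurable A -> m A = k%:num%:E * power p #|{: E}| A.
Proof.
move=> mE; apply: power_unique => F mF.
have := mE (fun e => F (enum_rank e)) (fun e => mF _).
rewrite (_ : mkset _ = [set t : fam T | forall i, F i (tnth t i)]); last first.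
  apply/seteqP; split => t /= h => [i|e]; last exact: h.
  by have := h (enum_val i); rewrite /coord enum_valK.
move=> ->; congr (_ * _).
rewrite [LHS](reindex_onto (@enum_val E predT) enum_rank)/=; last first.
  by move=> e _; exact: enum_rankK.
by apply: eq_big => [i|i _]; rewrite enum_valK ?eqxx.
Qed.

Lemma prod_indic_coord (F : E -> set T) (t : fam T) :
  (\prod_e \1_(F e) (coord t e) = \1_[set t | forall e, F e (coord t e)] t :> R)%R.
Proof.
rewrite indicE; case: (pselect (forall e, F e (coord t e))) => h.
  by rewrite mem_set//= big1// => i _; rewrite indicE mem_set.
rewrite memNset//=; move/boolp.existsNP: h => [i Fi].
by rewrite (bigD1 i)//= indicE memNset ?mul0r.
Qed.

Lemma integral_prod_power d' (X : measurableType d') (q : probability X R)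
    (h : E -> X * T -> \bar R) :
  (forall e, measurable_fun setT (h e)) -> (forall e z, 0 <= h e z) ->
  \int[q \x power p #|{: E}|]_z (\prod_e h e (z.1, coord z.2 e)) =
  \int[q]_x (\prod_e \int[p]_y h e (x, y)).
Proof.
move=> mh h0; rewrite fubini_tonelli1//=.
- apply: eq_integral => x _; rewrite /fubini_F/=.
  rewrite (@integral_power_coord (fun e y => h e (x, y)))// => e.
  by apply: measurableT_comp => //; exact: pair1_measurable.
- apply: emeasurable_prod => e; apply: measurableT_comp => //=.
  apply: measurable_fun_pair => //=.
  exact: (measurableT_comp (measurable_coord e) measurable_snd).
- by move=> z; apply: prode_ge0.
Qed.

End family.
(** The encoding of families by tuples is the one of the observation vectors, so that
    [coord] and [entry] are convertible. *)
Notation fam E S := (#|{: E}|.-tuple S).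

Section resampling.
Context d (T : measurableType d) (R : realType) (p : probability T R) (E : finType).
Local Open Scope ereal_scope.
Variables (D : pred E) (tau : {perm E}).

Let splice (z : fam E T * fam E T) : fam E T :=
  of_fun (fun e => if D e then coord z.2 ((tau^-1)%g e) else coord z.1 e).

Let measurable_splice : measurable_fun setT splice.
Proof.
apply: measurable_of_fun => e; case: (D e).
- exact: (measurableT_comp (measurable_coord _) measurable_snd).
- exact: (measurableT_comp (measurable_coord _) measurable_fst).
Qed.

(** Replacing the coordinates in [D] by those of an independent copy, read through
    [tau], does not change the law. *)
Lemma power_splice (h : fam E T -> \bar R) :
  measurable_fun setT h -> (forall t, 0 <= h t) ->
  \int[power p #|{: E}|]_t h t =
  \int[power p #|{: E}| \x power p #|{: E}|]_z
    h (of_fun (fun e => if D e then coord z.2 ((tau^-1)%g e) else coord z.1 e)).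
Proof.
move=> mh h0.
pose Xm : {mfun (fam E T * fam E T)%type >-> fam E T} :=
  HB.pack splice (isMeasurableFun.Build _ _ _ _ splice measurable_splice).
rewrite -(@ge0_integral_distribution _ _ _ _ _ (power p #|{: E}| \x power p #|{: E}|)%E Xm)//.
apply: eq_measure_integral => A mA _.
rewrite -[LHS]mul1e; apply/esym.
have := @power_coord_unique _ _ _ p E (1%:nng)%R
  (distribution (power p #|{: E}| \x power p #|{: E}|)%E Xm).
apply=> // F mF; rewrite /= mul1e /distribution /pushforward/=.
(* The box condition at e is read on the first copy if e is outside D, and on the second
   copy at the preimage of e under tau otherwise. *)
pose u e : T -> \bar R := if D e then cst 1 else EFin \o \1_(F e).
pose v e : T -> \bar R := if D (tau e) then EFin \o \1_(F (tau e)) else cst 1.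
have mu e : measurable_fun setT (u e).
  by rewrite /u; case: ifP => _//; exact/measurable_EFinP.
have mv e : measurable_fun setT (v e).
  by rewrite /v; case: ifP => _//; exact/measurable_EFinP.
have u0 e x : 0 <= u e x by rewrite /u; case: ifP => _/=; rewrite lee_fin.
have v0 e x : 0 <= v e x by rewrite /v; case: ifP => _/=; rewrite lee_fin.
transitivity (\int[power p #|{: E}| \x power p #|{: E}|]_z
    ((\prod_e u e (coord z.1 e)) * (\prod_e v e (coord z.2 e)))).
  transitivity (\int[power p #|{: E}| \x power p #|{: E}|]_z
      (\1_(splice @^-1` [set t | forall e, F e (coord t e)]) z : R)%:E).
    rewrite integral_indic ?setIT//.
    by rewrite -[X in measurable X]setTI; apply: measurable_splice => //;
       exact: measurable_coord_box.
  apply: eq_integral => z _.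
  transitivity ((\1_[set t | forall e, F e (coord t e)] (splice z) : R)%:E) => //.
  rewrite -prod_indic_coord -prodEFin.
  rewrite [X in _ = _ * X](reindex_inj (@perm_inj _ (tau^-1)%g)) -big_split/=.
  apply: eq_bigr => e _; rewrite /u /v permKV /splice coord_of_fun.
  by case: ifP => _/=; rewrite ?mul1e ?mule1.
have mU : measurable_fun setT (fun x : fam E T => \prod_e u e (coord x e)).
  apply: emeasurable_prod => e; apply: measurableT_comp => //; exact: measurable_coord.
have mV : measurable_fun setT (fun x : fam E T => \prod_e v e (coord x e)).
  apply: emeasurable_prod => e; apply: measurableT_comp => //; exact: measurable_coord.
have U0 x : 0 <= \prod_e u e (coord x e) by exact: prode_ge0.
have V0 x : 0 <= \prod_e v e (coord x e) by exact: prode_ge0.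
rewrite fubini_tonelli1//=; last 2 first.
- apply: emeasurable_funM.
    exact: (measurableT_comp mU measurable_fst).
  exact: (measurableT_comp mV measurable_snd).
- by move=> z; exact: mule_ge0.
rewrite /fubini_F/=.
under eq_integral do rewrite ge0_integralZl//.
rewrite ge0_integralZr//; last by apply: integral_ge0.
rewrite !integral_power_coord//.
rewrite [X in _ * X](reindex_inj (@perm_inj _ (tau^-1)%g)) -big_split/=.
apply: eq_bigr => e _; rewrite /u /v permKV.
by case: ifP => _/=; rewrite integral_prob_cst ?mul1e ?mule1 integral_indic ?setIT.
Qed.

End resampling.

(** Since [tau] maps [C] outside [C], the pairs [(e, tau e)] for [e] in [C] are
    disjoint, hence independent: the second members may be taken from an independent
    copy. *)
Lemma integral_power_pairs d (T : measurableType d) (R : realType)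
    (p : probability T R) (E : finType) (C : pred E) (tau : {perm E})
    (f : T * T -> \bar R) :
  measurable_fun setT f -> (forall z, (0 <= f z)%E) ->
  (forall e, C e -> ~~ C (tau e)) ->
  (\int[power p #|{: E}|]_t (\prod_(e | C e) f (coord t e, coord t (tau e))) =
   \prod_(e | C e) \int[p]_x \int[p]_y f (x, y))%E.
Proof.
move=> mf f0 hC.
have mpair d1 (X : measurableType d1) (a b : X -> T) : measurable_fun setT a ->
    measurable_fun setT b -> measurable_fun setT (fun x => f (a x, b x)).
  by move=> ma mb; apply: measurableT_comp => //; exact: measurable_fun_pair.
pose D : pred E := fun e => C ((tau^-1)%g e).
rewrite (power_splice p D tau); last 2 first.
- under eq_fun do rewrite big_mkcond/=.
  apply: emeasurable_prod => e; case: (C e); last exact: measurable_cst.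
  by apply: mpair; exact: measurable_coord.
- by move=> t; exact: prode_ge0.
pose h e (z : fam E T * T) : \bar R := if C e then f (coord z.1 e, z.2) else 1%E.
transitivity (\int[power p #|{: E}| \x power p #|{: E}|]_z
    (\prod_e h e (z.1, coord z.2 e)))%E.
  apply: eq_integral => z _; rewrite big_mkcond/=; apply: eq_bigr => e _.
  rewrite /h/=; case: ifP => // Ce; rewrite !coord_of_fun /D permK Ce.
  case: ifP => // Ce'; exfalso.
  by have := hC _ Ce'; rewrite permKV Ce.
rewrite integral_prod_power; last 2 first.
- move=> e; rewrite /h; case: (C e); last exact: measurable_cst.
  apply: mpair => //; exact: (measurableT_comp (measurable_coord _) measurable_fst).
- by move=> e z; rewrite /h; case: ifP => _//; rewrite lee_fin.
pose k e (x : T) : \bar R := (\int[p]_y (if C e then f (x, y) else 1%E))%E.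
transitivity (\int[power p #|{: E}|]_x \prod_e k e (coord x e))%E => //.
rewrite integral_power_coord; last 2 first.
- move=> e; rewrite /k; case: (C e).
    exact: (@measurable_fun_fubini_tonelli_F _ _ _ _ _ p f mf f0).
  exact: measurable_cst.
- move=> e x; rewrite /k; apply: integral_ge0 => y _; case: ifP => _; first exact: f0.
  by [].
rewrite [RHS]big_mkcond/=; apply: eq_bigr => e _; rewrite /k; case: (C e) => //.
by under eq_integral do rewrite integral_prob_cst; rewrite integral_prob_cst.
Qed.

(** * Exponential moments of Gaussians *)

Section gauss_law.
Context (R : realType).
Local Notation leb := (@lebesgue_measure R).

Lemma integral_normal_prob (m s : R) (f : R -> R) : measurable_fun setT f -> (forall x, 0 <= f x) ->
  (\int[normal_prob m s]_x (f x)%:E = \int[leb]_x (f x * normal_pdf m s x)%:E)%E.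
Proof.
move=> mf f0.
have [nu [nuE nuI]] := exists_density leb (normal_pdf_ge0 m s) (measurable_normal_pdf m s).
by rewrite -nuI//; apply: eq_measure_integral => A mA _; rewrite nuE.
Qed.

(** The identity between two presentations of the Borel structure of the line; it
    transports the normal law to the structure used for tuples and products. *)
Definition retype (x : measurableTypeR R) : R := x.

Lemma measurable_retype : measurable_fun setT retype.
Proof. exact: measurable_id. Qed.

HB.instance Definition _ := isMeasurableFun.Build _ _ _ _ retype measurable_retype.

Definition gauss : probability R R :=
  distribution (normal_prob (0 : R) 1) (retype : {mfun measurableTypeR R >-> R}).
Local Notation gamma := gauss.

Lemma integral_gauss (f : R -> \bar R) : measurable_fun setT f -> (forall x, 0 <= f x)%E ->
  (\int[gamma]_x f x = \int[normal_prob (0 : R) 1]_x f x)%E.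
Proof. by move=> mf f0; rewrite ge0_integral_distribution. Qed.

Lemma integral_gauss_pdf (f : R -> R) : measurable_fun setT f -> (forall x, 0 <= f x) ->
  (\int[gamma]_x (f x)%:E = \int[leb]_x (f x * normal_pdf 0 1 x)%:E)%E.
Proof.
move=> mf f0; rewrite integral_gauss; first exact: integral_normal_prob.
- exact/measurable_EFinP.
- by move=> x; rewrite lee_fin.
Qed.

(** Completing the square: an exponential tilt of the standard normal density, quadratic
    of coefficient below 1/2, is a multiple of another normal density. *)
Lemma normal_tilt (t w x : R) : 0 < w ->
  expR (t * x + (1 - w) / 2 * x ^+ 2) * normal_pdf 0 1 x =
  (Num.sqrt w)^-1 * expR (t ^+ 2 / (2 * w)) * normal_pdf (t / w) (Num.sqrt w)^-1 x.
Proof.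
move=> w0; have sw0 : 0 < Num.sqrt w by rewrite sqrtr_gt0.
rewrite !normal_pdfE ?oner_neq0 ?invr_neq0 ?gt_eqF// /normal_peak /normal_fun.
have pi0 : 0 < pi *+ 2 :> R by rewrite mulrn_wgt0// pi_gt0.
have -> : Num.sqrt ((Num.sqrt w)^-1 ^+ 2 * pi *+ 2) = (Num.sqrt w)^-1 * Num.sqrt (pi *+ 2).
  rewrite -mulrnAr sqrtrM ?sqr_ge0// sqrtr_sqr ger0_norm// invr_ge0 ltW//.
have -> : Num.sqrt (1 ^+ 2 * pi *+ 2) = Num.sqrt (pi *+ 2) :> R by rewrite expr1n mul1r.
have -> : (Num.sqrt w)^-1 ^+ 2 = w^-1 by rewrite exprVn sqr_sqrtr// ltW.
have sP : 0 < Num.sqrt (pi *+ 2) :> R by rewrite sqrtr_gt0.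
move: (Num.sqrt (pi *+ 2)) (Num.sqrt w) sP sw0 => P S P0 S0.
have e : expR (t * x + (1 - w) / 2 * x ^+ 2) * expR (- (x - 0) ^+ 2 / (1 ^+ 2 *+ 2)) =
    expR (t ^+ 2 / (2 * w)) * expR (- (x - t / w) ^+ 2 / (w^-1 *+ 2)).
  rewrite -!expRD; congr expR; rewrite !mulr2n.
  by field; rewrite gt_eqF.
rewrite mulrCA e (_ : (S^-1 * P)^-1 = S * P^-1); last by rewrite invfM invrK.
move: (expR (t ^+ 2 / _)) (expR (- (x - _) ^+ 2 / _)) => e1 e2.
by field; rewrite !gt_eqF.
Qed.

Lemma mgf_normal (t u : R) : u < 2^-1 ->
  (\int[gamma]_x (expR (t * x + u * x ^+ 2))%:E =
   ((Num.sqrt (1 - 2 * u))^-1 * expR (t ^+ 2 / (2 * (1 - 2 * u))))%:E)%E.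
Proof.
move=> u2; set w := 1 - 2 * u; have w0 : 0 < w by rewrite /w; lra.
have -> : u = (1 - w) / 2 by rewrite /w; lra.
rewrite integral_gauss_pdf; last 2 first.
- apply: measurableT_comp => //; apply: measurable_funD; apply: measurable_funM => //.
- by move=> x; exact: expR_ge0.
under eq_integral do rewrite normal_tilt// EFinM.
rewrite ge0_integralZl//=; last 2 first.
- by apply/measurable_EFinP; exact: measurable_normal_pdf.
- by move=> x _; rewrite lee_fin normal_pdf_ge0.
by rewrite integral_normal_pdf mule1.
Qed.

Lemma mgf_normal_sqr (u : R) : u < 2^-1 ->
  (\int[gamma]_x (expR (u * x ^+ 2))%:E = ((Num.sqrt (1 - 2 * u))^-1)%:E)%E.
Proof.
move=> u2; have := mgf_normal 0 u2.
by rewrite expr0n/= mul0r expR0 mulr1 => <-; apply: eq_integral => x _; rewrite mul0r add0r.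
Qed.

Lemma mgf_normal_lin (t : R) :
  (\int[gamma]_x (expR (t * x))%:E = (expR (t ^+ 2 / 2))%:E)%E.
Proof.
have := @mgf_normal t 0; rewrite mulr0 subr0 sqrtr1 invr1 mul1r mulr1 => <-; last by lra.
by apply: eq_integral => x _; rewrite mul0r addr0.
Qed.

Lemma mgf_normal_prod (t : R) : t ^+ 2 < 1 ->
  (\int[gamma]_x \int[gamma]_y (expR (t * (x * y)))%:E =
   ((Num.sqrt (1 - t ^+ 2))^-1)%:E)%E.
Proof.
move=> t1; have t2 : t ^+ 2 / 2 < 2^-1 by lra.
transitivity (\int[gamma]_x (expR (t ^+ 2 / 2 * x ^+ 2))%:E)%E.
  apply: eq_integral => x _; under eq_integral do rewrite mulrA.
  by rewrite mgf_normal_lin exprMn mulrAC.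
by rewrite mgf_normal_sqr// mulrCA divff// mulr1.
Qed.

Lemma expRN_le (x : R) : `|x| <= 4^-1 -> expR (- (x + x ^+ 2)) <= 1 - x.
Proof.
move=> hx; have [x1 x2] : - 4^-1 <= x /\ x <= 4^-1 by apply/andP; rewrite -ler_norml.
rewrite expRN -[1 - x]invrK lef_pV2 ?posrE ?expR_gt0 ?invr_gt0//; last lra.
have [x0|x0] := leP 0 x.
  apply: (@le_trans _ _ ((1 + (x + x ^+ 2) / 2) ^+ 2)); last first.
    have -> : expR (x + x ^+ 2) = expR ((x + x ^+ 2) / 2) ^+ 2.
      by rewrite -expRM_natr; congr expR; field.
    have hp : 0 <= 1 + (x + x ^+ 2) / 2 by have := sqr_ge0 x; lra.
    apply: lerXn2r; rewrite ?nnegrE ?expR_ge0//.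
    exact: expR_ge1Dx.
  rewrite -div1r ler_pdivrMr; last lra.
  have x3 : 0 <= x ^+ 2 by exact: sqr_ge0.
  have h : 0 <= x ^+ 2 * (1 - 3 * x - x ^+ 2 - x ^+ 3).
    apply: mulr_ge0 => //; have h2 : x ^+ 2 <= 16^-1 by nra.
    have h3 : 0 <= x * (16^-1 - x ^+ 2) by apply: mulr_ge0 => //; lra.
    by rewrite exprS; lra.
  nra.
apply: (@le_trans _ _ (1 + (x + x ^+ 2))); last exact: expR_ge1Dx.
rewrite -div1r ler_pdivrMr; last lra.
have : 0 <= - x * x ^+ 2 by apply: mulr_ge0; [lra|exact: sqr_ge0].
nra.
Qed.

(** Accuracy to second order matters: in the applications the first-order terms either
    cancel or carry the main exponent. *)
Lemma inv_sqrt_le (x : R) : `|x| <= 4^-1 ->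
  (Num.sqrt (1 - x))^-1 <= expR (x / 2 + x ^+ 2 / 2).
Proof.
move=> hx; have [x1 x2] : - 4^-1 <= x /\ x <= 4^-1 by apply/andP; rewrite -ler_norml.
have s0 : 0 < Num.sqrt (1 - x) by rewrite sqrtr_gt0; lra.
rewrite -[leRHS]invrK lef_pV2 ?posrE ?invr_gt0 ?expR_gt0// -expRN.
rewrite -(@ler_pXn2r _ 2)// ?nnegrE ?expR_ge0 ?(ltW s0)// sqr_sqrtr ?subr_ge0; last lra.
apply: (@le_trans _ _ (expR (- (x + x ^+ 2)))); last exact: expRN_le.
by rewrite -expRM_natr ler_expR; lra.
Qed.

End gauss_law.
Arguments gauss {R}.

Section mgf.
Context d (T : measurableType d) (R : realType).
Local Open Scope ereal_scope.

(** A bound on the logarithm of the exponential moment of [U], bundled with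
    measurability so that it can be combined without side conditions. The exponent is kept
    inside [U]. *)
Definition mgf_le (P : probability T R) (U : T -> R) (a : R) :=
  measurable_fun setT U /\ \int[P]_x (expR (U x))%:E <= (expR a)%:E.

Variable P : probability T R.

Lemma measurable_expR_comp (U : T -> R) : measurable_fun setT U ->
  measurable_fun setT (fun x => (expR (U x))%:E).
Proof. by move=> mU; apply/measurable_EFinP; exact: measurableT_comp. Qed.

Lemma mgf_le_mono U a b : (a <= b)%R -> mgf_le P U a -> mgf_le P U b.
Proof.
by move=> ab [mU h]; split => //; apply: le_trans h _; rewrite lee_fin ler_expR.
Qed.

Lemma mgf_le_dom (U V : T -> R) a : measurable_fun setT U -> (forall x, U x <= V x)%R ->
  mgf_le P V a -> mgf_le P U a.
Proof.
move=> mU UV [mV h]; split => //; apply: le_trans h; apply: ge0_le_integral => //.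
- exact: measurable_expR_comp.
- exact: measurable_expR_comp.
- by move=> x _; rewrite lee_fin ler_expR.
Qed.

Lemma mgf_le_addc (U : T -> R) a c : mgf_le P U a -> mgf_le P (fun x => U x + c)%R (a + c)%R.
Proof.
move=> [mU h]; split; first exact: measurable_funD.
under eq_integral do rewrite expRD EFinM.
rewrite ge0_integralZr//; last exact: measurable_expR_comp.
by rewrite expRD EFinM lee_wpmul2r// lee_fin expR_ge0.
Qed.

(** Cauchy-Schwarz for exponential moments, in the form 2 u v <= u^2 + v^2 applied to
    the normalised exponentials. *)
Lemma mgf_leD (U V : T -> R) a b :
  mgf_le P (fun x => 2 * U x)%R (2 * a)%R -> mgf_le P (fun x => 2 * V x)%R (2 * b)%R ->
  mgf_le P (fun x => U x + V x)%R (a + b)%R.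
Proof.
move=> hU hV.
have mhalf (W : T -> R) : measurable_fun setT (fun x => 2 * W x)%R -> measurable_fun setT W.
  move=> mW; rewrite (_ : W = fun x => (2^-1 * (2 * W x))%R).
    exact: measurable_funM.
  by apply/funext => x; rewrite mulrA mulVf ?mul1r.
have mU := mhalf _ hU.1; have mV := mhalf _ hV.1.
split; first exact: measurable_funD.
have [mU2 IU] := mgf_le_addc (- (2 * a))%R hU; have [mV2 IV] := mgf_le_addc (- (2 * b))%R hV.
rewrite subrr expR0 in IU; rewrite subrr expR0 in IV.
pose K := (expR (a + b) / 2)%R.
apply: (@le_trans _ _ (\int[P]_x (K%:E * ((expR (2 * U x - 2 * a))%:E + (expR (2 * V x - 2 * b))%:E)))).
  apply: ge0_le_integral => //.
    - by apply: measurable_expR_comp; exact: measurable_funD.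
  - apply: emeasurable_funM => //; apply: emeasurable_funD;
    exact: measurable_expR_comp.
  - move=> x _; rewrite -EFinD -EFinM lee_fin /K.
    have -> : (U x + V x = (a + b) + ((U x - a) + (V x - b)))%R by ring.
    rewrite expRD -mulrA ler_wpM2l ?expR_ge0//.
    have -> : (2 * U x - 2 * a = (U x - a) * 2%:R)%R by ring.
    have -> : (2 * V x - 2 * b = (V x - b) * 2%:R)%R by ring.
    rewrite !expRM_natr expRD.
    have := sqr_ge0 (expR (U x - a) - expR (V x - b))%R; nra.
rewrite ge0_integralZl//; last 3 first.
- by apply: emeasurable_funD; exact: measurable_expR_comp.
- by move=> x _; rewrite adde_ge0.
- by rewrite lee_fin divr_ge0// expR_ge0.
rewrite ge0_integralD//; [|exact: measurable_expR_comp..].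
have -> : (expR (a + b))%:E = K%:E * (1 + 1).
  by rewrite -EFinD -EFinM /K divfK.
apply: lee_wpmul2l; first by rewrite lee_fin divr_ge0// expR_ge0.
exact: leeD IU IV.
Qed.

Lemma mgf_le_markov (U : T -> R) a c : mgf_le P U a ->
  P [set x | (c <= U x)%R] <= (expR (a - c))%:E.
Proof.
move=> /(mgf_le_addc (- c)%R) [mU h]; apply: le_trans h.
have mA : measurable [set x | (c <= U x)%R].
  have := mU measurableT [set` `[0%R, +oo[ ] (measurable_itv _); rewrite setTI.
  by congr measurable; apply/seteqP; split => x /=; rewrite in_itv/= andbT subr_ge0.
have -> : P [set x | (c <= U x)%R] = \int[P]_x (\1_[set x | (c <= U x)%R] x)%:E.
  by rewrite integral_indic ?setIT.
apply: ge0_le_integral => //.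
- exact/measurable_EFinP.
- exact: measurable_expR_comp.
- move=> x _; rewrite lee_fin indicE; case: (boolP (x \in _)) => [|_]; last exact: expR_ge0.
  rewrite inE/= => h0; apply: (@le_trans _ _ (1 + (U x - c))%R); first by lra.
  exact: expR_ge1Dx.
Qed.

End mgf.

(** * Exponential moments of quadratic forms *)

Lemma lee_prod (R : realDomainType) (I : Type) (r : seq I) (P : pred I) (f g : I -> \bar R) :
  (forall i, P i -> 0 <= f i <= g i)%E ->
  (\prod_(i <- r | P i) f i <= \prod_(i <- r | P i) g i)%E.
Proof.
move=> h; suff /andP[] : (0 <= \prod_(i <- r | P i) f i <= \prod_(i <- r | P i) g i)%E by [].
elim/big_ind2: _ => [|x1 x2 y1 y2 /andP[x0 x12] /andP[y0 y12]|//].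
  by rewrite lexx lee01.
by rewrite mule_ge0//= lee_pmul.
Qed.

Section mgf_combine.
Context d (T : measurableType d) (R : realType) (P : probability T R).

Lemma eq_mgf_le (U V : T -> R) (a b : R) : U =1 V -> a = b -> mgf_le P U a -> mgf_le P V b.
Proof. by move=> /funext -> ->. Qed.

Lemma mgf_leD4 (U1 U2 U3 U4 : T -> R) (a1 a2 a3 a4 : R) :
  mgf_le P (fun x => 4 * U1 x) (4 * a1) -> mgf_le P (fun x => 4 * U2 x) (4 * a2) ->
  mgf_le P (fun x => 4 * U3 x) (4 * a3) -> mgf_le P (fun x => 4 * U4 x) (4 * a4) ->
  mgf_le P (fun x => U1 x + U2 x + (U3 x + U4 x)) (a1 + a2 + (a3 + a4)).
Proof.
have h (U V : T -> R) a b : mgf_le P (fun x => 4 * U x) (4 * a) ->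
    mgf_le P (fun x => 4 * V x) (4 * b) ->
    mgf_le P (fun x => 2 * (U x + V x)) (2 * (a + b)).
  move=> hU hV; apply: (eq_mgf_le (U := fun x => 2 * U x + 2 * V x) (a := 2 * a + 2 * b)).
  - by move=> x; rewrite mulrDr.
  - by rewrite mulrDr.
  apply: mgf_leD.
  - by apply: eq_mgf_le hU => [x|]; ring.
  - by apply: eq_mgf_le hV => [x|]; ring.
by move=> h1 h2 h3 h4; apply: mgf_leD; exact: h.
Qed.

End mgf_combine.

Lemma mgf_power d (T : measurableType d) (R : realType) (p : probability T R)
    (E : finType) (f : E -> T -> R) (a : E -> R) :
  (forall e, mgf_le p (f e) (a e)) ->
  mgf_le (power p #|{: E}|) (fun t => \sum_e f e (coord t e)) (\sum_e a e).
Proof.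
move=> hf; split.
  apply: measurable_sum => e; apply: measurableT_comp; first exact: (hf e).1.
  exact: measurable_coord.
under eq_integral do rewrite expR_sum -prodEFin.
rewrite (@integral_power_coord _ _ _ _ _ (fun e x => (expR (f e x))%:E)); last 2 first.
- by move=> e; apply: measurable_expR_comp; exact: (hf e).1.
- by [].
rewrite expR_sum -prodEFin; apply: lee_prod => e _; apply/andP; split; last exact: (hf e).2.
exact: integral_ge0.
Qed.

Lemma mgf_power_pairs d (T : measurableType d) (R : realType) (p : probability T R)
    (E : finType) (C : pred E) (tau : {perm E}) (f : T * T -> R) (a : R) :
  measurable_fun setT f ->
  (\int[p]_x \int[p]_y (expR (f (x, y)))%:E <= (expR a)%:E)%E ->
  (forall e, C e -> ~~ C (tau e)) ->
  mgf_le (power p #|{: E}|) (fun t => \sum_(e | C e) f (coord t e, coord t (tau e)))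
    (a *+ #|C|).
Proof.
move=> mf hf hC; split.
  under eq_fun do rewrite big_mkcond/=.
  apply: measurable_sum => e; case: (C e); last exact: measurable_cst.
  by apply: measurableT_comp => //; apply: measurable_fun_pair; exact: measurable_coord.
under eq_integral do rewrite expR_sum -prodEFin.
rewrite (@integral_power_pairs _ _ _ _ _ C tau (fun z => (expR (f z))%:E))//; last first.
  exact: measurable_expR_comp.
rewrite -sumr_const expR_sum -prodEFin; apply: lee_prod => e _; apply/andP; split => //.
by apply: integral_ge0 => x _; exact: integral_ge0.
Qed.

(** Greedy colouring: [e] is only adjacent to [tau e] and to its preimage, so one of
    three colours is always free. Two colours would fail on odd cycles. *)
Lemma three_coloring (E : finType) (tau : {perm E}) :
  exists c : E -> 'I_3, forall e, tau e != e -> c (tau e) != c e.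
Proof.
suff [c hc] : exists c : E -> 'I_3, forall e, e \in enum E -> tau e \in enum E ->
    tau e != e -> c (tau e) != c e.
  by exists c => e; apply: hc; rewrite mem_enum.
elim: (enum E) => [|x s [c hc]]; first by exists (fun=> ord0).
have [k /andP[k1 k2]] : exists k : 'I_3, (k != c (tau x)) && (k != c ((tau^-1)%g x)).
  apply/existsP; apply: contraT; rewrite negb_exists => /forallP h.
  have : (#|[set c (tau x); c ((tau^-1)%g x)]%SET| <= 2)%N by rewrite cards2; case: (_ == _).
  rewrite leqNgt => /negP; case.
  apply: (@leq_trans #|'I_3|); first by rewrite card_ord.
  apply: subset_leq_card; apply/fintype.subsetP => k _.
  by have := h k; rewrite negb_and !negbK !inE.
exists (fun e => if e == x then k else c e) => e.
rewrite !inE; have [->|ex] := eqVneq e x => /=.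
  by move=> _ _ /negPf ->; rewrite eq_sym.
have [te|tx] := eqVneq (tau e) x => /=.
  by move=> _ _ _; rewrite (_ : e = (tau^-1)%g x) ?k2// -te permK.
exact: hc.
Qed.

Section gaussian_forms.
Context (R : realType).
Local Notation gamma := (@gauss R).

Lemma mgf_sqr (u : R) : `|u| <= 8^-1 -> mgf_le gamma (fun x => u * x ^+ 2) (u + 2 * u ^+ 2).
Proof.
move=> hu; split; first by apply: measurable_funM => //; exact: measurable_funX.
have [u1 u2] : - 8^-1 <= u /\ u <= 8^-1 by apply/andP; rewrite -ler_norml.
rewrite mgf_normal_sqr; last lra.
rewrite lee_fin; apply: le_trans (inv_sqrt_le _) _; last by rewrite ler_expR; lra.
by rewrite ler_norml; apply/andP; split; lra.
Qed.

Lemma mgf_prod (t : R) : t ^+ 2 <= 4^-1 ->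
  (\int[gamma]_x \int[gamma]_y (expR (t * (x * y)))%:E <= (expR (t ^+ 2))%:E)%E.
Proof.
move=> t4; have t0 := sqr_ge0 t; rewrite mgf_normal_prod; last lra.
rewrite lee_fin; apply: le_trans (inv_sqrt_le _) _; last by rewrite ler_expR; nra.
by rewrite ger0_norm.
Qed.

Variable E : finType.
Local Notation G := (power gamma #|{: E}|).

(** The edges moved by [tau] are split into three colour classes; inside a class the
    pairs [(e, tau e)] are independent. The three classes and the fixed points, where the
    form is a sum of squares, are recombined by Cauchy-Schwarz. The point is that moved
    edges only cost k^2 each, against k for fixed ones. *)
Lemma mgf_form_perm (tau : {perm E}) (D : pred E) (k : R) : 0 <= k <= 32^-1 ->
  mgf_le G (fun t => k * \sum_(e | D e) coord t e * coord t (tau e))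
    (4 * k ^+ 2 * #|[pred e | D e && (tau e != e)]|%:R +
     2 * k * #|[pred e | D e && (tau e == e)]|%:R).
Proof.
move=> /andP[k0 k32]; have [c hc] := three_coloring tau.
(* Colour class j of the moved edges, which tau maps outside itself. *)
pose C (j : 'I_3) : pred E := fun e => [&& D e, tau e != e & c e == j].
pose F : pred E := fun e => D e && (tau e == e).
have kk : (4 * k) ^+ 2 <= 4^-1 by nra.
have hC j : mgf_le G (fun t => 4 * (k * \sum_(e | C j e) coord t e * coord t (tau e)))
    (4 * (4 * k ^+ 2 * #|C j|%:R)).
  have := @mgf_power_pairs _ _ _ gamma E (C j) tau (fun z => 4 * k * (z.1 * z.2)) ((4 * k) ^+ 2).
  have -> : (4 * k) ^+ 2 *+ #|C j| = 4 * (4 * k ^+ 2 * #|C j|%:R).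
    by rewrite -mulr_natr; ring.
  have -> : (fun t : fam E R => \sum_(e | C j e) 4 * k * (coord t e * coord t (tau e))) =
      (fun t => 4 * (k * \sum_(e | C j e) coord t e * coord t (tau e))).
    by apply/funext => t; rewrite -mulr_sumr mulrA.
  apply.
  - by apply: measurable_funM => //; apply: measurable_funM.
  - exact: mgf_prod.
  - move=> e /and3P[_ te /eqP ce]; apply/and3P => -[_ _ /eqP ce'].
    by have := hc _ te; rewrite ce ce' eqxx.
have hF : mgf_le G (fun t => 4 * (k * \sum_(e | F e) coord t e * coord t (tau e)))
    (4 * (2 * k * #|F|%:R)).
  have := @mgf_power _ _ _ gamma E (fun e x => if F e then 4 * k * x ^+ 2 else 0)
    (fun e => if F e then 8 * k else 0).
  rewrite -big_mkcond/= sumr_const.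
  have -> : 8 * k *+ #|F| = 4 * (2 * k * #|F|%:R).
    by rewrite -mulr_natr; ring.
  have -> : (fun t : fam E R => \sum_e if F e then 4 * k * coord t e ^+ 2 else 0) =
      (fun t => 4 * (k * \sum_(e | F e) coord t e * coord t (tau e))).
    apply/funext => t; rewrite -big_mkcond/= mulrA mulr_sumr.
    by apply: eq_bigr => e /andP[_ /eqP ->].
  apply => e; case: (F e); last first.
    by split => //; rewrite integral_prob_cst expR0.
  apply: (mgf_le_mono _ (mgf_sqr _)); first by nra.
  by rewrite ger0_norm; lra.
have hx (x0 x1 x2 : 'I_3) (W : 'I_3 -> R) : x0 = ord0 -> x1 = lift ord0 ord0 ->
    x2 = lift ord0 (lift ord0 ord0) -> \sum_j W j = W x0 + W x1 + W x2.
  by move=> -> -> ->; rewrite !big_ord_recl big_ord0 addr0 addrA.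
have hmov (W : E -> R) : \sum_(e | D e && (tau e != e)) W e =
    \sum_(e | C ord0 e) W e + \sum_(e | C (lift ord0 ord0) e) W e +
    \sum_(e | C (lift ord0 (lift ord0 ord0)) e) W e.
  rewrite -(hx _ _ _ (fun j => \sum_(e | C j e) W e))//.
  rewrite (partition_big c predT)//=; apply: eq_bigr => j _.
  by apply: eq_bigl => e; rewrite /C andbA.
apply: eq_mgf_le (mgf_leD4 (hC ord0) (hC (lift ord0 ord0)) (hC (lift ord0 (lift ord0 ord0))) hF).
  move=> t; rewrite -!mulrDr addrA -hmov; congr (_ * _).
  by rewrite [RHS](bigID (fun e => tau e == e))/= addrC.
have -> : #|[pred e | D e && (tau e != e)]|%:R =
    #|C ord0|%:R + #|C (lift ord0 ord0)|%:R + #|C (lift ord0 (lift ord0 ord0))|%:R :> R.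
  have := hmov (fun=> 1); rewrite !sumr_const => <-.
  by [].
have -> : #|[pred e | D e && (tau e == e)]| = #|F| by [].
rewrite /=; ring.
Qed.

Lemma mgf_form (al be : {perm E}) (D : pred E) (k : R) : 0 <= k <= 32^-1 ->
  mgf_le G (fun t => k * \sum_(e | D e) coord t (al e) * coord t (be e))
    (4 * k ^+ 2 * #|[pred e | D e && (al e != be e)]|%:R +
     2 * k * #|[pred e | D e && (al e == be e)]|%:R).
Proof.
move=> hk; have := mgf_form_perm (al^-1 * be)%g (fun e => D ((al^-1)%g e)) hk.
apply: eq_mgf_le.
  move=> t; congr (_ * _); rewrite (reindex_inj (@perm_inj _ al))/=.
  by apply: eq_big => e; rewrite permK// permM permK.
have card_al (Q : pred E) : #|[pred e | Q ((al^-1)%g e)]| = #|Q|.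
  rewrite -!sum1_card (reindex_inj (@perm_inj _ al))/=.
  by apply: eq_bigl => e; rewrite !inE/= permK.
congr (_ * _%:R + _ * _%:R); rewrite -[RHS]card_al; apply: eq_card => e;
  by rewrite !inE/= permM permKV eq_sym.
Qed.

End gaussian_forms.

(** * The correlated pair and its density *)

Lemma exists_pushforward d d' (T1 : measurableType d) (T2 : measurableType d')
    (R : realType) (m : {measure set T1 -> \bar R}) (phi : T1 -> T2) :
  measurable_fun setT phi ->
  exists nu : {measure set T2 -> \bar R}, (forall A, nu A = m (phi @^-1` A)) /\
    (forall f : T2 -> \bar R, measurable_fun setT f -> (forall y, 0 <= f y)%E ->
      \int[nu]_y f y = \int[m]_x f (phi x))%E.
Proof.
move=> mphi.
have [nu nuE] : exists nu : {measure set T2 -> \bar R}, forall A, nu A = m (phi @^-1` A).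
  by unshelve eexists (pushforward m phi : {measure set T2 -> \bar R}).
exists nu; split => // f mf f0.
rewrite -[RHS](@ge0_integral_pushforward _ _ _ _ _ _ mphi m setT)//.
by apply: eq_measure_integral => A mA _; exact: nuE.
Qed.

Section affine.
Context (R : realType).
Local Notation leb := (@lebesgue_measure R).
Variables (m c : R).
Hypothesis c0 : 0 < c.

Let aff (z : R) : R := m + c * z.

Let measurable_aff : measurable_fun setT aff.
Proof. by apply: measurable_funD => //; exact: measurable_funM. Qed.

(** Translation and scaling of the line, from the uniqueness of Lebesgue measure on
    half-open intervals. *)
Lemma integral_lebesgue_affine (f : R -> R) : measurable_fun setT f -> (forall x, 0 <= f x) ->
  (\int[leb]_z (c * f (m + c * z))%:E = \int[leb]_x (f x)%:E)%E.
Proof.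
move=> mf f0.
have [nu0 [nu0E nu0I]] := @exists_pushforward _ _ _ _ _ leb
  (aff : measurableTypeR R -> measurableTypeR R) measurable_aff.
pose cn : {nonneg R} := NngNum (ltW c0).
pose nu := mscale cn nu0.
transitivity (\int[nu]_x (f x)%:E)%E; last first.
  apply: eq_measure_integral => A mA _; apply/esym.
  apply: (@lebesgue_measure_unique R nu) => //.
  move=> X [[a b]] _ <-; 
  transitivity (c%:E * leb (aff @^-1` `]a, b]%classic))%E; last by rewrite -nu0E.
  have -> : aff @^-1` `]a, b] = `](a - m) / c, (b - m) / c]%classic.
    apply/seteqP; split => z/=; rewrite !in_itv/= /aff ltr_pdivrMr// ler_pdivlMr//.
      by move=> /andP[h1 h2]; apply/andP; split; lra.
    by move=> /andP[h1 h2]; apply/andP; split; lra.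
  rewrite !lebesgue_measure_itv/= !lte_fin ltr_pM2r ?invr_gt0// ltrD2r.
  case: ifP => _; last by rewrite mule0.
  by rewrite -!EFinB -EFinM; congr EFin; field; rewrite gt_eqF.
have mEf : measurable_fun setT (fun x : measurableTypeR R => (f x)%:E).
  exact/measurable_EFinP.
transitivity (c%:E * \int[leb]_x (f (aff x))%:E)%E.
  rewrite -ge0_integralZl//.
  - by apply/measurable_EFinP; exact: (measurableT_comp mf measurable_aff).
  - by move=> x _; rewrite lee_fin.
  - by rewrite lee_fin ltW.
rewrite ge0_integral_mscale//; last by move=> x _; rewrite lee_fin.
congr (_ * _)%E; apply/esym; apply: nu0I => // y; rewrite lee_fin//.
Qed.

End affine.

Section bivariate.
Context (R : realType) (rho : R).
Local Notation gamma := (@gauss R).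
Local Notation c := (Num.sqrt (1 - rho ^+ 2)).

Definition correlate (z : R * R) : R * R := (z.1, rho * z.1 + c * z.2).

Lemma measurable_correlate : measurable_fun setT correlate.
Proof.
apply: measurable_fun_pair => //.
by apply: measurable_funD; apply: measurable_funM.
Qed.

HB.instance Definition _ := isMeasurableFun.Build _ _ _ _ correlate measurable_correlate.

Definition bivariate : probability (R * R)%type R :=
  distribution (gamma \x gamma)%E (correlate : {mfun (R * R)%type >-> (R * R)%type}).

(** [bivariate] is a bona fide probability on pairs of reals, so that powers of it can
    be formed; this links it to the law in the model. *)
Lemma bivariateE A : measurable A -> bivariate A = bivariate_normal rho A.
Proof.
move=> mA; have mB : measurable (correlate @^-1` A).
  by rewrite -[X in measurable X]setTI; exact: measurable_correlate.
transitivity (\int[gamma]_x (gamma \o xsection (correlate @^-1` A)) x)%E => //.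
by rewrite integral_gauss//; exact: (measurable_fun_xsection gamma mB).
Qed.

Lemma integral_bivariate (f : R * R -> \bar R) :
  measurable_fun setT f -> (forall z, 0 <= f z)%E ->
  (\int[bivariate]_z f z = \int[gamma]_x \int[gamma]_y f (x, rho * x + c * y)%R)%E.
Proof.
move=> mf f0; rewrite ge0_integral_distribution//.
apply: (@fubini_tonelli1 _ _ _ _ _ _ _ (f \o correlate)) => //.
  exact: (measurableT_comp mf measurable_correlate).
by move=> z; exact: f0.
Qed.

(** The density of the correlated pair with respect to a pair of independent standard
    Gaussians, also known as the Mehler kernel. *)
Definition lratio (z : R * R) : R :=
  (Num.sqrt (1 - rho ^+ 2))^-1 *
  expR ((2 * rho * (z.1 * z.2) - rho ^+ 2 * (z.1 ^+ 2 + z.2 ^+ 2)) / (2 * (1 - rho ^+ 2))).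

Lemma lratio_ge0 z : 0 <= lratio z.
Proof. by rewrite mulr_ge0 ?expR_ge0// invr_ge0 sqrtr_ge0. Qed.

Lemma measurable_lratio : measurable_fun setT lratio.
Proof.
apply: measurable_funM => //; apply: measurableT_comp => //; apply: measurable_funM => //.
apply: measurable_funB; apply: measurable_funM => //; first exact: measurable_funM.
by apply: measurable_funD; apply: measurable_funX.
Qed.

Hypothesis rho1 : rho ^+ 2 < 1.

Lemma lratio_gt0 z : 0 < lratio z.
Proof. by rewrite mulr_gt0 ?expR_gt0// invr_gt0 sqrtr_gt0 subr_gt0. Qed.

Lemma normal_pdf_lratio (x y : R) :
  normal_pdf (rho * x) c y = lratio (x, y) * normal_pdf 0 1 y.
Proof.
have c0 : 0 < c by rewrite sqrtr_gt0 subr_gt0.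
have w0 : 0 < 1 - rho ^+ 2 by rewrite subr_gt0.
rewrite !normal_pdfE ?oner_neq0 ?gt_eqF// /normal_peak /normal_fun /lratio/=.
rewrite -[_ * pi *+ 2]mulrnAr -[_ * pi *+ 2]mulrnAr sqrtrM ?sqr_ge0// sqrtr_sqr.
rewrite (ger0_norm (ltW c0)) expr1n mul1r sqr_sqrtr ?(ltW w0)//.
have sP : 0 < Num.sqrt (pi *+ 2) :> R by rewrite sqrtr_gt0 mulrn_wgt0// pi_gt0.
move: (Num.sqrt (pi *+ 2)) sP => P P0.
have -> : expR (- (y - rho * x) ^+ 2 / ((1 - rho ^+ 2) *+ 2)) =
  expR ((2 * rho * (x * y) - rho ^+ 2 * (x ^+ 2 + y ^+ 2)) / (2 * (1 - rho ^+ 2))) *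
  expR (- (y - 0) ^+ 2 / (1 *+ 2)).
  rewrite -!expRD; congr expR; rewrite !mulr2n; field.
  by rewrite !gt_eqF// addr_gt0.
move: c c0 => C C0; move: (expR _) (expR _) => e1 e2.
by field; rewrite !gt_eqF.
Qed.

Lemma integral_lratio (x : R) (f : R -> R) : measurable_fun setT f -> (forall y, 0 <= f y) ->
  (\int[gamma]_z (f (rho * x + c * z))%:E = \int[gamma]_y (f y * lratio (x, y))%:E)%E.
Proof.
move=> mf f0.
have c0 : 0 < c by rewrite sqrtr_gt0 subr_gt0.
have maff : measurable_fun setT (fun z : R => rho * x + c * z).
  by apply: measurable_funD => //; exact: measurable_funM.
have ml : measurable_fun setT (fun y => lratio (x, y)).
  by apply: (measurableT_comp measurable_lratio); exact: pair1_measurable.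
have mphi := measurable_normal_pdf (rho * x) c.
rewrite (integral_gauss_pdf (measurableT_comp mf maff))//.
rewrite (@integral_gauss_pdf _ (fun y => f y * lratio (x, y))); last 2 first.
- exact: measurable_funM.
- by move=> y; rewrite mulr_ge0// lratio_ge0.
transitivity (\int[@lebesgue_measure R]_y (f y * normal_pdf (rho * x) c y)%:E)%E; last first.
  by apply: eq_integral => y _; rewrite normal_pdf_lratio mulrA.
have := @integral_lebesgue_affine _ (rho * x) _ c0
  (fun y => f y * normal_pdf (rho * x) c y).
move=> <-; last 2 first.
- exact: (measurable_funM mf mphi).
- by move=> y; rewrite mulr_ge0// normal_pdf_ge0.
apply: eq_integral => z _; congr EFin; rewrite mulrCA; congr (_ * _).
rewrite !normal_pdfE ?oner_neq0 ?gt_eqF// /normal_peak /normal_fun.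
have -> : Num.sqrt (1 ^+ 2 * pi *+ 2) = Num.sqrt (pi *+ 2) :> R by rewrite expr1n mul1r.
have -> : Num.sqrt (c ^+ 2 * pi *+ 2) = c * Num.sqrt (pi *+ 2) :> R.
  by rewrite -mulrnAr sqrtrM ?sqr_ge0// sqrtr_sqr ger0_norm// ltW.
have sP : 0 < Num.sqrt (pi *+ 2) :> R by rewrite sqrtr_gt0 mulrn_wgt0// pi_gt0.
move: (Num.sqrt (pi *+ 2)) c sP c0 => P C P0 C0.
have -> : expR (- (rho * x + C * z - rho * x) ^+ 2 / (C ^+ 2 *+ 2)) =
    expR (- (z - 0) ^+ 2 / (1 ^+ 2 *+ 2)).
  congr expR; rewrite !mulr2n; field.
  by rewrite gt_eqF// addr_gt0// exprn_gt0.
move: (expR _) => e1; field.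
by rewrite !gt_eqF.
by move=> z; exact: f0.
Qed.

Lemma integral_bivariate_lratio (f : R * R -> R) :
  measurable_fun setT f -> (forall z, 0 <= f z) ->
  (\int[bivariate]_z (f z)%:E = \int[gamma]_x \int[gamma]_y (f (x, y) * lratio (x, y))%:E)%E.
Proof.
move=> mf f0; rewrite integral_bivariate//; last exact/measurable_EFinP.
apply: eq_integral => x _; rewrite -(integral_lratio _ (f := fun y => f (x, y)))//.
by apply: measurableT_comp => //; exact: pair1_measurable.
Qed.

End bivariate.

(** * The law of the observations *)

Lemma integral_power_zip d1 (T1 : measurableType d1) d2 (T2 : measurableType d2)
    (R : realType) (p : probability T1 R) (q : probability T2 R) (E : finType)
    (s : {perm E}) (h : E -> T1 * T2 -> \bar R) :
  (forall e, measurable_fun setT (h e)) -> (forall e z, (0 <= h e z)%E) ->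
  (\int[power p #|{: E}| \x power q #|{: E}|]_z
     (\prod_e h e (coord z.1 (s e), coord z.2 e)) =
   \prod_e \int[p]_x \int[q]_y h e (x, y))%E.
Proof.
move=> mh h0.
rewrite (@integral_prod_power _ _ _ q E _ _ (power p #|{: E}|)
  (fun e z => h e (coord z.1 (s e), z.2))); last 2 first.
- move=> e; apply: measurableT_comp => //; apply: measurable_fun_pair => //.
  exact: (measurableT_comp (measurable_coord _) measurable_fst).
- by [].
pose k e (x : T1) : \bar R := (\int[q]_y h ((s^-1)%g e) (x, y))%E.
transitivity (\int[power p #|{: E}|]_x \prod_e k e (coord x e))%E.
  apply: eq_integral => x _; rewrite [RHS](reindex_inj (@perm_inj _ s))/=.
  by apply: eq_bigr => e _; rewrite /k permK.
rewrite integral_power_coord.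
- rewrite (reindex_inj (@perm_inj _ s))/=.
  by apply: eq_bigr => e _; rewrite /k permK.
- by move=> e; exact: (@measurable_fun_fubini_tonelli_F _ _ _ _ _ q _ (mh _) (h0 _)).
- by move=> e x; exact: integral_ge0.
Qed.

Section correlated_families.
Context (R : realType) (rho : R) (E : finType).
Local Notation gamma := (@gauss R).
Local Notation G := (power gamma #|{: E}|).
Local Notation G2 := (G \x G)%E.
Local Notation bivE := (power (bivariate rho) #|{: E}|).

Lemma measurable_zip (s : {perm E}) : measurable_fun setT
  (fun z : fam E R * fam E R => of_fun (fun e => (coord z.1 (s e), coord z.2 e))).
Proof.
apply: measurable_of_fun => e; apply: measurable_fun_pair.
- exact: (measurableT_comp (measurable_coord _) measurable_fst).
- exact: (measurableT_comp (measurable_coord _) measurable_snd).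
Qed.

Let bivE1 A : measurable A ->
  bivariate rho A = (\int[gamma]_x \int[gamma]_y (\1_A (correlate rho (x, y)))%:E)%E.
Proof.
move=> mA; rewrite -(@integral_bivariate _ rho (fun z => (\1_A z)%:E)).
- have h := integral_indic (bivariate rho) measurableT mA.
  by rewrite setIT in h; exact/esym.
- exact/measurable_EFinP.
- by move=> z; rewrite lee_fin.
Qed.

Lemma power_bivariate_correlate (K : fam E (R * R)%type -> \bar R) :
  measurable_fun setT K -> (forall t, 0 <= K t)%E ->
  (\int[bivE]_t K t =
   \int[G2]_z K (of_fun (fun e => correlate rho (coord z.1 e, coord z.2 e))))%E.
Proof.
move=> mK K0.
have mphi : measurable_fun setT (fun z : fam E R * fam E R =>
    of_fun (fun e => correlate rho (coord z.1 e, coord z.2 e))).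
  apply: measurable_of_fun => e.
  apply: (measurableT_comp (measurable_correlate rho)); apply: measurable_fun_pair.
  - exact: (measurableT_comp (measurable_coord _) measurable_fst).
  - exact: (measurableT_comp (measurable_coord _) measurable_snd).
have [nu [nuE nuI]] := exists_pushforward G2 mphi.
rewrite -nuI//; apply: eq_measure_integral => A mA _.
rewrite -[LHS]mul1e; apply/esym; move: A mA.
apply: (@power_coord_unique _ _ _ (bivariate rho) E (1%:nng)%R nu) => F mF.
rewrite nuE/= mul1e.
have mFc e : measurable_fun setT (fun z => (\1_(F e) (correlate rho z))%:E : \bar R).
  apply/measurable_EFinP; apply: measurableT_comp => //; exact: measurable_correlate.
transitivity (\int[G2]_z \prod_e (\1_(F e) (correlate rho (coord z.1 e, coord z.2 e)))%:E)%E.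
  transitivity (\int[G2]_z (\1_([set t | forall e, F e (coord t e)]) (of_fun (fun e =>
      correlate rho (coord z.1 e, coord z.2 e))))%:E)%E; last first.
    apply: eq_integral => z _; rewrite -prod_indic_coord -prodEFin.
    by apply: eq_bigr => e _; rewrite coord_of_fun.
  rewrite -(nuI (fun t => (\1_([set t | forall e, F e (coord t e)]) t)%:E)).
  - by rewrite integral_indic ?setIT ?nuE//; exact: measurable_coord_box.
  - by apply/measurable_EFinP; apply: measurable_indic; exact: measurable_coord_box.
  - by move=> y; rewrite lee_fin.
have := @integral_power_zip _ _ _ _ _ gamma gamma E 1%g
  (fun e z => (\1_(F e) (correlate rho z))%:E) mFc (fun e z => _).
under eq_integral do under eq_bigr do rewrite perm1.
move=> ->; last by move=> e z; rewrite lee_fin.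
by apply: eq_bigr => e _; exact/esym/bivE1.
Qed.

Hypothesis rho1 : rho ^+ 2 < 1.

(** The relabelling [s] of the first coordinates allows the same reference law of
    independent vectors to serve for all latent permutations at once. *)
Lemma power_bivariate_density (s : {perm E}) (A : set (fam E (R * R)%type)) :
  measurable A ->
  (bivE A = \int[G2]_z (\1_A (of_fun (fun e => (coord z.1 (s e), coord z.2 e))) *
     \prod_e lratio rho (coord z.1 (s e), coord z.2 e))%:E)%E.
Proof.
have mz e : measurable_fun setT (fun z : fam E R * fam E R => (coord z.1 (s e), coord z.2 e)).
  apply: measurable_fun_pair.
  - exact: (measurableT_comp (measurable_coord _) measurable_fst).
  - exact: (measurableT_comp (measurable_coord _) measurable_snd).
pose g (z : fam E R * fam E R) := \prod_e lratio rho (coord z.1 (s e), coord z.2 e).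
have mg : measurable_fun setT g.
  apply: measurable_prod => e _; exact: (measurableT_comp (measurable_lratio rho) (mz e)).
have g0 z : 0 <= g z by apply: prodr_ge0 => e _; exact: lratio_ge0.
have [m [mE mI]] := exists_density G2 g0 mg.
have [nu [nuE nuI]] := exists_pushforward m (measurable_zip s).
have muse B : measurable B -> nu B =
    (\int[G2]_z (\1_B (of_fun (fun e => (coord z.1 (s e), coord z.2 e))) * g z)%:E)%E.
  move=> mB; transitivity (\int[nu]_t (\1_B t)%:E)%E; first by rewrite integral_indic ?setIT.
  rewrite nuI; last 2 first.
  - exact/measurable_EFinP.
  - by move=> y; rewrite lee_fin.
  apply: (mI (fun z => \1_B (of_fun (fun e => (coord z.1 (s e), coord z.2 e))))) => //.
  have mB1 : measurable_fun setT (\1_B : _ -> R) by exact: measurable_indic.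
  exact: (measurableT_comp mB1 (measurable_zip s)).
move=> mA; rewrite -muse// -[LHS]mul1e; apply/esym; move: A mA.
apply: (@power_coord_unique _ _ _ (bivariate rho) E (1%:nng)%R nu) => F mF.
rewrite muse/= ?mul1e; last exact: measurable_coord_box.
have mh e : measurable_fun setT (fun z => (\1_(F e) z * lratio rho z)%:E : \bar R).
  by apply/measurable_EFinP; apply: measurable_funM => //; exact: measurable_lratio.
transitivity (\int[G2]_z \prod_e (\1_(F e) (coord z.1 (s e), coord z.2 e) *
    lratio rho (coord z.1 (s e), coord z.2 e))%:E)%E.
  apply: eq_integral => z _; rewrite -prod_indic_coord prodEFin -big_split/=.
  by congr EFin; apply: eq_bigr => e _; rewrite coord_of_fun.
rewrite (@integral_power_zip _ _ _ _ _ gamma gamma E s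
  (fun e z => (\1_(F e) z * lratio rho z)%:E))//; last first.
  by move=> e z; rewrite lee_fin mulr_ge0// lratio_ge0.
apply: eq_bigr => e _; rewrite -integral_bivariate_lratio//.
by rewrite integral_indic ?setIT.
Qed.

End correlated_families.

Lemma perm_edge_inj n (s : 'S_n) : injective (perm_edge s).
Proof.
move=> e f /(congr1 val)/= h; apply: val_inj => /=.
exact: (imset_inj (@perm_inj _ s) h).
Qed.

Definition edge_perm n (s : 'S_n) : {perm edge n} := perm (@perm_edge_inj n s).

Section model_law.
Context (R : realType) (n : nat) (d : measure_display) (T : measurableType d)
  (P : probability T R) (rho : R) (pi : {RV P >-> 'S_n}) (A B : {RV P >-> obs n R}).
Hypothesis hmodel : correlated_gaussian rho pi A B.

(** The product rule of the model concerns boxes; by uniqueness of the power it extends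
    to all events on the matched family. *)
Lemma model_joint_law (s : 'S_n) (H : set (fam (edge n) (R * R)%type)) : measurable H ->
  P [set w | pi w = s /\
     H (of_fun (fun e => (entry (A w) (perm_edge s e), entry (B w) e)))] =
  (n`!%:R^-1%:E * power (bivariate rho) #|{: edge n}| H)%E.
Proof.
move=> mH.
have mpi : measurable [set w | pi w = s].
  exact: (measurable_funPTI pi (Y := [set s])).
pose phi w := of_fun (fun e => (entry (A w) (perm_edge s e), entry (B w) e)).
have mphi : measurable_fun setT phi.
  apply: measurable_of_fun => e; apply: measurable_fun_pair.
  - exact: (measurableT_comp (measurable_coord (perm_edge s e)) (measurable_funP A)).
  - exact: (measurableT_comp (measurable_coord e) (measurable_funP B)).
have [nu [nuE _]] := exists_pushforward (mrestr P mpi) mphi.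
have nuE' X : nu X = P [set w | pi w = s /\ X (phi w)].
  rewrite nuE /mrestr; congr (P _).
  by apply/seteqP; split => w /= [].
rewrite -nuE'.
have k0 : 0 <= n`!%:R^-1 :> R by rewrite invr_ge0.
pose k : {nonneg R} := NngNum k0.
apply: (@power_coord_unique _ _ _ (bivariate rho) (edge n) k nu) => // F mF.
rewrite nuE'.
have [h1 h2] := hmodel; have := h2 s F mF; rewrite h1.
under eq_bigr do rewrite -bivariateE//.
move=> <-; congr (P _); apply/seteqP; split => w /= [-> h]; split => // e; have := h e.
  by rewrite coord_of_fun.
by rewrite coord_of_fun.
Qed.

End model_law.

(** * Chernoff bounds for sums of matched products *)

Lemma mgf_le_if d (T : measurableType d) (R : realType) (P : probability T R)
    (b : bool) (U : T -> R) (a : R) : (b -> mgf_le P U a) ->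
  mgf_le P (fun x => if b then U x else 0) (if b then a else 0).
Proof.
case: b => [h|_]; first exact: h.
by split; [exact: measurable_cst|rewrite integral_prob_cst].
Qed.

Section chernoff.
Context (R : realType) (rho : R) (E : finType).
Local Notation gamma := (@gauss R).
Local Notation G := (power gamma #|{: E}|).
Local Notation W := (power (bivariate rho) #|{: E}|).
Local Notation c := (Num.sqrt (1 - rho ^+ 2)).
Hypothesis rho01 : 0 < rho <= 1.

Let cE : c ^+ 2 = 1 - rho ^+ 2.
Proof.
case/andP: rho01 => r0 r1; rewrite sqr_sqrtr//.
nra.
Qed.

Let c1 : c ^+ 2 <= 1. Proof. by rewrite cE gerBl sqr_ge0. Qed.

(** Given the first coordinates [x], the second ones are independent normal variables of
    means [rho * x e] and variance [1 - rho ^+ 2]; integrating them out leaves an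
    exponential moment of a function of [x] alone. *)
Lemma mgf_correlate (u : E -> fam E R -> R) (a : R) :
  (forall e, measurable_fun setT (u e)) ->
  mgf_le G (fun x => \sum_e (rho * u e x * coord x e + c ^+ 2 / 2 * u e x ^+ 2)) a ->
  mgf_le W (fun t => \sum_e u e (of_fun (fun f => (coord t f).1)) * (coord t e).2) a.
Proof.
move=> mu [mU hU].
have mfst : measurable_fun setT (fun t : fam E (R * R)%type => of_fun (fun f => (coord t f).1)).
  by apply: measurable_of_fun => e; apply: (measurableT_comp measurable_fst (measurable_coord e)).
have mUY : measurable_fun setT (fun t : fam E (R * R)%type =>
    \sum_e u e (of_fun (fun f => (coord t f).1)) * (coord t e).2).
  apply: measurable_sum => e; apply: measurable_funM.
    exact: (measurableT_comp (mu e) mfst).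
  exact: (measurableT_comp measurable_snd (measurable_coord e)).
split => //; apply: le_trans hU.
rewrite (power_bivariate_correlate rho (measurable_expR_comp mUY))//.
pose h e (z : fam E R * R) : \bar R :=
  (expR (rho * u e z.1 * coord z.1 e + c * u e z.1 * z.2))%:E.
rewrite le_eqVlt; apply/orP; left; apply/eqP.
transitivity (\int[G \x G]_z \prod_e h e (z.1, coord z.2 e))%E.
  apply: eq_integral => z _; rewrite expR_sum -prodEFin; apply: eq_bigr => e _.
  rewrite /h/= coord_of_fun/=; congr (EFin (expR _)).
  have -> : of_fun (fun f => (coord (of_fun (fun e0 => correlate rho
      (coord z.1 e0, coord z.2 e0))) f).1) = z.1.
    by rewrite -[RHS]of_fun_coord; congr of_fun; apply/funext => f; rewrite coord_of_fun.
  by ring.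
rewrite (@integral_prod_power _ _ _ gamma E _ _ G h); last 2 first.
- move=> e; apply: measurable_expR_comp; apply: measurable_funD; apply: measurable_funM => //.
  + apply: measurable_funM => //; exact: (measurableT_comp (mu e) measurable_fst).
  + exact: (measurableT_comp (measurable_coord e) measurable_fst).
  + apply: measurable_funM => //; exact: (measurableT_comp (mu e) measurable_fst).
- by move=> e z; rewrite lee_fin expR_ge0.
apply: eq_integral => x _; rewrite expR_sum -prodEFin; apply: eq_bigr => e _.
rewrite /h/=; under eq_integral do rewrite expRD EFinM.
rewrite ge0_integralZl//; last first.
  by apply: measurable_expR_comp; exact: measurable_funM.
rewrite mgf_normal_lin -EFinM -expRD; congr (EFin (expR _)).
by ring.
Qed.

Section moved.
Variable tau : {perm E}.

(** The exponential tilt is rho/2 times the difference of the two sums. Once the second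
    coordinates are integrated out, the exponent is at most -s sum_e (x_(tau e) - x_e)^2 as
    soon as 8 s <= rho^2; expanding the square leaves a sum of squares, which gives the
    gain, and a form along [tau] of second order. *)
Lemma chernoff_swap (s : R) : 0 <= s <= 128^-1 -> 8 * s <= rho ^+ 2 ->
  (W [set t | (\sum_e (coord t e).1 * (coord t e).2 <=
             \sum_e (coord t (tau e)).1 * (coord t e).2)%R] <=
   (expR (#|[pred e | tau e != e]|%:R * (- 2 * s + 48 * s ^+ 2)))%:E)%E.
Proof.
move=> /andP[s0 s1] srho; case/andP: rho01 => r0 r1.
set M := [pred e | tau e != e].
have ms e : measurable_fun setT (fun x : fam E R => coord x e) by exact: measurable_coord.
(* Among the multiples of the difference of the scores, rho / 2 is near optimal when rho
   is small. *)
pose u e (x : fam E R) := rho / 2 * (coord x (tau e) - coord x e).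
have mu e : measurable_fun setT (u e).
  by apply: measurable_funM => //; exact: measurable_funB.
have h1 : mgf_le G (fun x => 2 * (- 2 * s * \sum_(e | M e) coord x e ^+ 2))
    (2 * (#|M|%:R * (- 2 * s + 16 * s ^+ 2))).
  have := @mgf_power _ _ _ gamma E (fun e x => if M e then - 4 * s * x ^+ 2 else 0)
    (fun e => if M e then - 4 * s + 32 * s ^+ 2 else 0).
  rewrite -big_mkcond/= sumr_const => h; apply: (eq_mgf_le _ _ (h _)).
  - by move=> x; rewrite -big_mkcond/= -mulr_sumr; ring.
  - by rewrite -mulr_natl; ring.
  move=> e; apply: mgf_le_if => _.
  apply: (mgf_le_mono _ (mgf_sqr _)); first by nra.
  by rewrite mulNr normrN ger0_norm; lra.
have h2 : mgf_le G (fun x => 2 * (2 * s * \sum_(e | M e) coord x e * coord x (tau e)))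
    (2 * (#|M|%:R * (32 * s ^+ 2))).
  have hk : 0 <= 4 * s <= 32^-1 by apply/andP; split; lra.
  apply: eq_mgf_le (mgf_form_perm tau M hk) => [x|]; first by rewrite mulrA; congr (_ * _); ring.
  have -> : #|[pred e | M e && (tau e != e)]| = #|M| by apply: eq_card => e; rewrite !inE andbb.
  have -> : #|[pred e | M e && (tau e == e)]| = 0%N.
    by apply: eq_card0 => e; rewrite !inE; case: (tau e == e).
  by rewrite mulr0; ring.
have h3 := mgf_leD h1 h2.
have h4 : mgf_le W (fun t => \sum_e u e (of_fun (fun f => (coord t f).1)) * (coord t e).2)
    (#|M|%:R * (- 2 * s + 48 * s ^+ 2)).
  apply: mgf_correlate => //.
  apply: mgf_le_dom (eq_mgf_le (fun=> erefl) _ h3); last by ring.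
    apply: measurable_sum => e; apply: measurable_funD.
      by apply: measurable_funM => //; exact: measurable_funM.
    by apply: measurable_funM => //; exact: measurable_funX.
  move=> x.
  have hD : \sum_e (coord x (tau e) - coord x e) ^+ 2 =
      2 * (\sum_(e | M e) coord x e ^+ 2 - \sum_(e | M e) coord x e * coord x (tau e)).
    have hM : \sum_(e | M e) coord x (tau e) ^+ 2 = \sum_(e | M e) coord x e ^+ 2.
      rewrite [RHS](reindex_inj (@perm_inj _ tau))/=; apply: eq_bigl => e.
      by rewrite (inj_eq perm_inj).
    rewrite (bigID M)/= [X in _ + X]big1 ?addr0; last first.
      by move=> e; rewrite negbK => /eqP ->; rewrite subrr expr0n.
    rewrite mulrBr mulr2n mulrDl mul1r -{1}hM -big_split/= mulr_sumr -sumrB.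
    by apply: eq_bigr => e _; ring.
  have hX : \sum_e (coord x (tau e) - coord x e) * coord x e =
      - (2^-1 * \sum_e (coord x (tau e) - coord x e) ^+ 2).
    have hE : \sum_e coord x (tau e) ^+ 2 = \sum_e coord x e ^+ 2.
      by rewrite [RHS](reindex_inj (@perm_inj _ tau)).
    apply/eqP; rewrite -addr_eq0 mulr_sumr -big_split/=; apply/eqP.
    transitivity (\sum_e (2^-1 * coord x (tau e) ^+ 2 - 2^-1 * coord x e ^+ 2)).
      by apply: eq_bigr => e _; field.
    by rewrite sumrB -!mulr_sumr hE subrr.
  have -> : \sum_e (rho * u e x * coord x e + c ^+ 2 / 2 * u e x ^+ 2) =
      (- (rho ^+ 2 / 4) + c ^+ 2 * rho ^+ 2 / 8) * \sum_e (coord x (tau e) - coord x e) ^+ 2.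
    rewrite big_split/=.
    have -> : \sum_e rho * u e x * coord x e =
        rho ^+ 2 / 2 * \sum_e (coord x (tau e) - coord x e) * coord x e.
      by rewrite mulr_sumr; apply: eq_bigr => e _; rewrite /u; ring.
    have -> : \sum_e c ^+ 2 / 2 * u e x ^+ 2 =
        c ^+ 2 * rho ^+ 2 / 8 * \sum_e (coord x (tau e) - coord x e) ^+ 2.
      by rewrite mulr_sumr; apply: eq_bigr => e _; rewrite /u; field.
    by rewrite hX; field.
  have D0 : 0 <= \sum_e (coord x (tau e) - coord x e) ^+ 2.
    by apply: sumr_ge0 => e _; exact: sqr_ge0.
  have -> : - 2 * s * \sum_(e | M e) coord x e ^+ 2 +
      2 * s * \sum_(e | M e) coord x e * coord x (tau e) =
      - s * \sum_e (coord x (tau e) - coord x e) ^+ 2 by rewrite hD; ring.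
  apply: ler_wpM2r => //.
  have : 0 <= (1 - c ^+ 2) * rho ^+ 2 by rewrite mulr_ge0 ?sqr_ge0// subr_ge0.
  lra.
have := mgf_le_markov 0 h4; rewrite subr0; apply: le_trans.
rewrite le_eqVlt; apply/orP; left; apply/eqP; congr (W _).
apply/seteqP; split => t /= ht.
  have -> : \sum_e u e (of_fun (fun f => (coord t f).1)) * (coord t e).2 =
     rho / 2 * (\sum_e (coord t (tau e)).1 * (coord t e).2 - \sum_e (coord t e).1 * (coord t e).2).
    rewrite -sumrB mulr_sumr; apply: eq_bigr => e _; rewrite /u !coord_of_fun; ring.
  by rewrite mulr_ge0 ?subr_ge0// divr_ge0// ltW.
move: ht.
have -> : \sum_e u e (of_fun (fun f => (coord t f).1)) * (coord t e).2 =
   rho / 2 * (\sum_e (coord t (tau e)).1 * (coord t e).2 - \sum_e (coord t e).1 * (coord t e).2).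
  rewrite -sumrB mulr_sumr; apply: eq_bigr => e _; rewrite /u !coord_of_fun; ring.
by rewrite pmulr_rge0 ?subr_ge0// divr_gt0.
Qed.

Variable D : pred E.

(** The sum is unrelated to its second factors except on the at most [k] fixed edges:
    tilted by [rho], it behaves like a centred Gaussian of variance #|D|, which gives the
    1/2 in the exponent. *)
Lemma chernoff_wrong_sum (eta : R) (k : nat) : rho ^+ 2 <= 64^-1 ->
  (#|[pred e | D e && (tau e == e)]| <= k)%N ->
  (W [set t | (rho * #|D|%:R * (1 - eta) <=
             \sum_(e | D e) (coord t (tau e)).1 * (coord t e).2)%R] <=
   (expR (- rho ^+ 2 * #|D|%:R * (2^-1 - eta - 9 * rho ^+ 2) + 2 * rho ^+ 2 * k%:R))%:E)%E.
Proof.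
move=> r64 hk; case/andP: rho01 => r0 r1.
have ms e : measurable_fun setT (fun x : fam E R => coord x e) by exact: measurable_coord.
pose u e (x : fam E R) := if D e then rho * coord x (tau e) else 0.
have mu e : measurable_fun setT (u e).
  by rewrite /u; case: (D e) => //; exact: measurable_funM.
have r2 := sqr_ge0 rho.
have h1 : mgf_le G (fun x => 2 * (rho ^+ 2 / 2 * \sum_(e | D e) coord x (tau e) ^+ 2))
    (2 * (#|D|%:R * (rho ^+ 2 / 2 + rho ^+ 4))).
  have := @mgf_power _ _ _ gamma E (fun e x => if D ((tau^-1)%g e) then rho ^+ 2 * x ^+ 2 else 0)
    (fun e => if D ((tau^-1)%g e) then rho ^+ 2 + 2 * rho ^+ 4 else 0).
  move=> h; apply: (eq_mgf_le _ _ (h _)).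
  - move=> x; rewrite -big_mkcond/= (reindex_inj (@perm_inj _ tau))/= mulrA mulr_sumr.
    by apply: eq_big => [e|e _]; [rewrite permK|field].
  - rewrite -big_mkcond/= (reindex_inj (@perm_inj _ tau))/=.
    rewrite (eq_bigl D); last by move=> e; rewrite /= permK.
    by rewrite sumr_const -mulr_natl; field.
  move=> e; apply: mgf_le_if => _.
  apply: (mgf_le_mono _ (mgf_sqr _)); first by nra.
  by rewrite ger0_norm; lra.
have h2 : mgf_le G (fun x => 2 * (rho ^+ 2 * \sum_(e | D e) coord x e * coord x (tau e)))
    (2 * (8 * rho ^+ 4 * #|D|%:R + 2 * rho ^+ 2 * k%:R)).
  have hk2 : 0 <= 2 * rho ^+ 2 <= 32^-1 by apply/andP; split; lra.
  apply: (mgf_le_mono _ (eq_mgf_le _ erefl (mgf_form_perm tau D hk2))); last first.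
    by move=> x; rewrite mulrA.
  have k1 : #|[pred e | D e && (tau e == e)]|%:R <= k%:R :> R by rewrite ler_nat.
  have k2 : #|[pred e | D e && (tau e != e)]|%:R <= #|D|%:R :> R.
    by rewrite ler_nat; apply: subset_leq_card; apply/fintype.subsetP => e /andP[].
  have r4 : 0 <= rho ^+ 4 by rewrite -[4%N]/(2 * 2)%N exprM sqr_ge0.
  have := ler_wpM2l r2 k1; have := ler_wpM2l r4 k2.
  have -> : (2 * rho ^+ 2) ^+ 2 = 4 * rho ^+ 4 by ring.
  lra.
have h4 : mgf_le W (fun t => \sum_e u e (of_fun (fun f => (coord t f).1)) * (coord t e).2)
    (#|D|%:R * (rho ^+ 2 / 2 + rho ^+ 4) + (8 * rho ^+ 4 * #|D|%:R + 2 * rho ^+ 2 * k%:R)).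
  apply: mgf_correlate => //.
  apply: mgf_le_dom (mgf_leD h1 h2).
    apply: measurable_sum => e; apply: measurable_funD.
      by apply: measurable_funM => //; exact: measurable_funM.
    by apply: measurable_funM => //; exact: measurable_funX.
  move=> x; rewrite big_split/= addrC; apply: lerD.
    rewrite mulr_sumr [leRHS]big_mkcond/=; apply: ler_sum => e _; rewrite /u; case: (D e).
      have : 0 <= (1 - c ^+ 2) * (rho * coord x (tau e)) ^+ 2.
        by rewrite mulr_ge0 ?sqr_ge0// subr_ge0.
      lra.
    by rewrite expr0n/= mulr0.
  rewrite mulr_sumr [leRHS]big_mkcond/=; apply: ler_sum => e _; rewrite /u; case: (D e).
    by rewrite [X in _ <= X](_ : _ = rho * (rho * coord x (tau e)) * coord x e)//; ring.
  by rewrite mulr0 mul0r.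
have := mgf_le_markov (rho * (rho * #|D|%:R * (1 - eta))) h4.
have -> : #|D|%:R * (rho ^+ 2 / 2 + rho ^+ 4) + (8 * rho ^+ 4 * #|D|%:R + 2 * rho ^+ 2 * k%:R) -
   rho * (rho * #|D|%:R * (1 - eta)) =
   - rho ^+ 2 * #|D|%:R * (2^-1 - eta - 9 * rho ^+ 2) + 2 * rho ^+ 2 * k%:R by field.
apply: le_trans; rewrite le_eqVlt; apply/orP; left; apply/eqP; congr (W _).
have hS t : \sum_e u e (of_fun (fun f => (coord t f).1)) * (coord t e).2 =
    rho * \sum_(e | D e) (coord t (tau e)).1 * (coord t e).2.
  rewrite mulr_sumr [RHS]big_mkcond/=; apply: eq_bigr => e _; rewrite /u.
  by case: (D e); rewrite ?mul0r ?coord_of_fun//; ring.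
by apply/seteqP; split => t /=; rewrite hS ler_pM2l.
Qed.

End moved.

(** The sum has mean [rho * #|D|]; the deviation [eta] below the mean is reached by the
    tilt [- eta * rho]. *)
Lemma chernoff_true_sum (D : pred E) (eta : R) : rho ^+ 2 <= 8^-1 -> 0 < eta <= 1 ->
  (W [set t | (\sum_(e | D e) (coord t e).1 * (coord t e).2 <= rho * #|D|%:R * (1 - eta))%R] <=
   (expR (- #|D|%:R * rho ^+ 2 * eta ^+ 2 / 4))%:E)%E.
Proof.
move=> r8 /andP[eta0 eta1]; case/andP: rho01 => r0 r1.
have ms e : measurable_fun setT (fun x : fam E R => coord x e) by exact: measurable_coord.
pose u e (x : fam E R) := if D e then - (eta * rho) * coord x e else 0.
have mu e : measurable_fun setT (u e).
  by rewrite /u; case: (D e) => //; exact: measurable_funM.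
have r2 := sqr_ge0 rho.
have h1 : mgf_le G (fun x => - (eta * rho ^+ 2 * (1 - eta / 2)) * \sum_(e | D e) coord x e ^+ 2)
    (#|D|%:R * (- eta * rho ^+ 2 + eta ^+ 2 * rho ^+ 2 / 2 + 2 * eta ^+ 2 * rho ^+ 4)).
  have := @mgf_power _ _ _ gamma E (fun e x => if D e then - (eta * rho ^+ 2 * (1 - eta / 2)) * x ^+ 2 else 0)
    (fun e => if D e then - eta * rho ^+ 2 + eta ^+ 2 * rho ^+ 2 / 2 + 2 * eta ^+ 2 * rho ^+ 4 else 0).
  move=> h; apply: (eq_mgf_le _ _ (h _)).
  - by move=> x; rewrite mulr_sumr [RHS]big_mkcond.
  - by rewrite -big_mkcond/= sumr_const -[LHS]mulr_natl.
  have er : 0 <= eta * rho ^+ 2 by rewrite mulr_ge0// ltW.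
  have er1 : eta * rho ^+ 2 <= 8^-1 by nra.
  move=> e; apply: mgf_le_if => _.
  apply: (mgf_le_mono _ (mgf_sqr _)).
    have h0 : 0 <= (eta * rho ^+ 2) ^+ 2 * (1 - (1 - eta / 2) ^+ 2).
      by apply: mulr_ge0; [exact: sqr_ge0|nra].
    have -> : 2 * eta ^+ 2 * rho ^+ 4 = 2 * (eta * rho ^+ 2) ^+ 2 by ring.
    rewrite sqrrN exprMn; nra.
  rewrite normrN ger0_norm; last by apply: mulr_ge0 => //; lra.
  nra.
have h4 : mgf_le W (fun t => \sum_e u e (of_fun (fun f => (coord t f).1)) * (coord t e).2)
    (#|D|%:R * (- eta * rho ^+ 2 + eta ^+ 2 * rho ^+ 2 / 2 + 2 * eta ^+ 2 * rho ^+ 4)).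
  apply: mgf_correlate => //.
  apply: mgf_le_dom h1.
    apply: measurable_sum => e; apply: measurable_funD.
      by apply: measurable_funM => //; exact: measurable_funM.
    by apply: measurable_funM => //; exact: measurable_funX.
  move=> x; rewrite mulr_sumr [leRHS]big_mkcond/=; apply: ler_sum => e _; rewrite /u.
  case: (D e); last by rewrite mulr0 mul0r expr0n/= mulr0 addr0.
  have hz : 0 <= (1 - c ^+ 2) * (eta * rho * coord x e) ^+ 2.
    by rewrite mulr_ge0 ?sqr_ge0// subr_ge0.
  nra.
have hS t : \sum_e u e (of_fun (fun f => (coord t f).1)) * (coord t e).2 =
    - (eta * rho) * \sum_(e | D e) (coord t e).1 * (coord t e).2.
  rewrite mulr_sumr [RHS]big_mkcond/=; apply: eq_bigr => e _; rewrite /u.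
  by case: (D e); rewrite ?mul0r ?coord_of_fun//; ring.
have er : 0 < eta * rho by rewrite mulr_gt0.
have := mgf_le_markov (- (eta * rho) * (rho * #|D|%:R * (1 - eta))) h4.
move=> h5; apply: le_trans (le_trans h5 _).
  rewrite le_eqVlt; apply/orP; left; apply/eqP; congr (W _).
  by apply/seteqP; split => t /=; rewrite hS !mulNr lerN2 ler_pM2l.
rewrite lee_fin ler_expR.
have h0 : 0 <= #|D|%:R * (rho ^+ 2 * eta ^+ 2) * (4^-1 - 2 * rho ^+ 2).
  by apply: mulr_ge0; [do 2 (apply: mulr_ge0 => //; rewrite ?sqr_ge0//)|lra].
have -> : rho ^+ 4 = rho ^+ 2 * rho ^+ 2 by ring.
nra.
Qed.

End chernoff.

(** * Edges and permutations *)

Section edges.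
Variable n : nat.
Implicit Types (s t : 'S_n) (S : {set 'I_n}).

Definition agree s t : {set 'I_n} := finset (fun i => s i == t i).

Definition inside S : pred (edge n) := fun e => val e \subset S.

Lemma card_inside S : #|inside S| = 'C(#|S|, 2).
Proof.
rewrite -cards_draws -(card_imset _ val_inj); apply: eq_card => A.
rewrite [RHS]inE; apply/imsetP/andP => [[e eS ->]|[AS A2]].
  by split; [exact: eS|exact: (valP e)].
by exists (Sub A A2); rewrite ?SubK// /in_mem/= /inside SubK.
Qed.

Lemma card_edge : #|{: edge n}| = 'C(n, 2).
Proof.
have := card_inside [set: 'I_n]%SET; rewrite cardsT card_ord => <-.
by apply: eq_card => e; apply/esym/finset.subsetT.
Qed.

Lemma perm_edge_agree s t e : inside (agree s t) e -> perm_edge s e = perm_edge t e.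
Proof.
move=> /fintype.subsetP h; apply: val_inj => /=; apply: eq_in_imset => i /h.
by rewrite inE => /eqP.
Qed.

(** An edge with the same image under [s] and [t] on which they disagree is the pair
    formed by a point [i] where they differ and by [t^-1 (s i)], so the points of
    disagreement enumerate these edges. *)
Lemma card_crossing s t :
  (#|[pred e : edge n | ~~ inside (agree s t) e && (perm_edge s e == perm_edge t e)]|
   <= #|(~: agree s t)%SET|)%N.
Proof.
(* The only edge at i, with i a point of disagreement, that can have the same image
   under s and t. *)
pose f i : {set 'I_n} := (i |: [set (t^-1)%g (s i)])%SET.
apply: (@leq_trans #|f @: (~: agree s t)%SET|); last exact: leq_imset_card.
rewrite -(card_imset _ val_inj); apply: subset_leq_card; apply/fintype.subsetP => A.
move=> /imsetP[e /andP[/subsetPn[i ie iS] /eqP st] ->]; apply/imsetP; exists i.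
  by rewrite inE.
have e2 : #|val e| = 2%N by apply/eqP; exact: (valP e).
have := imset_f s ie; rewrite -[s @: val e]/(val (perm_edge s e)) st /= => /imsetP[j je sj].
rewrite /f sj permK; apply/eqP; rewrite eq_sym eqEcard; apply/andP; split.
  by apply/fintype.subsetP => x; rewrite !inE => /orP[] /eqP ->.
rewrite e2 cards2; case: eqVneq => // ij.
by move: iS; rewrite inE {1}ij in sj *; rewrite ?ij sj eqxx.
Qed.

(** Composing with the inverse of [s] turns [t] into a permutation that only moves
    points outside [S]. *)
Lemma card_same_agree s S : (#|[pred t | agree s t == S]| <= (#|(~: S)%SET|)`!)%N.
Proof.
rewrite -card_perm -(card_imset _ (@mulIg _ (s^-1)%g)).
apply: subset_leq_card; apply/fintype.subsetP => u /imsetP[t /eqP <- ->].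
rewrite unfold_in; apply/fintype.subsetP => i; rewrite !inE permM; apply: contraNN => /eqP <-.
by rewrite permK.
Qed.

End edges.

Lemma sum_agree_le (R : realType) n (s : 'S_n) (Q : pred {set 'I_n}) (f : {set 'I_n} -> R) :
  (forall S, 0 <= f S) ->
  \sum_(t | Q (agree s t)) f (agree s t) <=
  \sum_(S | Q S) (#|(~: S)%SET|)`!%:R * f S.
Proof.
move=> f0; rewrite (partition_big (agree s) Q)//=; apply: ler_sum => S QS.
rewrite (eq_bigr (fun=> f S)); last by move=> t /andP[_ /eqP ->].
rewrite sumr_const -[leLHS]mulr_natl ler_wpM2r// ler_nat.
apply: leq_trans (card_same_agree s S); apply: subset_leq_card.
by apply/fintype.subsetP => t; rewrite !inE => /andP[].
Qed.

Lemma ffact_le_expn n k : (n ^_ k <= n ^ k)%N.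
Proof.
by elim: k => [|k IH]//; rewrite ffactnSr expnSr leq_mul// leq_subr.
Qed.

(** At most [n ^ k] permutations differ from [s] on exactly [k] points: choose the
    points, then a permutation of them. *)
Lemma sum_moved_le (R : realType) n (s : 'S_n) (f : nat -> R) : (forall k, 0 <= f k) ->
  \sum_(t | t != s) f #|(~: agree s t)%SET| <= \sum_(k < n) n%:R ^+ k.+1 * f k.+1.
Proof.
move=> f0.
have hst t : (t != s) = (0 < #|(~: agree s t)%SET|)%N.
  rewrite card_gt0 -finset.setCT (inj_eq (can_inj finset.setCK)).
  apply/idP/idP; apply: contraNN => /eqP h; apply/eqP.
    by apply/permP => i; have := finset.in_setT i; rewrite -h inE => /eqP.
  by rewrite h; apply/setP => i; rewrite !inE eqxx.
under eq_bigl do rewrite hst.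
apply: le_trans (@sum_agree_le R n s (fun S => (0 < #|(~: S)%SET|)%N)
  (fun S => f #|(~: S)%SET|) (fun S => f0 _)) _.
rewrite (reindex_inj (inv_inj (@finset.setCK _)))/=.
under eq_bigr do rewrite finset.setCK.
under eq_bigl do rewrite finset.setCK.
have hn (S : {set 'I_n}) : (#|S| < n.+1)%N.
  by rewrite ltnS; have := max_card (mem S); rewrite card_ord.
rewrite (partition_big (fun S => Ordinal (hn S)) (fun k : 'I_n.+1 => 0 < k)%N)//=.
rewrite big_mkcond/= big_ord_recl/= add0r; apply: ler_sum => k _ /=.
rewrite (eq_bigr (fun=> (k.+1)`!%:R * f k.+1)); last first.
  by move=> S /andP[_ /eqP/(congr1 val)/= ->].
rewrite sumr_const -[leLHS]mulr_natl mulrA ler_wpM2r// -natrM -natrX ler_nat.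
apply: leq_trans (ffact_le_expn n k.+1); rewrite -bin_ffact leq_mul2r; apply/orP; right.
have -> : 'C(n, k.+1) = #|[set A : {set 'I_n} | #|A| == k.+1]%SET|.
  by rewrite card_draws card_ord.
apply: subset_leq_card.
by apply/fintype.subsetP => S; rewrite !inE => /andP[_ /eqP/(congr1 val)/= ->].
Qed.

(** * Elementary estimates and union bounds *)

(** The only asymptotic input: log n exceeds any constant, and its square is negligible
    with respect to n. *)
Lemma near_ln (R : realType) (K : R) :
  \forall n \near \oo, [/\ K <= ln n%:R, K * ln n%:R ^+ 2 <= n%:R & (0 < n)%N].
Proof.
(* 27 comes from n = exp (L / 3)^3 >= (L / 3)^3, where L = log n. *)
pose K1 := 27 * (`|K| + 1).
near=> n.
have n0 : (0 < n)%N by near: n; exact: nbhs_infty_gt.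
have hn : expR K1 <= n%:R by near: n; exact: nbhs_infty_ger.
have nR : (0 : R) < n%:R by rewrite ltr0n.
have hL : K1 <= ln n%:R by rewrite -(expRK K1) ler_ln// posrE expR_gt0.
have K0 := ler_norm K; have K2 := normr_ge0 K.
have L1 : 1 <= ln n%:R :> R by rewrite /K1 in hL; lra.
split => //; first by rewrite /K1 in hL; lra.
have e1 : n%:R = expR (ln n%:R / 3) ^+ 3 :> R by rewrite -expRM_natr divfK// lnK.
rewrite [leRHS]e1; have := expR_ge1Dx (ln n%:R / 3 : R).
move: (ln n%:R) (expR (ln n%:R / 3)) hL L1 => L x hL L1 hx.
have hx3 : (L / 3) ^+ 3 <= x ^+ 3 by apply: lerXn2r; rewrite ?nnegrE; lra.
apply: le_trans hx3; rewrite (_ : (L / 3) ^+ 3 = L / 27 * L ^+ 2); last by field.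
by apply: ler_wpM2r; [exact: sqr_ge0|rewrite /K1 in hL; lra].
Unshelve. all: by end_near. Qed.

Lemma sum_geo_le (R : realType) (q : R) n : 0 <= q <= 2^-1 ->
  \sum_(k < n) q ^+ k.+1 <= 2 * q.
Proof.
move=> /andP[q0 q2]; suff : \sum_(k < n) q ^+ k.+1 <= 2 * q * (1 - q ^+ n).
  have := exprn_ge0 n q0; nra.
elim: n => [|n IH]; first by rewrite big_ord0 expr0 subrr mulr0.
rewrite big_ord_recr/= !exprS.
have : 0 <= q * q ^+ n * (1 - 2 * q).
  by rewrite mulr_ge0 ?mulr_ge0 ?exprn_ge0//; lra.
nra.
Qed.

Lemma measurable_exists2 d (T : measurableType d) (I : finType) (Q : pred I) (A : I -> set T) :
  (forall i, measurable (A i)) -> measurable [set x | exists2 i, Q i & A i x].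
Proof.
move=> mA; rewrite (_ : mkset _ = \big[setU/set0]_(i <- index_enum I | Q i) A i).
  by apply: bigsetU_measurable.
rewrite -bigcup_seq_cond; apply/seteqP; split => x /=.
  by move=> [i Qi Ai]; exists i => //=; rewrite mem_index_enum.
by move=> [i /= /andP[_ Qi] Ai]; exists i.
Qed.

Lemma measure_union_le d (T : measurableType d) (R : realType)
    (P : {measure set T -> \bar R}) (I : finType) (Q : pred I) (A : I -> set T) :
  (forall i, measurable (A i)) ->
  (P [set x | exists2 i, Q i & A i x] <= \sum_(i | Q i) P (A i))%E.
Proof.
move=> mA.
have mU (r : seq I) : measurable [set x | exists2 i, (i \in r) && Q i & A i x].
  rewrite (_ : mkset _ = \big[setU/set0]_(i <- r | Q i) A i).
    by apply: bigsetU_measurable.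
  rewrite -bigcup_seq_cond; apply/seteqP; split => x /=.
    by move=> [i iQ Ai]; exists i.
  by move=> [i /= iQ Ai]; exists i.
suff h (r : seq I) : (P [set x | exists2 i, (i \in r) && Q i & A i x] <= \sum_(i <- r | Q i) P (A i))%E.
  apply: le_trans (h (index_enum I)); rewrite le_eqVlt; apply/orP; left; apply/eqP.
  congr (P _); apply/seteqP; split => x /= [i iQ Ax]; exists i => //.
    by rewrite mem_index_enum.
  by case/andP: iQ.
elim: r => [|i r IH].
  rewrite big_nil (_ : mkset _ = set0) ?measure0//.
  by apply/seteqP; split => x //= [].
rewrite big_cons; case: (boolP (Q i)) => Qi.
  apply: le_trans (leeD (lexx _) IH).
  apply: le_trans (measureU2 _ _ _) => //.
  rewrite le_measure ?inE//; first exact: measurableU.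
  move=> x [j /andP[]]; rewrite inE => /orP[/eqP ->|jr] Qj Ax; [by left|].
  by right; exists j => //; rewrite jr.
apply: le_trans IH; rewrite le_measure ?inE//.
move=> x [j /andP[]]; rewrite inE => /orP[/eqP ->|jr] Qj Ax; first by rewrite Qj in Qi.
by exists j => //; rewrite jr.
Qed.

Lemma natr_bin2 (R : realType) m : 'C(m, 2)%:R = m%:R * (m%:R - 1) / 2 :> R.
Proof.
elim: m => [|m IH]; first by rewrite bin0n/= !mul0r.
by rewrite binS bin1 natrD IH -natr1; field.
Qed.

Lemma card_outside (R : realType) n (S : {set 'I_n}) :
  #|[predC inside S]|%:R =
    #|(~: S)%SET|%:R * (2 * n%:R - #|(~: S)%SET|%:R - 1) / 2 :> R.
Proof.
have h1 : #|inside S|%:R + #|[predC inside S]|%:R = 'C(n, 2)%:R :> R.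
  by rewrite -natrD cardC card_edge.
have h2 : #|S|%:R + #|(~: S)%SET|%:R = n%:R :> R by rewrite -natrD cardsC card_ord.
have -> : #|[predC inside S]|%:R = 'C(n, 2)%:R - #|inside S|%:R :> R by rewrite -h1; ring.
rewrite card_inside !natr_bin2; move: h2; move: (_%:R) (_%:R) => x y.
by move=> <-; field.
Qed.

(** * Exact recovery above the threshold *)

Lemma measurable_le_set d (T : measurableType d) (R : realType) (f g : T -> R) :
  measurable_fun setT f -> measurable_fun setT g -> measurable [set x | f x <= g x].
Proof.
move=> mf mg; have mh : measurable_fun setT (fun x => g x - f x) by exact: measurable_funB.
have := mh measurableT [set` `[0%R, +oo[ ] (measurable_itv _); rewrite setTI.
by congr measurable; apply/seteqP; split => x /=; rewrite in_itv/= andbT subr_ge0.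
Qed.

Section recovery.
Context (R : realType) (n : nat) (rho : R).
Local Notation W := (power (bivariate rho) #|{: edge n}|).
Local Notation data := (fam (edge n) (R * R)%type).
Hypothesis rho01 : 0 < rho <= 1.

(** The likelihood score of [t] restricted to the edges in [D], on data already
    relabelled by the latent permutation; the truth corresponds to [t = 1]. *)
Definition match_sum (D : pred (edge n)) (t : 'S_n) (u : data) : R :=
  \sum_(e | D e) (coord u (perm_edge t e)).1 * (coord u e).2.

Lemma measurable_match_sum D t : measurable_fun setT (match_sum D t).
Proof.
rewrite (_ : match_sum D t = fun u => \sum_e
    if D e then (coord u (perm_edge t e)).1 * (coord u e).2 else 0); last first.
  by apply/funext => u; rewrite /match_sum [LHS]big_mkcond.
apply: measurable_sum => e; case: (D e) => //; apply: measurable_funM.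
- exact: (measurableT_comp measurable_fst (measurable_coord _)).
- exact: (measurableT_comp measurable_snd (measurable_coord _)).
Qed.

(** The event that the identity, hence the true permutation, is not strictly preferred
    to [t]. The non-strict inequality covers every tie-breaking rule. *)
Definition beaten (t : 'S_n) : set data :=
  [set u | match_sum predT 1%g u <= match_sum predT t u].

Lemma measurable_beaten t : measurable (beaten t).
Proof. by apply: measurable_le_set; exact: measurable_match_sum. Qed.

Let perm_edge1 e : perm_edge (1%g : 'S_n) e = e.
Proof.
apply: val_inj => /=; rewrite (eq_imset (g := id)) ?imset_id// => i.
by rewrite perm1.
Qed.

Let match1 D (u : data) : match_sum D 1%g u = \sum_(e | D e) (coord u e).1 * (coord u e).2.
Proof. by apply: eq_bigr => e _; rewrite perm_edge1. Qed.

Let matchE D t (u : data) :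
  match_sum D t u = \sum_(e | D e) (coord u (edge_perm t e)).1 * (coord u e).2.
Proof. by apply: eq_bigr => e _; rewrite permE. Qed.

Let moved (t : 'S_n) := #|(~: agree 1%g t)%SET|.
Let crossing (t : 'S_n) : pred (edge n) := [predC inside (agree 1%g t)].

Let card_fixed_crossing t :
  (#|[pred e | crossing t e && (edge_perm t e == e)]| <= moved t)%N.
Proof.
apply: leq_trans (card_crossing 1%g t); apply: subset_leq_card.
by apply/fintype.subsetP => e; rewrite !inE permE perm_edge1 eq_sym.
Qed.

Let card_moved_edges t : (moved t)%:R * (2 * n%:R - (moved t)%:R - 3) / 2 <=
  #|[pred e : edge n | edge_perm t e != e]|%:R :> R.
Proof.
have h := card_outside R (agree 1%g t).
have h2 : #|crossing t|%:R <= (moved t)%:R + #|[pred e : edge n | edge_perm t e != e]|%:R :> R.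
  rewrite -natrD ler_nat.
  rewrite -(cardID [pred e | edge_perm t e == e] (crossing t)); apply: leq_add.
    apply: leq_trans (card_fixed_crossing t); apply: subset_leq_card.
    by apply/fintype.subsetP => e; rewrite !inE.
  by apply: subset_leq_card; apply/fintype.subsetP => e; rewrite !inE => /andP[].
rewrite /crossing h -/(moved t) in h2; lra.
Qed.

Lemma beaten_few_moved (s : R) t : 0 <= s <= 128^-1 -> 8 * s <= rho ^+ 2 ->
  (W (beaten t) <= (expR (- (s * (1 - 24 * s) * ((moved t)%:R * (2 * n%:R - (moved t)%:R - 3)))))%:E)%E.
Proof.
move=> hs h8; have := @chernoff_swap R rho _ rho01 (edge_perm t) s hs h8.
have -> : [set u : data | \sum_e (coord u e).1 * (coord u e).2 <=
    \sum_e (coord u (edge_perm t e)).1 * (coord u e).2] = beaten t.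
  by apply/seteqP; split => u; rewrite /beaten/= match1 matchE.
move=> h; apply: le_trans h _; rewrite lee_fin ler_expR.
case/andP: hs => s0 s1.
have h0 : 0 <= s * (1 - 24 * s) by apply: mulr_ge0 => //; lra.
have := ler_wpM2l h0 (card_moved_edges t); lra.
Qed.

Definition wrong_large (eta : R) (t : 'S_n) : set data :=
  [set u | rho * #|crossing t|%:R * (1 - eta) <= match_sum (crossing t) t u].

(** Indexed by the set of fixed points and not by the permutation: this is what reduces
    its union bound to 2^n events. *)
Definition true_small (eta : R) (S : {set 'I_n}) : set data :=
  [set u | match_sum [predC inside S] 1%g u <= rho * #|[predC inside S]|%:R * (1 - eta)].

(** On edges inside the fixed set both scores coincide and cancel, so on the remaining
    edges one of the scores must be on the wrong side of the level. *)
Lemma beaten_subset eta t : beaten t `<=` wrong_large eta t `|` true_small eta (agree 1%g t).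
Proof.
move=> u; rewrite /beaten /wrong_large /true_small/= => h.
have split_sum s : {in inside (agree 1%g t), forall e, perm_edge s e = e} ->
    match_sum predT s u = \sum_(e | inside (agree 1%g t) e) (coord u e).1 * (coord u e).2 +
    match_sum (crossing t) s u.
  move=> hs; rewrite /match_sum (bigID (inside (agree 1%g t)))/=; congr (_ + _).
  by apply: eq_bigr => e he; rewrite hs.
have e1 := split_sum 1%g (fun e _ => perm_edge1 e).
have e2 : {in inside (agree 1%g t), forall e, perm_edge t e = e}.
  by move=> e he; rewrite -(perm_edge_agree he) perm_edge1.
move: h; rewrite e1 (split_sum t e2) lerD2l => h; have [h1|h1] := leP (rho * #|crossing t|%:R * (1 - eta))
  (match_sum (crossing t) t u); [by left|right].
by rewrite -/(crossing t) ltW// (le_lt_trans h h1).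
Qed.

Lemma wrong_large_le eta t : rho ^+ 2 <= 64^-1 ->
  (W (wrong_large eta t) <= (expR (- rho ^+ 2 *
    ((moved t)%:R * (2 * n%:R - (moved t)%:R - 1) / 2) * (2^-1 - eta - 9 * rho ^+ 2)
    + 2 * rho ^+ 2 * (moved t)%:R))%:E)%E.
Proof.
move=> r64; have := @chernoff_wrong_sum R rho _ rho01 (edge_perm t) (crossing t) eta _ r64
  (card_fixed_crossing t).
rewrite /wrong_large /crossing card_outside -/(moved t).
apply: le_trans; rewrite le_eqVlt; apply/orP; left; apply/eqP; congr (W _).
by apply/seteqP; split => u /=; rewrite matchE.
Qed.

Lemma true_small_le eta (S : {set 'I_n}) : rho ^+ 2 <= 8^-1 -> 0 < eta <= 1 ->
  (W (true_small eta S) <= (expR (- (#|(~: S)%SET|%:R * (2 * n%:R - #|(~: S)%SET|%:R - 1) / 2) *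
     rho ^+ 2 * eta ^+ 2 / 4))%:E)%E.
Proof.
move=> r8 heta; have := @chernoff_true_sum R rho (edge n) rho01 [predC inside S] eta r8 heta.
rewrite card_outside; apply: le_trans.
rewrite le_eqVlt; apply/orP; left; apply/eqP; congr (W _).
by rewrite /true_small card_outside; apply/seteqP; split => u /=; rewrite match1.
Qed.

End recovery.

Section exponents.
Context (R : realType) (e q n k : R).
Hypotheses (e01 : 0 < e <= 1) (q0 : 0 <= q) (qe : q * (100 * 100 * 100) <= e) (ne : (100 * 100 * 100) <= n * e).
Hypotheses (k0 : 0 <= k) (kn : k <= n).

Let facts : [/\ 0 < e, e <= 1, 0 <= q /\ q * (100 * 100 * 100) <= e,
  100 * 100 * 100 <= n * e /\ 100 * 100 * 100 <= n & 0 <= k /\ k <= n].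
Proof.
move: e01 q0 qe ne k0 kn => /andP[h1 h2] h3 h4 h5 h6 h7; split => //; split => //.
have : 0 <= (1 - e) * n by apply: mulr_ge0; lra.
lra.
Qed.

(** Case of a signal far above the threshold: here [q] stands for log n / n and [k] for
    the number of moved points, and the direct comparison of scores suffices for every
    [k]. *)
Lemma exponent_strong (s : R) : s = 3 / 2 * q ->
  (1 + e / 16) * (q * n) * k <= s * (1 - 24 * s) * (k * (2 * n - k - 3)).
Proof.
have [e0 e1 [q0' qe'] [ne' n0] [k0' kn']] := facts.
move=> ->; have h : (1 + e / 16) * n <= 3 / 2 * (1 - 36 * q) * (2 * n - k - 3).
  have h1 : 36 * q <= 1 / 100 by lra.
  have h2 : 0 <= (1 / 100 - 36 * q) * (2 * n - k - 3) by apply: mulr_ge0; lra.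
  have h3 : 0 <= (1 - e) * n by apply: mulr_ge0; lra.
  lra.
have qk : 0 <= q * k by exact: mulr_ge0.
have := ler_wpM2l qk h; lra.
Qed.

(** Direct comparison for few moved points: [2 * n - k] is nearly [2 * n] and the tilt
    may be as large as (4 + e) q / 8. *)
Lemma exponent_few (s : R) : s = (4 + e) / 8 * q -> k * 16 <= e * n ->
  (1 + e / 16) * (q * n) * k <= s * (1 - 24 * s) * (k * (2 * n - k - 3)).
Proof.
have [e0 e1 [q0' qe'] [ne' n0] [k0' kn']] := facts.
move=> -> hk.
have h : (1 + e / 16) * n <= (4 + e) / 8 * (1 - 3 * (4 + e) * q) * (2 * n - k - 3).
  have h1 : 3 * (4 + e) * q <= e / 100 by nra.
  have h2 : n * (2 - e / 8) <= 2 * n - k - 3 by lra.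
  have hA : 0 <= (4 + e) / 8 * (1 - e / 100) by apply: mulr_ge0; lra.
  have hB : (4 + e) / 8 * (1 - e / 100) <= (4 + e) / 8 * (1 - 3 * (4 + e) * q).
    by apply: ler_wpM2l; lra.
  have hC : 0 <= 2 * n - k - 3 by lra.
  apply: le_trans (ler_wpM2r hC hB).
  apply: le_trans (ler_wpM2l hA h2).
  have -> : (4 + e) / 8 * (1 - e / 100) * (n * (2 - e / 8)) =
    ((4 + e) / 8 * (1 - e / 100) * (2 - e / 8)) * n by ring.
  apply: ler_wpM2r; first by lra.
  nra.
have qk : 0 <= q * k by exact: mulr_ge0.
have := ler_wpM2l qk h; lra.
Qed.

(** With the fixed level, the exponent is r k (2 n - k) / 4 up to small corrections,
    twice the one of the direct comparison, so that [k <= n] is enough. *)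
Lemma exponent_wrong (r : R) : (4 + e) * q <= r -> r <= 12 * q ->
  (1 + e / 16) * (q * n) * k <=
  r * (k * (2 * n - k - 1) / 2) * (2^-1 - e / 64 - 9 * r) - 2 * r * k.
Proof.
have [e0 e1 [q0' qe'] [ne' n0] [k0' kn']] := facts.
move=> r1 r2.
have h0 : 0 <= (2 * n - k - 1) / 2 * (2^-1 - e / 64 - 9 * r) - 2 - (n - 1) / 2 * (2^-1 - e / 32) + 2.
  have h1 : 9 * r <= e / 64 by lra.
  have h3 : 0 <= (2 * n - k - 1) / 2 * (e / 64 - 9 * r) by apply: mulr_ge0; lra.
  have h4 : 0 <= (n - k) / 2 * (2^-1 - e / 32) by apply: mulr_ge0; lra.
  lra.
have h1 : (1 + e / 16) * n <= (4 + e) * ((n - 1) / 2 * (2^-1 - e / 32) - 2).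
  have : 0 <= e * (1 - e) * n.
    by apply: mulr_ge0; [apply: mulr_ge0|]; lra.
  nra.
have h2 : 0 <= (n - 1) / 2 * (2^-1 - e / 32) - 2.
  have : 0 <= (n - 1) * (2^-1 - e / 32 - 4^-1) by apply: mulr_ge0; lra.
  lra.
have h3 : 0 <= r * ((2 * n - k - 1) / 2 * (2^-1 - e / 64 - 9 * r) - 2 - ((n - 1) / 2 * (2^-1 - e / 32) - 2)).
  by apply: mulr_ge0; nra.
have h4 : 0 <= (r - (4 + e) * q) * ((n - 1) / 2 * (2^-1 - e / 32) - 2).
  by apply: mulr_ge0 => //; lra.
have qk : 0 <= q * k by exact: mulr_ge0.
have h5 := mulr_ge0 k0 h3; have h6 := mulr_ge0 k0 h4.
have := ler_wpM2l qk h1; lra.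
Qed.

(** A linear number of moved points involves quadratically many edges, so the exponent
    is of order n log n and dominates the entropy of the 2^n sets. *)
Lemma exponent_true (r : R) : (4 + e) * q <= r -> e * n <= k * 16 ->
  (100 * 100 * 100) <= e ^+ 3 * (q * n) ->
  2 * n <= k * (2 * n - k - 1) / 2 * r * (e / 64) ^+ 2 / 4.
Proof.
have [e0 e1 [q0' qe'] [ne' n0] [k0' kn']] := facts.
move=> r1 hk hq.
have h1 : n * (n / 2) * (e / 32) <= k * (2 * n - k - 1) / 2.
  have a1 : 0 <= (k - e * n / 16) * (2 * n - k - 1) by apply: mulr_ge0; lra.
  have a2 : 0 <= (e * n) * (n / 2 - 1) by apply: mulr_ge0; [apply: mulr_ge0|]; lra.
  have a3 : 0 <= (e * n) * (n - k) by apply: mulr_ge0; [apply: mulr_ge0|]; lra.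
  lra.
have eq0 : 0 <= e * q by apply: mulr_ge0 => //; exact: ltW.
have r4 : 4 * q <= r by lra.
have z0 : 0 <= (e / 64) ^+ 2 / 4 by rewrite divr_ge0// sqr_ge0.
have h2 : (n * (n / 2) * (e / 32)) * (4 * q) <= k * (2 * n - k - 1) / 2 * r.
  apply: ler_pM => //; last by lra.
  by apply: mulr_ge0; [apply: mulr_ge0|]; lra.
have := ler_wpM2r z0 h2.
have : 0 <= n * (e ^+ 3 * (q * n) - (100 * 100 * 100)) by apply: mulr_ge0; lra.
nra.
Qed.

End exponents.

Lemma expR1_ge2 (R : realType) : 2 <= expR 1 :> R.
Proof. by have := expR_ge1Dx (1 : R); lra. Qed.

Lemma sum_subsets_le (R : realType) (n : nat) (Q : pred {set 'I_n}) (f : {set 'I_n} -> R) :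
  (forall S, Q S -> f S <= expR (- (2 * n%:R))) -> \sum_(S | Q S) f S <= expR (- n%:R).
Proof.
move=> h; apply: le_trans (ler_sum _ h) _; rewrite sumr_const -[leLHS]mulr_natl.
apply: (@le_trans _ _ (expR n%:R * expR (- (2 * n%:R)))).
  apply: ler_wpM2r; first exact: expR_ge0.
  apply: (@le_trans _ _ ((2 ^ n)%N%:R)).
    rewrite ler_nat; apply: leq_trans (max_card _) _.
    by rewrite -cardsT -powersetT card_powerset cardsT card_ord.
  rewrite natrX -[n%:R]mulr1 expRM_natl; apply: lerXn2r; rewrite ?nnegrE ?expR_ge0//.
  exact: expR1_ge2.
by rewrite -expRD ler_expR; lra.
Qed.

Section exact_recovery.
Context (R : realType) (n : nat) (rho e : R).
Local Notation W := (power (bivariate rho) #|{: edge n}|).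
Local Notation L := (ln n%:R : R).

(** Union bound over permutations and over sets. A permutation is excluded by the direct
    comparison if the signal is strong or if it moves few points, and otherwise by its score
    exceeding the level. *)
Lemma some_beaten_le : 0 < rho <= 1 -> 0 < e <= 1 -> (0 < n)%N ->
  100 * 100 * 100 / e ^+ 3 <= L -> 100 * 100 * 100 / e ^+ 3 * L ^+ 2 <= n%:R ->
  (4 + e) * L / n%:R <= rho ^+ 2 ->
  (W [set u | exists2 t, t != 1%g & beaten t u] <=
   (2 * expR (- (e / 16 * L)) + expR (- n%:R))%:E)%E.
Proof.
move=> rho01 e01 n0 LK nK hr.
have nR : (0 : R) < n%:R by rewrite ltr0n.
case/andP: (e01) => e0 e1.
have e3 : 0 < e ^+ 3 by rewrite exprn_gt0.
have e3e : e ^+ 3 <= e by rewrite -[leRHS]expr1; apply: ler_wiXn2l => //; exact: ltW.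
rewrite ler_pdivrMr// in LK.
rewrite mulrAC ler_pdivrMr// in nK.
pose q : R := L / n%:R.
have Lq : L = q * n%:R by rewrite /q divfK// gt_eqF.
have L1 : 1 <= L.
  rewrite leNgt; apply/negP => L1.
  have L00 : 0 <= L by apply: ln_ge0; rewrite -(ler_nat R) in n0.
  have : L * e ^+ 3 <= 1 * 1 by apply: ler_pM => //; lra.
  lra.
have L0 : 0 <= L by lra.
have q0 : 0 <= q by rewrite divr_ge0.
have L2 : L <= L ^+ 2 by rewrite expr2 ler_peMl.
have nee : n%:R * e ^+ 3 <= n%:R * e by apply: ler_wpM2l; lra.
have ne : 100 * 100 * 100 <= n%:R * e by lra.
have qe : q * (100 * 100 * 100) <= e.
  by rewrite /q mulrAC ler_pdivrMr// [e * _]mulrC; lra.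
rewrite -mulrA -/q in hr.
pose k (t : 'S_n) := #|(~: agree 1%g t)%SET|.
have kn t : (k t)%:R <= n%:R :> R.
  by rewrite ler_nat; have := max_card (mem (~: agree 1%g t)%SET); rewrite card_ord.
have k0 t : 0 <= (k t)%:R :> R by [].
have r2 := sqr_ge0 rho.
(* The permutations for which the direct comparison of scores suffices. *)
pose few (t : 'S_n) := (12 * q < rho ^+ 2) || ((k t)%:R * 16 <= e * n%:R).
pose F t := if few t then beaten t else wrong_large rho (e / 64) t.
have FE t : (W (F t) <= (expR (- ((1 + e / 16) * L * (k t)%:R)))%:E)%E.
  rewrite Lq /F; case: ifP => [/orP[h|h]|/negbT].
  - apply: le_trans (@beaten_few_moved _ _ _ rho01 (3 / 2 * q) t _ _) _.
    + by apply/andP; split; lra.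
    + by lra.
    rewrite lee_fin ler_expR lerN2.
    exact: (@exponent_strong _ e q n%:R (k t)%:R).
  - have h4 : (4 + e) * q <= rho ^+ 2 by [].
    apply: le_trans (@beaten_few_moved _ _ _ rho01 ((4 + e) / 8 * q) t _ _) _.
    + apply/andP; split; first by apply: mulr_ge0 => //; lra.
      nra.
    + by lra.
    rewrite lee_fin ler_expR lerN2.
    exact: (@exponent_few _ e q n%:R (k t)%:R).
  - rewrite negb_or -leNgt => /andP[h _].
    have r64 : rho ^+ 2 <= 64^-1 by lra.
    apply: le_trans (@wrong_large_le _ _ _ rho01 (e / 64) t r64) _.
    rewrite lee_fin ler_expR.
    have := @exponent_wrong _ e q n%:R (k t)%:R e01 q0 qe ne (k0 t) (kn t) (rho ^+ 2) hr h.
    rewrite -/(k t); lra.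
pose many (S : {set 'I_n}) := (rho ^+ 2 <= 12 * q) && (e * n%:R <= #|(~: S)%SET|%:R * 16).
have CE S : many S -> (W (true_small rho (e / 64) S) <= (expR (- (2 * n%:R)))%:E)%E.
  move=> /andP[h1 h2].
  have r8 : rho ^+ 2 <= 8^-1 by lra.
  have h64 : 0 < e / 64 <= 1 by apply/andP; split; lra.
  apply: le_trans (@true_small_le _ _ _ rho01 (e / 64) S r8 h64) _.
  rewrite lee_fin ler_expR.
  have hk : #|(~: S)%SET|%:R <= n%:R :> R.
    by rewrite ler_nat; have := max_card (mem (~: S)%SET); rewrite card_ord.
  have hk0 : 0 <= #|(~: S)%SET|%:R :> R by [].
  have hq : 100 * 100 * 100 <= e ^+ 3 * (q * n%:R) by rewrite -Lq; lra.
  have := @exponent_true _ e q n%:R _ e01 q0 qe ne hk0 hk (rho ^+ 2) hr h2 hq.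
  lra.
have mb t : measurable (beaten t : set (fam (edge n) (R * R)%type)) by exact: measurable_beaten.
have mms := @measurable_match_sum R n.
have mF t : measurable (F t).
  rewrite /F; case: ifP => _; first exact: mb.
  exact: (measurable_le_set (measurable_cst _) (mms _ _)).
have mC S : measurable (true_small rho (e / 64) S : set (fam (edge n) (R * R)%type)).
  exact: (measurable_le_set (mms _ _) (measurable_cst _)).
have mU1 : measurable [set u | exists2 t, t != 1%g & F t u] by exact: measurable_exists2.
have mU2 : measurable [set u | exists2 S, many S & true_small rho (e / 64) S u] by exact: measurable_exists2.
apply: (@le_trans _ _ (W ([set u | exists2 t, t != 1%g & F t u] `|`
    [set u | exists2 S, many S & true_small rho (e / 64) S u]))).
  rewrite le_measure ?inE//.
  - exact: measurable_exists2.
  - exact: measurableU.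
  move=> u [t t1 bt]; case: (boolP (few t)) => ft.
    by left; exists t => //; rewrite /F ft.
  have [h|h] := @beaten_subset R n rho (e / 64) t u bt.
    by left; exists t => //; rewrite /F (negbTE ft).
  right; exists (agree 1%g t) => //; rewrite /many.
  move: ft; rewrite negb_or -leNgt -ltNge => /andP[-> h2] /=; exact: ltW.
apply: (@le_trans _ _ (W [set u | exists2 t, t != 1%g & F t u] +
    W [set u | exists2 S, many S & true_small rho (e / 64) S u])%E).
  exact: measureU2.
rewrite EFinD; apply: leeD.
  apply: le_trans (measure_union_le _ _ mF) _.
  apply: (@le_trans _ _ (\sum_(t : 'S_n | t != 1%g) (expR (- ((1 + e / 16) * L * (k t)%:R)))%:E)%E).
    by apply: lee_sum => t _; exact: FE.
  rewrite sumEFin lee_fin.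
  apply: le_trans (@sum_moved_le R n 1%g (fun j => expR (- ((1 + e / 16) * L * j%:R)))
    (fun j => expR_ge0 _)) _.
  have ql : 0 <= expR (- (e / 16 * L)) <= 2^-1.
    rewrite expR_ge0/= expRN lef_pV2 ?posrE ?expR_gt0//.
    apply: le_trans (expR1_ge2 R) _; rewrite ler_expR.
    have : e ^+ 3 * L <= e * L by apply: ler_wpM2r.
    lra.
  apply: le_trans (sum_geo_le n ql).
  apply: ler_sum => j _; rewrite -expRM_natr -[n%:R ^+ _](lnK (x := n%:R ^+ j.+1)) ?posrE ?exprn_gt0//.
  rewrite lnXn// -expRD ler_expR -mulr_natr; lra.
apply: le_trans (measure_union_le _ _ mC) _.
apply: (@le_trans _ _ (\sum_(S : {set 'I_n} | many S) (expR (- (2 * n%:R)))%:E)%E).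
  by apply: lee_sum => S mS; exact: CE.
by rewrite sumEFin lee_fin; exact: sum_subsets_le.
Qed.

End exact_recovery.

Lemma cvg_prob1 (R : realType) (d : nat -> measure_display) (T : forall n, measurableType (d n))
    (P : forall n, probability (T n) R) (E : forall n, set (T n)) :
  (forall n, measurable (E n)) ->
  (forall eps : R, 0 < eps -> \forall n \near \oo, (P n (~` E n) <= eps%:E)%E) ->
  P n (E n) @[n --> \oo] --> 1%E.
Proof.
move=> mE hE.
have PE n : P n (E n) = (1 - fine (P n (~` E n)))%:E.
  rewrite probability_setC// -[in RHS](fineK (fin_num_measure (P n) _ (mE n))).
  by rewrite -EFinB/= -[LHS](fineK (fin_num_measure (P n) _ (mE n))); congr EFin; ring.
under eq_fun do rewrite PE.
apply: cvg_EFin; first exact: nearW.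
apply/cvgrPdist_le => eps eps0; have := hE eps eps0; apply: filterS => n h.
have p0 : 0 <= fine (P n (~` E n)) by rewrite fine_ge0.
rewrite /= opprB addrC subrK ger0_norm//.
by rewrite -lee_fin fineK// fin_num_measure//; exact: measurableC.
Qed.

Section estimation.
Context (R : realType) (n : nat) (d : measure_display) (T : measurableType d)
  (P : probability T R) (rho : R) (pi : {RV P >-> 'S_n}) (A B : {RV P >-> obs n R}).
Hypothesis hmodel : correlated_gaussian rho pi A B.
Variable est : estimator n R.
Local Notation W := (power (bivariate rho) #|{: edge n}|).

Lemma measurable_est_event (Q : 'S_n -> 'S_n -> Prop) :
  measurable [set w | Q (est (A w, B w)) (pi w)].
Proof.
have -> : [set w | Q (est (A w, B w)) (pi w)] = [set w | exists2 st : 'S_n * 'S_n,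
    `[< Q st.1 st.2 >] & est (A w, B w) = st.1 /\ pi w = st.2].
  apply/seteqP; split => w /=.
    by move=> h; exists (est (A w, B w), pi w) => //=; apply/asboolP.
  by move=> [[s t] /asboolP/= h [-> ->]].
apply: measurable_exists2 => -[s t]/=.
have mAB : measurable_fun setT (fun w => est (A w, B w)).
  apply: measurableT_comp; first exact: measurable_funP.
  by apply: measurable_fun_pair; exact: measurable_funP.
change (measurable ((fun w => est (A w, B w)) @^-1` [set s] `&` pi @^-1` [set t])).
apply: measurableI; last exact: (measurable_funPTI pi (Y := [set t])).
by rewrite -[X in measurable X]setTI; exact: mAB.
Qed.

Lemma overlap_eq1 (s t : 'S_n) : (0 < n)%N -> (overlap R s t == 1) = (s == t).
Proof.
move=> n0; rewrite /overlap.
have nR : (n%:R : R) != 0 by rewrite pnatr_eq0 -lt0n.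
rewrite (can2_eq (divfK nR) (mulfK nR)) mul1r eqr_nat.
apply/eqP/eqP => [h|->]; last first.
  by rewrite -[RHS]card_ord; apply: eq_card => i; rewrite !inE eqxx.
apply/permP => i; apply/eqP.
have : [pred i | s i == t i] =i predT.
  by apply/subset_cardP; [rewrite h card_ord|exact/fintype.subsetP].
by move=> /(_ i); rewrite !inE.
Qed.

(** Relabelling the edges by the latent permutation turns the estimate [t] into [t *
    s^-1], which beats the identity. *)
Lemma ml_error_le : (0 < n)%N -> is_ML est ->
  (P [set w | overlap R (est (A w, B w)) (pi w) <> 1%R] <=
   W [set u | exists2 t, t != 1%g & beaten t u])%E.
Proof.
move=> n0 hml.
pose U : set (fam (edge n) (R * R)%type) := [set u | exists2 t, t != 1%g & beaten t u].
have mU : measurable U by apply: measurable_exists2 => t; exact: measurable_beaten.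
rewrite -/U.
pose X s w := of_fun (fun e => (entry (A w) (perm_edge s e), entry (B w) e)).
have hs s : P [set w | pi w = s /\ U (X s w)] = (n`!%:R^-1%:E * W U)%E.
  exact: model_joint_law.
apply: (@le_trans _ _ (\sum_(s : 'S_n) P [set w | pi w = s /\ U (X s w)])%E); last first.
  under eq_bigr do rewrite hs.
  have Wfin : W U \is a fin_num by exact: fin_num_measure.
  rewrite -(fineK Wfin) -EFinM sumEFin lee_fin sumr_const card_Sn -[leLHS]mulr_natl mulrA.
  by rewrite divff ?mul1r// pnatr_eq0 -lt0n fact_gt0.
have mX s : measurable [set w | pi w = s /\ U (X s w)].
  have mphi : measurable_fun setT (X s).
    apply: measurable_of_fun => e; apply: measurable_fun_pair.
    - exact: (measurableT_comp (measurable_coord (perm_edge s e)) (measurable_funP A)).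
    - exact: (measurableT_comp (measurable_coord e) (measurable_funP B)).
  change (measurable (pi @^-1` [set s] `&` X s @^-1` U)).
  apply: measurableI; first exact: (measurable_funPTI pi (Y := [set s])).
  by rewrite -[X in measurable X]setTI; exact: mphi.
apply: le_trans (measure_union_le _ predT mX).
rewrite le_measure ?inE//; [exact: (measurable_est_event (fun s t => overlap R s t <> 1))|
  exact: measurable_exists2|].
move=> w /= /eqP; rewrite overlap_eq1// => hw; exists (pi w) => //; split => //.
set s := pi w in hw *; set t := est (A w, B w) in hw.
exists (t * s^-1)%g; first by rewrite -eq_mulgV1.
have := hml (A w) (B w) s; rewrite -/t /beaten /inner/= /match_sum.
have -> : \sum_e entry (A w) (perm_edge s e) * entry (B w) e =
   \sum_e (coord (X s w) (perm_edge (1%g : 'S_n) e)).1 * (coord (X s w) e).2.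
  apply: eq_bigr => e _; rewrite !coord_of_fun/=; congr (entry _ _ * _).
  apply: val_inj => /=; rewrite -imset_comp; apply: eq_imset => i /=.
  by rewrite perm1.
have -> // : \sum_e entry (A w) (perm_edge t e) * entry (B w) e =
   \sum_e (coord (X s w) (perm_edge (t * s^-1)%g e)).1 * (coord (X s w) e).2.
apply: eq_bigr => e _; rewrite !coord_of_fun/=; congr (entry _ _ * _).
apply: val_inj => /=; rewrite -imset_comp; apply: eq_imset => i /=.
by rewrite permM permKV.
Qed.

End estimation.

Lemma ml_exact_recovery (R : realType) (eps : R) (rho : nat -> R)
    (d : nat -> measure_display) (T : forall n, measurableType (d n))
    (P : forall n, probability (T n) R)
    (pi : forall n, {RV (P n) >-> 'S_n})
    (A B : forall n, {RV (P n) >-> obs n R}) :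
  0 < eps -> (forall n, 0 < rho n <= 1) ->
  (forall n, correlated_gaussian (rho n) (pi n) (A n) (B n)) ->
  (\forall n \near \oo, (4 + eps) * ln n%:R / n%:R <= rho n ^+ 2) ->
  forall ml : (forall n, estimator n R), (forall n, is_ML (ml n)) ->
  P n [set w | overlap R (ml n (A n w, B n w)) (pi n w) = 1] @[n --> \oo] --> 1%E.
Proof.
move=> eps0 hrho hmodel hsnr ml hml.
(* Decreasing eps only weakens the hypothesis, so eps <= 1 may be assumed. *)
pose e := Num.min eps 1.
have e01 : 0 < e <= 1 by rewrite /e lt_min eps0 ltr01/= ge_min lexx orbT.
have ee : e <= eps by rewrite /e ge_min lexx.
apply: cvg_prob1 => [n|z z0].
  exact: (measurable_est_event _ _ _ _ (fun s t => overlap R s t = 1)).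
have e3 : 0 < e ^+ 3 by rewrite exprn_gt0//; case/andP: e01.
pose K := 100 * 100 * 100 / e ^+ 3 + 100 / (e * z).
near=> n.
have [LK nK n0] : [/\ K <= ln n%:R, K * ln n%:R ^+ 2 <= n%:R & (0 < n)%N].
  by near: n; exact: near_ln.
have hr : (4 + eps) * ln n%:R / n%:R <= rho n ^+ 2 by near: n.
have e0 : 0 < e by case/andP: e01.
have ez : 0 < 100 / (e * z) by rewrite divr_gt0// mulr_gt0.
have LK1 : 100 * 100 * 100 / e ^+ 3 <= ln n%:R by rewrite /K in LK; lra.
have L0 : 0 <= ln n%:R :> R by apply: le_trans LK1; rewrite divr_ge0// ltW.
have nK1 : 100 * 100 * 100 / e ^+ 3 * ln n%:R ^+ 2 <= n%:R.
  apply: le_trans nK; apply: ler_wpM2r; first exact: sqr_ge0.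
  by rewrite /K; lra.
have hr1 : (4 + e) * ln n%:R / n%:R <= rho n ^+ 2.
  by apply: le_trans hr; rewrite -!mulrA ler_wpM2r ?lerD2l// divr_ge0.
have h := some_beaten_le (hrho n) e01 n0 LK1 nK1 hr1.
rewrite (_ : ~` _ = [set w | overlap R (ml n (A n w, B n w)) (pi n w) <> 1%R])//.
apply: le_trans (ml_error_le (hmodel n) n0 (hml n)) _.
apply: le_trans h _; rewrite lee_fin.
have expN x : 0 < x -> expR (- x) <= x^-1 :> R.
  move=> x0; rewrite expRN lef_pV2 ?posrE ?expR_gt0//.
  by apply: le_trans (expR_ge1Dx x); lra.
case/andP: e01 => _ e1.
have zi : 1 / z <= 1 / (e * z).
  by rewrite !div1r lef_pV2 ?posrE ?mulr_gt0// ler_piMl// ltW.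
have ez1 : 100 / z <= 100 / (e * z) by lra.
have L1 : 1 <= ln n%:R :> R.
  apply: le_trans LK1; rewrite ler_pdivlMr//.
  have : e ^+ 3 <= 1 by apply: exprn_ile1 => //; exact: ltW.
  lra.
have zV : 0 < 1 / z by rewrite divr_gt0.
have K0 : 0 <= 100 * 100 * 100 / e ^+ 3 by rewrite divr_ge0// ltW.
have h1 : 6 / z <= e / 16 * ln n%:R.
  have : e * (100 / (e * z)) <= e * ln n%:R by apply: ler_wpM2l; [exact: ltW|rewrite /K in LK; lra].
  have -> : e * (100 / (e * z)) = 100 / z by field; rewrite !gt_eqF.
  lra.
have h2 : 100 / z <= n%:R.
  apply: le_trans nK; have : 1 <= ln n%:R ^+ 2 :> R by rewrite expr_ge1.
  have : 0 <= K by rewrite /K; lra.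
  have : 0 <= 100 * 100 * 100 / e ^+ 3 by rewrite divr_ge0// ltW.
  rewrite /K; nra.
have h3 : expR (- (e / 16 * ln n%:R)) <= z / 6.
  apply: (@le_trans _ _ (expR (- (6 / z)))); first by rewrite ler_expR lerN2.
  by apply: le_trans (expN _ _) _; [rewrite divr_gt0|rewrite invf_div].
have h4 : expR (- n%:R) <= z / 100.
  apply: (@le_trans _ _ (expR (- (100 / z)))); first by rewrite ler_expR lerN2.
  by apply: le_trans (expN _ _) _; [rewrite divr_gt0|rewrite invf_div].
lra.
Unshelve. all: by end_near.
Qed.

(** * The likelihood ratio *)

Section kernels.
Context (R : realType) (rho : R).
Local Notation gamma := (@gauss R).
Local Notation c := (Num.sqrt (1 - rho ^+ 2)).
Hypothesis rho1 : rho ^+ 2 < 1.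

Let w0 : 0 < 1 - rho ^+ 2. Proof. by rewrite subr_gt0. Qed.
Let c0 : 0 < c. Proof. by rewrite sqrtr_gt0. Qed.

Lemma integral_lratio1 x : (\int[gamma]_y (lratio rho (x, y))%:E = 1)%E.
Proof.
have mf : measurable_fun setT (fun _ : R => 1 : R) by exact: measurable_cst.
have := integral_lratio rho1 x mf (fun _ => ler01).
rewrite integral_prob_cst => ->; apply: eq_integral => y _; by rewrite mul1r.
Qed.

(** Mehler kernels compose: integrating out the common second coordinate leaves a kernel
    of correlation [rho ^+ 2]. *)
Lemma integral_lratio2 x x' :
  (\int[gamma]_y (lratio rho (x, y) * lratio rho (x', y))%:E =
   (lratio (rho ^+ 2) (x, x'))%:E)%E.
Proof.
pose t := rho * (x + x') / (1 - rho ^+ 2); pose u := - (rho ^+ 2 / (1 - rho ^+ 2)).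
have r2 := sqr_ge0 rho.
have u2 : u < 2^-1.
  have : 0 <= rho ^+ 2 / (1 - rho ^+ 2) by rewrite divr_ge0// ltW.
  by rewrite /u; lra.
pose K := (c ^+ 2)^-1 * expR (- (rho ^+ 2 * (x ^+ 2 + x' ^+ 2) / (2 * (1 - rho ^+ 2)))).
transitivity (\int[gamma]_y (K%:E * (expR (t * y + u * y ^+ 2))%:E))%E.
  apply: eq_integral => y _; rewrite -EFinM /K /lratio/=; congr EFin.
  have -> : (c ^+ 2)^-1 = c^-1 * c^-1 by rewrite expr2 invfM.
  rewrite mulrACA -expRD -[RHS]mulrA -expRD; congr (_ * expR _).
  by rewrite /t /u; field; rewrite gt_eqF.
have K0 : (0 <= K%:E)%E by rewrite lee_fin mulr_ge0 ?expR_ge0// invr_ge0 sqr_ge0.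
have mE : measurable_fun setT (fun y : R => (expR (t * y + u * y ^+ 2))%:E).
  apply: measurable_expR_comp; apply: measurable_funD; apply: measurable_funM => //.
rewrite ge0_integralZl//=.
rewrite mgf_normal// -EFinM /K /lratio/=; congr EFin.
have e1 : 1 - 2 * u = (1 + rho ^+ 2) / (1 - rho ^+ 2) by rewrite /u; field; rewrite gt_eqF.
have p0 : 0 < 1 + rho ^+ 2 by lra.
have e2 : 1 - (rho ^+ 2) ^+ 2 = (1 - rho ^+ 2) * (1 + rho ^+ 2) by ring.
rewrite e1 e2 !sqrtrM ?(ltW p0) ?(ltW w0)// sqrtrV ?(ltW w0)//.
have s0 : 0 < Num.sqrt (1 + rho ^+ 2) by rewrite sqrtr_gt0.
have -> : (2 * rho ^+ 2 * (x * x') - (rho ^+ 2) ^+ 2 * (x ^+ 2 + x' ^+ 2)) /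
    (2 * ((1 - rho ^+ 2) * (1 + rho ^+ 2))) =
    - (rho ^+ 2 * (x ^+ 2 + x' ^+ 2) / (2 * (1 - rho ^+ 2))) +
    t ^+ 2 / (2 * ((1 + rho ^+ 2) / (1 - rho ^+ 2))).
  by rewrite /t; field; rewrite !gt_eqF.
rewrite expRD; move: (expR _) (expR _) => z1 z2.
move: (Num.sqrt (1 + rho ^+ 2)) c s0 c0 => a b a0 b0.
by field; rewrite !gt_eqF.
Qed.

Definition loglr (z : R * R) : R :=
  (2 * rho * (z.1 * z.2) - rho ^+ 2 * (z.1 ^+ 2 + z.2 ^+ 2)) / (2 * (1 - rho ^+ 2))
    - ln (1 - rho ^+ 2) / 2.

Lemma lratio_exp z : lratio rho z = expR (loglr z).
Proof.
rewrite /lratio expRD mulrC; congr (_ * _); rewrite expRN; congr (_^-1).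
apply/eqP; rewrite -(@eqrXn2 _ 2)// ?expR_ge0// sqr_sqrtr ?ltW// -expRM_natr divfK//.
by rewrite lnK.
Qed.

Lemma lratio_le z : lratio rho z <=
  (Num.sqrt (1 - rho ^+ 2))^-1 * expR (rho / (1 - rho ^+ 2) * (z.1 * z.2)).
Proof.
rewrite /lratio ler_wpM2l ?invr_ge0// ler_expR.
have -> : rho / (1 - rho ^+ 2) * (z.1 * z.2) = 2 * rho * (z.1 * z.2) / (2 * (1 - rho ^+ 2)).
  by field; rewrite gt_eqF.
rewrite ler_pM2r ?invr_gt0 ?mulr_gt0// gerBl mulr_ge0 ?sqr_ge0//.
by rewrite addr_ge0 ?sqr_ge0.
Qed.

Lemma measurable_loglr : measurable_fun setT loglr.
Proof.
apply: measurable_funB => //; apply: measurable_funM => //.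
apply: measurable_funB; apply: measurable_funM => //; first exact: measurable_funM.
by apply: measurable_funD; apply: measurable_funX.
Qed.

(** With the second coordinate written as rho x + c y, the log-likelihood ratio is rho^2
    (x^2 - y^2) / 2 + rho c x y - log (1 - rho^2) / 2. The constant, about rho^2 / 2, is its
    mean; the rest is centred and contributes to second order. *)
Lemma mgf_loglr (l : R) : rho ^+ 2 <= 16^-1 -> 0 <= l <= 1 ->
  mgf_le (bivariate rho) (fun z => l * loglr z) (l / 2 * (rho ^+ 2 + rho ^+ 4) + 4 * l ^+ 2 * rho ^+ 2).
Proof.
move=> r8 /andP[l0 l1]; have r2 := sqr_ge0 rho.
have ml : measurable_fun setT (fun z => l * loglr z).
  by apply: measurable_funM => //; exact: measurable_loglr.
have cE : c ^+ 2 = 1 - rho ^+ 2 by rewrite sqr_sqrtr// ltW.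
have m1 : measurable_fun setT (fun z : R * R => z.1) by exact: measurable_fst.
have m2 : measurable_fun setT (fun z : R * R => z.2) by exact: measurable_snd.
have lr0 : 0 <= l * rho ^+ 2 by exact: mulr_ge0.
have lr8 : l * rho ^+ 2 <= 8^-1 by nra.
have h1 : mgf_le (gamma \x gamma)%E
    (fun z => 2 * (l / 2 * rho ^+ 2 * (z.1 ^+ 2 - z.2 ^+ 2))) (2 * (2 * l ^+ 2 * rho ^+ 4)).
  split.
    apply: measurable_funM => //; apply: measurable_funM => //.
    by apply: measurable_funB; exact: measurable_funX.
  have mx : measurable_fun setT (fun x : R => (expR (l * rho ^+ 2 * x ^+ 2))%:E).
    by apply: measurable_expR_comp; apply: measurable_funM => //; exact: measurable_funX.
  have my : measurable_fun setT (fun x : R => (expR (- (l * rho ^+ 2) * x ^+ 2))%:E).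
    by apply: measurable_expR_comp; apply: measurable_funM => //; exact: measurable_funX.
  rewrite fubini_tonelli1//; last first.
    apply: measurable_expR_comp; apply: measurable_funM => //; apply: measurable_funM => //.
    by apply: measurable_funB; exact: measurable_funX.
  rewrite /fubini_F.
  have n8 : `|l * rho ^+ 2| <= 8^-1 by rewrite ger0_norm.
  have [_ hx] := mgf_sqr n8.
  have n8' : `|- (l * rho ^+ 2)| <= 8^-1 by rewrite normrN.
  have [_ hy] := mgf_sqr n8'.
  have -> : (\int[gamma]_x \int[gamma]_y
      (expR (2 * (l / 2 * rho ^+ 2 * (x ^+ 2 - y ^+ 2))))%:E =
      \int[gamma]_x (expR (l * rho ^+ 2 * x ^+ 2))%:E *
      \int[gamma]_y (expR (- (l * rho ^+ 2) * y ^+ 2))%:E)%E.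
    rewrite -ge0_integralZr//; last exact: integral_ge0.
    apply: eq_integral => x _; rewrite -ge0_integralZl//; apply: eq_integral => y _.
    by rewrite -EFinM -expRD; congr (EFin (expR _)); field.
  have -> : 2 * (2 * l ^+ 2 * rho ^+ 4) = (l * rho ^+ 2 + 2 * (l * rho ^+ 2) ^+ 2) +
      (- (l * rho ^+ 2) + 2 * (- (l * rho ^+ 2)) ^+ 2) by ring.
  by rewrite expRD EFinM; apply: lee_pmul => //; exact: integral_ge0.
have h2 : mgf_le (gamma \x gamma)%E
    (fun z => 2 * (l * rho * c * (z.1 * z.2))) (2 * (2 * l ^+ 2 * rho ^+ 2)).
  split.
    by apply: measurable_funM => //; apply: measurable_funM => //; exact: measurable_funM.
  rewrite fubini_tonelli1//; last first.
    by apply: measurable_expR_comp; apply: measurable_funM => //; apply: measurable_funM => //;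
      exact: measurable_funM.
  rewrite /fubini_F.
  have t4 : (2 * (l * rho * c)) ^+ 2 <= 4^-1.
    have -> : (2 * (l * rho * c)) ^+ 2 = 4 * l * (l * rho ^+ 2) * c ^+ 2 by ring.
    rewrite cE -[4 * l * _]mulrA; have wz : 0 <= l * (l * rho ^+ 2) by exact: mulr_ge0.
    have h16 : l * (l * rho ^+ 2) <= 1 * 16^-1 by apply: ler_pM => //; nra.
    move: (l * (l * rho ^+ 2)) wz h16 => w; nra.
  apply: (@le_trans _ _ (expR ((2 * (l * rho * c)) ^+ 2))%:E); last first.
    rewrite lee_fin ler_expR.
    have -> : (2 * (l * rho * c)) ^+ 2 = 4 * l ^+ 2 * rho ^+ 2 * c ^+ 2 by ring.
    have : 0 <= l ^+ 2 * rho ^+ 2 * rho ^+ 2 by exact: (mulr_ge0 (mulr_ge0 (sqr_ge0 l) r2) r2).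
    rewrite cE; lra.
  apply: le_trans (mgf_prod t4).
  by rewrite le_eqVlt; apply/orP; left; apply/eqP; apply: eq_integral => x _;
    apply: eq_integral => y _; rewrite mulrA.
have [mU hU] := mgf_le_addc (- (l * (ln (1 - rho ^+ 2) / 2))) (mgf_leD h1 h2).
split => //; rewrite integral_bivariate; last 2 first.
- exact: measurable_expR_comp.
- by [].
have -> : (\int[gamma]_x \int[gamma]_y (expR (l * loglr (x, rho * x + c * y)))%:E =
   \int[gamma \x gamma]_z (expR (l / 2 * rho ^+ 2 * (z.1 ^+ 2 - z.2 ^+ 2) +
     l * rho * c * (z.1 * z.2) + - (l * (ln (1 - rho ^+ 2) / 2))))%:E)%E.
  rewrite (@fubini_tonelli1 _ _ _ _ _ gamma gamma _ (measurable_expR_comp mU)); last by [].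
  apply: eq_integral => x _; apply: eq_integral => y _; congr (EFin (expR _)).
  rewrite /loglr/=.
  have -> : 2 * rho * (x * (rho * x + c * y)) - rho ^+ 2 * (x ^+ 2 + (rho * x + c * y) ^+ 2) =
      (1 - rho ^+ 2) * (rho ^+ 2 * x ^+ 2 + 2 * rho * c * (x * y)) - rho ^+ 2 * c ^+ 2 * y ^+ 2.
    by ring.
  by rewrite cE; field; rewrite gt_eqF.
apply: le_trans hU _; rewrite lee_fin ler_expR.
have hln : - (rho ^+ 2 + rho ^+ 4) <= ln (1 - rho ^+ 2).
  have -> : rho ^+ 4 = (rho ^+ 2) ^+ 2 by ring.
  rewrite -ler_expR lnK ?posrE//; apply: expRN_le; rewrite ger0_norm//; lra.
have h4 : 0 <= l ^+ 2 * (rho ^+ 2 * (1 - rho ^+ 2)).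
  by rewrite mulr_ge0 ?sqr_ge0// mulr_ge0// ltW.
have h5 : 0 <= l * (ln (1 - rho ^+ 2) + (rho ^+ 2 + rho ^+ 4)) by apply: mulr_ge0 => //; lra.
have -> : rho ^+ 4 = rho ^+ 2 * rho ^+ 2 by ring.
have e4 : rho ^+ 4 = rho ^+ 2 * rho ^+ 2 by ring.
rewrite e4 in h5; lra.
Qed.

End kernels.

Section likelihood.
Context (R : realType) (n : nat) (rho : R).
Local Notation gamma := (@gauss R).
Local Notation G := (power gamma #|{: edge n}|).
Local Notation G2 := (G \x G)%E.
Local Notation W := (power (bivariate rho) #|{: edge n}|).
Hypothesis rho1 : rho ^+ 2 < 1.

(** The density of the observations given that the latent permutation is [s], relative
    to independent vectors, restricted to the factors of the edges in [D]. *)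
Definition likelihood (D : pred (edge n)) (s : 'S_n) (z : obs n R * obs n R) : R :=
  \prod_(e | D e) lratio rho (entry z.1 (perm_edge s e), entry z.2 e).

Lemma measurable_entry_pair (f g : edge n) :
  measurable_fun setT (fun z : obs n R * obs n R => (entry z.1 f, entry z.2 g)).
Proof.
apply: measurable_fun_pair.
- exact: (measurableT_comp (measurable_coord f) measurable_fst).
- exact: (measurableT_comp (measurable_coord g) measurable_snd).
Qed.

Lemma measurable_likelihood D s : measurable_fun setT (likelihood D s).
Proof.
rewrite (_ : likelihood D s = fun z => \prod_e
    if D e then lratio rho (entry z.1 (perm_edge s e), entry z.2 e) else 1); last first.
  by apply/funext => z; rewrite /likelihood [LHS]big_mkcond.
apply: measurable_prod => e _; case: (D e); last exact: measurable_cst.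
exact: (measurableT_comp (measurable_lratio rho) (measurable_entry_pair _ _)).
Qed.

Lemma likelihood_gt0 D s z : 0 < likelihood D s z.
Proof. by apply: prodr_gt0 => e _; exact: lratio_gt0. Qed.

Lemma likelihood_ge0 D s z : 0 <= likelihood D s z.
Proof. exact/ltW/likelihood_gt0. Qed.

Lemma likelihood_split (S : {set 'I_n}) s z :
  likelihood predT s z = likelihood (inside S) s z * likelihood [predC inside S] s z.
Proof. by rewrite /likelihood (bigID (inside S)). Qed.

Lemma likelihood_agree s t z :
  likelihood (inside (agree s t)) s z = likelihood (inside (agree s t)) t z.
Proof. by apply: eq_bigr => e he; rewrite (perm_edge_agree he). Qed.

Lemma likelihood_law (s : 'S_n) (H : set (fam (edge n) (R * R)%type)) : measurable H ->
  (\int[G2]_z (\1_H (of_fun (fun e => (entry z.1 (perm_edge s e), entry z.2 e))) *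
     likelihood predT s z)%:E = W H)%E.
Proof.
move=> mH; rewrite (power_bivariate_density rho1 (edge_perm s) mH).
apply: eq_integral => z _; congr EFin; congr (\1_H _ * _).
  by congr of_fun; apply/funext => e; rewrite permE.
by apply: eq_bigr => e _; rewrite permE.
Qed.

Lemma likelihood_total s : (\int[G2]_z (likelihood predT s z)%:E = 1)%E.
Proof.
rewrite -[RHS](probability_setT W) -(likelihood_law s measurableT).
by apply: eq_integral => z _; rewrite indicE in_setT mul1r.
Qed.

Section joint.
Context (d : measure_display) (T : measurableType d)
  (P : probability T R) (pi : {RV P >-> 'S_n}) (A B : {RV P >-> obs n R}).
Hypothesis hmodel : correlated_gaussian rho pi A B.

(** The latent permutation and the observations jointly have density [n`!^-1 *
    likelihood], the reference law not depending on the permutation. *)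
Lemma joint_density s (K : set (obs n R * obs n R)) : measurable K ->
  P [set w | pi w = s /\ K (A w, B w)] =
  (n`!%:R^-1%:E * \int[G2]_z (\1_K z * likelihood predT s z)%:E)%E.
Proof.
move=> mK.
pose unzip (u : fam (edge n) (R * R)%type) : obs n R * obs n R :=
  (of_fun (fun e => (coord u ((edge_perm s)^-1%g e)).1), of_fun (fun e => (coord u e).2)).
have muz : measurable_fun setT unzip.
  apply: measurable_fun_pair; apply: measurable_of_fun => e.
  - exact: (measurableT_comp measurable_fst (measurable_coord _)).
  - exact: (measurableT_comp measurable_snd (measurable_coord _)).
(* The matched family determines the observations once s is known. *)
have zipK (z : obs n R * obs n R) :
    unzip (of_fun (fun e => (entry z.1 (perm_edge s e), entry z.2 e))) = z.
  rewrite /unzip [RHS]surjective_pairing; congr pair.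
    rewrite -[RHS]of_fun_coord; congr of_fun; apply/funext => e.
    rewrite coord_of_fun/=; congr (entry _ _).
    by have := permKV (edge_perm s) e; rewrite permE.
  by rewrite -[RHS]of_fun_coord; congr of_fun; apply/funext => e; rewrite coord_of_fun.
have mH : measurable (unzip @^-1` K) by rewrite -[X in measurable X]setTI; exact: muz.
have := model_joint_law hmodel s mH.
rewrite -(likelihood_law s mH).
have -> : [set w | pi w = s /\ (unzip @^-1` K)
    (of_fun (fun e => (entry (A w) (perm_edge s e), entry (B w) e)))] =
    [set w | pi w = s /\ K (A w, B w)].
  by apply/seteqP; split => w /= []; rewrite (zipK (A w, B w)).
move=> ->; congr (_ * _)%E; apply: eq_integral => z _; congr EFin; congr (_ * _).
rewrite !indicE; congr ((nat_of_bool _)%:R); apply/idP/idP; by rewrite !inE/= zipK.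
Qed.

End joint.

(** Given the first vector, the entries of the second one are independent; integrating
    them out gives 1 on the edges inside the agreement set and a kernel of correlation rho^2
    on the others. Bounding these kernels by exponentials leaves a quadratic form, where all
    but at most n edges have distinct images under [s] and [t] and therefore cost rho^4
    only. *)
Lemma integral_cross_likelihood s t :
  rho ^+ 2 <= 64^-1 ->
  (\int[G2]_z (likelihood predT s z * likelihood [predC inside (agree s t)] t z)%:E <=
   (expR (17 * (rho ^+ 2) ^+ 2 * #|{: edge n}|%:R + 4 * rho ^+ 2 * n%:R))%:E)%E.
Proof.
move=> r64; set S := agree s t.
have r2 := sqr_ge0 rho; pose k := rho ^+ 2.
have k1 : k ^+ 2 < 1 by rewrite /k; nra.
pose h e (z : obs n R * R) : \bar R := (lratio rho (entry z.1 (perm_edge s e), z.2) *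
  (if inside S e then 1 else lratio rho (entry z.1 (perm_edge t e), z.2)))%:E.
have me (f : edge n) : measurable_fun setT (fun z : obs n R * R => (entry z.1 f, z.2)).
  apply: measurable_fun_pair => //.
  exact: (measurableT_comp (measurable_coord f) measurable_fst).
have mh e : measurable_fun setT (h e).
  apply/measurable_EFinP; apply: measurable_funM.
    exact: (measurableT_comp (measurable_lratio rho) (me _)).
  case: (inside S e); first exact: measurable_cst.
  exact: (measurableT_comp (measurable_lratio rho) (me _)).
have h0 e z : (0 <= h e z)%E.
  by rewrite lee_fin mulr_ge0 ?lratio_ge0//; case: ifP => _//; exact: lratio_ge0.
have -> : (\int[G2]_z (likelihood predT s z * likelihood [predC inside S] t z)%:E =
    \int[G2]_z \prod_e h e (z.1, coord z.2 e))%E.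
  apply: eq_integral => z _; rewrite prodEFin; congr EFin.
  rewrite /likelihood [X in _ * X]big_mkcond -big_split/=; apply: eq_bigr => e _.
  by rewrite (_ : (e \in inside S) = inside S e)//; case: (inside S e).
rewrite (@integral_prod_power _ _ _ gamma _ _ _ G h mh h0).
pose k' := k / (1 - k ^+ 2).
pose N : R := #|[predC inside S]|%:R.
have kk : k <= 64^-1 by [].
have k0 : 0 <= k by [].
have k'0 : 0 <= k' by apply: divr_ge0 => //; rewrite subr_ge0 ltW.
have k'2 : k' <= 2 * k.
  rewrite /k' ler_pdivrMr ?subr_gt0//.
  have : 0 <= k * (1 - 2 * k ^+ 2) by apply: mulr_ge0 => //; nra.
  lra.
have k'32 : 0 <= k' <= 32^-1 by apply/andP; split => //; lra.
have := mgf_form (edge_perm s) (edge_perm t) [predC inside S] k'32.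
move=> /(mgf_le_addc (k ^+ 2 * N)) [mU hU].
apply: (le_trans _ (le_trans hU _)).
  apply: ge0_le_integral => //.
  - by move=> x _; apply: prode_ge0 => e _; apply: integral_ge0 => y _.
  - apply: emeasurable_prod => e.
    exact: (@measurable_fun_fubini_tonelli_F _ _ _ _ _ gamma _ (mh e) (h0 e)).
  - exact: measurable_expR_comp.
  move=> x _.
  apply: (@le_trans _ _ (\prod_e (expR (if inside S e then 0 else
      k' * (coord x (edge_perm s e) * coord x (edge_perm t e)) + k ^+ 2))%:E)%E).
    apply: lee_prod => e _; apply/andP; split; first by apply: integral_ge0 => y _.
    rewrite /h/=; case: (inside S e).
      under eq_integral do rewrite mulr1.
      by rewrite integral_lratio1// expR0.
    rewrite integral_lratio2// lee_fin -/k.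
    apply: le_trans (lratio_le k1 _) _; rewrite [leRHS]expRD mulrC !permE.
    apply: ler_wpM2l; first exact: expR_ge0.
    have n4 : `|k ^+ 2| <= 4^-1 by rewrite ger0_norm ?sqr_ge0//; nra.
    apply: le_trans (inv_sqrt_le n4) _; rewrite ler_expR.
    have := sqr_ge0 k; nra.
  rewrite prodEFin -expR_sum lee_fin ler_expR.
  rewrite le_eqVlt; apply/orP; left; apply/eqP.
  transitivity (\sum_(e | [predC inside S] e)
      (k' * (coord x (edge_perm s e) * coord x (edge_perm t e)) + k ^+ 2)).
    rewrite [RHS]big_mkcond/=; apply: eq_bigr => e _.
    by rewrite (_ : (e \in inside S) = inside S e)//; case: (inside S e).
  by rewrite big_split/= -mulr_sumr sumr_const mulr_natr.
rewrite lee_fin ler_expR.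
have c1 : #|[pred e | [predC inside S] e && (edge_perm s e != edge_perm t e)]|%:R <=
    #|{: edge n}|%:R :> R by rewrite ler_nat max_card.
have c2 : #|[pred e | [predC inside S] e && (edge_perm s e == edge_perm t e)]|%:R <= n%:R :> R.
  rewrite ler_nat; apply: (@leq_trans #|(~: S)%SET|).
    apply: leq_trans (card_crossing s t); apply: subset_leq_card.
    by apply/fintype.subsetP => e; rewrite !inE !permE.
  by have := max_card (mem (~: S)%SET); rewrite card_ord.
have c3 : N <= #|{: edge n}|%:R by rewrite ler_nat max_card.
have k2 := sqr_ge0 k.
have d1 : k' ^+ 2 <= 4 * k ^+ 2 by nra.
have d2 := ler_pM (sqr_ge0 k') (ler0n _ _) d1 c1.
have d3 := ler_pM k'0 (ler0n _ _) k'2 c2.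
have d4 := ler_wpM2l k2 c3.
rewrite -/k; lra.
Qed.

End likelihood.

(** * Overlap of two posterior samples *)

Section second_moment.
Context (R : realType) (n : nat).
Hypothesis n0 : (0 < n)%N.
Variables (w : 'S_n -> R) (Z : R).
Hypotheses (w0 : forall s, 0 <= w s) (ZE : Z = \sum_s w s) (Z0 : 0 < Z).

Let nR : 0 < n%:R :> R. Proof. by rewrite ltr0n. Qed.

Lemma overlap_sum (s t : 'S_n) : \sum_(i : 'I_n) (s i == t i)%:R = n%:R * overlap R s t.
Proof.
rewrite /overlap mulrCA divff ?mulr1 ?gt_eqF//.
rewrite -natr_sum -sum1_card [in RHS]big_mkcond.
by congr (_%:R).
Qed.

Lemma overlap_le1 (s t : 'S_n) : overlap R s t <= 1.
Proof.
by rewrite /overlap ler_pdivrMr// mul1r ler_nat -[leqRHS]card_ord max_card.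
Qed.

Let near_mass (x : R) (s : 'S_n) := \sum_(t | x <= overlap R s t) w t.

(** Let a_i be the mass of the permutations near [t0] that agree with it at [i]. The sum
    of the a_i is at least n x p where p is the mass near [t0], so the sum of their squares
    is at least n (x p)^2; and a_i^2 is at most the mass of the pairs (s, t) with s i = t i.
    Summing over i, pairs contribute their overlap, which is at most y unless the pair is
    near. *)
Lemma overlap_mass_sqr (t0 : 'S_n) (x y : R) : 0 <= x -> 0 <= y ->
  (x * \sum_(s | x < overlap R t0 s) w s) ^+ 2 <=
  y * Z ^+ 2 + \sum_s w s * near_mass y s.
Proof.
move=> x0 y0; set H := fun s => x < overlap R t0 s.
pose p := \sum_(s | H s) w s.
pose a (i : 'I_n) := \sum_(s | H s) w s * (t0 i == s i)%:R.
have p0 : 0 <= p by apply: sumr_ge0.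
have h1 : n%:R * (x * p) <= \sum_i a i.
  rewrite /a exchange_big/= mulrA /p mulr_sumr; apply: ler_sum => s Hs.
  rewrite -mulr_sumr overlap_sum mulrC; apply: ler_wpM2l => //.
  by apply: ler_wpM2l; [exact: ltW|exact: ltW].
have h2 i : a i ^+ 2 <= \sum_s \sum_t w s * w t * (s i == t i)%:R.
  rewrite /a expr2 mulr_suml big_mkcond/=; apply: ler_sum => s _.
  have hs0 : 0 <= \sum_t w s * w t * (s i == t i)%:R.
    by apply: sumr_ge0 => t _; rewrite !mulr_ge0.
  case: ifP => // _; rewrite mulr_sumr big_mkcond/=; apply: ler_sum => t _.
  case: ifP => _; last by rewrite !mulr_ge0.
  rewrite mulrACA; apply: ler_wpM2l; first by rewrite mulr_ge0.
  have [->|] := eqVneq (t0 i) (s i); last by rewrite mul0r.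
  by rewrite mul1r.
have h3 : \sum_i a i ^+ 2 <= n%:R * (y * Z ^+ 2 + \sum_s w s * near_mass y s).
  apply: (@le_trans _ _ (\sum_i \sum_s \sum_t w s * w t * (s i == t i)%:R)).
    by apply: ler_sum => i _; exact: h2.
  rewrite exchange_big/= mulrDr [n%:R * \sum_s _]mulr_sumr.
  have -> : n%:R * (y * Z ^+ 2) = \sum_s n%:R * (y * (w s * Z)).
    by rewrite expr2 {1}ZE mulr_suml !mulr_sumr.
  rewrite -big_split/=; apply: ler_sum => s _; rewrite exchange_big/=.
  have -> : n%:R * (y * (w s * Z)) + n%:R * (w s * near_mass y s) =
    \sum_t n%:R * (w s * w t * (y + (y <= overlap R s t)%R%:R)).
    rewrite -mulr_sumr -mulrDr; congr (_ * _).
    rewrite /near_mass [\sum_(t | y <= overlap R s t) w t]big_mkcond/= ZE !mulr_sumr -big_split/=.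
    by apply: eq_bigr => t _; case: ifP => _ /=; ring.
  apply: ler_sum => t _; rewrite -mulr_sumr overlap_sum mulrCA.
  apply: ler_wpM2l => //; apply: ler_wpM2l; first by rewrite mulr_ge0.
  have := overlap_le1 s t; case: (lerP y (overlap R s t)) => h h' /=; lra.
have h4 : n%:R * (x * p) ^+ 2 <= \sum_i a i ^+ 2.
  have h5 : \sum_i (2 * (x * p) * a i - (x * p) ^+ 2) <= \sum_i a i ^+ 2.
    by apply: ler_sum => i _; have := sqr_ge0 (a i - x * p); nra.
  apply: le_trans h5; rewrite sumrB -mulr_sumr sumr_const card_ord -[_ *+ n]mulr_natl.
  have xp0 : 0 <= 2 * (x * p) by rewrite !mulr_ge0.
  have := ler_wpM2l xp0 h1; lra.
by rewrite -(ler_pM2l nR); apply: le_trans h4 h3.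
Qed.

(** The linear form of [overlap_mass_sqr], from p <= z Z + p^2 / (z Z). Dividing by [Z]
    a single time is what makes the right-hand side an integral under the joint law. *)
Lemma overlap_mass_le (t0 : 'S_n) (x y z : R) : 0 < x -> 0 <= y -> 0 < z ->
  \sum_(s | x < overlap R t0 s) w s <=
  (z + y / (z * x ^+ 2)) * Z + (z * x ^+ 2)^-1 * \sum_s w s * (near_mass y s / Z).
Proof.
move=> x0 y0 z0; set p := \sum_(s | _) _.
have h := overlap_mass_sqr t0 (ltW x0) y0; rewrite -/p in h.
have -> : \sum_s w s * (near_mass y s / Z) = (\sum_s w s * near_mass y s) / Z.
  by rewrite mulr_suml; apply: eq_bigr => s _; rewrite mulrA.
move: (\sum_s w s * near_mass y s) h => M h.
have hp : p <= z * Z + p ^+ 2 / (z * Z).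
  have zZ : 0 < z * Z by exact: mulr_gt0.
  rewrite -lerBlDl ler_pdivlMr//; have := sqr_ge0 (p - z * Z); have := sqr_ge0 (z * Z); have := sqr_ge0 p.
  nra.
apply: le_trans hp _.
have -> : (z + y / (z * x ^+ 2)) * Z + (z * x ^+ 2)^-1 * (M / Z) =
   z * Z + (y * Z ^+ 2 + M) / (x ^+ 2 * (z * Z)).
  by field; rewrite !gt_eqF.
rewrite lerD2l.
have -> : p ^+ 2 / (z * Z) = (x * p) ^+ 2 / (x ^+ 2 * (z * Z)).
  by field; rewrite !gt_eqF.
by apply: ler_wpM2r => //; rewrite invr_ge0 !mulr_ge0// ltW.
Qed.

(** The posterior mass [near_mass y s / Z] is at most 1, which handles bad [s] and,
    through the total mass [Z], the case where [Z] is at most [x]; in the remaining case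
    [Z^-1] is at most [x^-1]. *)
Lemma near_mass_split (y x : R) (good : pred 'S_n) : 0 < x ->
  \sum_s w s * (near_mass y s / Z) <=
  x + \sum_(s | ~~ good s) w s + x^-1 * \sum_(s | good s) w s * near_mass y s.
Proof.
move=> x0.
have nm0 s : 0 <= near_mass y s by apply: sumr_ge0.
have nmZ s : near_mass y s / Z <= 1.
  rewrite ler_pdivrMr// mul1r ZE /near_mass big_mkcond/=; apply: ler_sum => t _.
  by case: ifP.
have [Zx|Zx] := lerP Z x.
  apply: (@le_trans _ _ x); last first.
    rewrite -addrA lerDl addr_ge0 ?sumr_ge0// mulr_ge0 ?sumr_ge0 ?invr_ge0 ?ltW// => s _.
    by rewrite mulr_ge0.
  apply: le_trans Zx; rewrite [leRHS]ZE; apply: ler_sum => s _.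
  by rewrite -[leRHS]mulr1; apply: ler_wpM2l.
rewrite (bigID good)/= addrC mulr_sumr.
apply: (@le_trans _ _ (\sum_(s | ~~ good s) w s + \sum_(s | good s) x^-1 * (w s * near_mass y s))).
  apply: lerD; apply: ler_sum => s _.
    by rewrite -[leRHS]mulr1; apply: ler_wpM2l.
  rewrite [leRHS]mulrCA; apply: ler_wpM2l => //; rewrite [leLHS]mulrC; apply: ler_wpM2r => //.
  by rewrite lef_pV2 ?posrE// ltW.
by rewrite lerD2r lerDr ltW.
Qed.

End second_moment.

(** * Truncation of the likelihood *)

Section integral_bounds.
Context d (T : measurableType d) (R : realType) (m : probability T R).

(** Bundling measurability and positivity with the bound on the integral allows bounds
    on composite integrands to be assembled along their syntax. *)
Definition int_le (f : T -> R) (a : R) :=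
  [/\ measurable_fun setT f, forall x, 0 <= f x & (\int[m]_x (f x)%:E <= a%:E)%E].

Lemma int_leD f g a b : int_le f a -> int_le g b -> int_le (fun x => f x + g x) (a + b).
Proof.
move=> [mf f0 hf] [mg g0 hg]; split.
- exact: measurable_funD.
- by move=> x; exact: addr_ge0.
under eq_integral do rewrite EFinD.
have mEf : measurable_fun setT (fun x => (f x)%:E) by exact/measurable_EFinP.
have mEg : measurable_fun setT (fun x => (g x)%:E) by exact/measurable_EFinP.
have -> : (\int[m]_x ((f x)%:E + (g x)%:E) = \int[m]_x (f x)%:E + \int[m]_x (g x)%:E)%E.
  by apply: ge0_integralD => // x _; rewrite lee_fin.
by rewrite EFinD; exact: leeD.
Qed.

Lemma int_leZ k f a : 0 <= k -> int_le f a -> int_le (fun x => k * f x) (k * a).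
Proof.
move=> k0 [mf f0 hf]; split.
- exact: measurable_funM.
- by move=> x; exact: mulr_ge0.
under eq_integral do rewrite EFinM.
have mEf : measurable_fun setT (fun x => (f x)%:E) by exact/measurable_EFinP.
have -> : (\int[m]_x (k%:E * (f x)%:E) = k%:E * \int[m]_x (f x)%:E)%E.
  by apply: ge0_integralZl => // x _; rewrite lee_fin.
by rewrite EFinM; apply: lee_wpmul2l => //; rewrite lee_fin.
Qed.

Lemma int_le_cst a : 0 <= a -> int_le (fun=> a) a.
Proof. by move=> a0; split => //; rewrite integral_prob_cst. Qed.

Lemma int_le_sum (I : Type) (r : seq I) (Q : pred I) (f : I -> T -> R) (a : I -> R) :
  (forall i, Q i -> int_le (f i) (a i)) ->
  int_le (fun x => \sum_(i <- r | Q i) f i x) (\sum_(i <- r | Q i) a i).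
Proof.
move=> h; elim: r => [|i r IH].
  rewrite big_nil (_ : (fun x => _) = fun=> 0); first exact: int_le_cst.
  by apply/funext => x; rewrite big_nil.
rewrite big_cons (_ : (fun x => _) = fun x => if Q i then f i x + \sum_(j <- r | Q j) f j x
    else \sum_(j <- r | Q j) f j x); last by apply/funext => x; rewrite big_cons.
by case: (boolP (Q i)) => Qi //; apply: int_leD => //; exact: h.
Qed.

Lemma int_le_mono f a b : a <= b -> int_le f a -> int_le f b.
Proof. by move=> ab [mf f0 hf]; split => //; apply: le_trans hf _; rewrite lee_fin. Qed.

End integral_bounds.

Section truncation.
Context (R : realType) (n : nat) (rho : R).
Local Notation gamma := (@gauss R).
Local Notation G := (power gamma #|{: edge n}|).
Local Notation G2 := (G \x G)%E.
Local Notation W := (power (bivariate rho) #|{: edge n}|).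
Hypotheses (r64 : rho ^+ 2 <= 64^-1) (n0 : (0 < n)%N).
Variables (y : R) (theta : {set 'I_n} -> R).

Let rho1 : rho ^+ 2 < 1. Proof. by apply: le_lt_trans r64 _; rewrite invf_lt1// ltr1n. Qed.

Let many (S : {set 'I_n}) := y * n%:R <= #|S|%:R.

(** The truncation: no large set of points has an excessive likelihood. It bears on all
    sets at once, so that it depends on [s] and not on the second sample. *)
Definition good (s : 'S_n) (z : obs n R * obs n R) :=
  [forall S : {set 'I_n}, many S ==> (likelihood rho (inside S) s z <= expR (theta S))].

(** Contains all observations that are not [good], seen on the matched family, whose law
    given the latent permutation does not depend on it. *)
Definition atypical : set (fam (edge n) (R * R)%type) :=
  [set u | exists2 S, many S & theta S <= \sum_(e | inside S e) loglr rho (coord u e)].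

Lemma measurable_atypical_at S : measurable
  [set u : fam (edge n) (R * R)%type | theta S <= \sum_(e | inside S e) loglr rho (coord u e)].
Proof.
apply: measurable_le_set => //.
rewrite (_ : (fun u => _) = fun u => \sum_e (if inside S e then loglr rho (coord u e) else 0)).
  apply: measurable_sum => e; case: (inside S e); last exact: measurable_cst.
  exact: (measurableT_comp (measurable_loglr rho) (measurable_coord e)).
by apply/funext => u; rewrite [LHS]big_mkcond.
Qed.

Lemma measurable_atypical : measurable atypical.
Proof. by apply: measurable_exists2 => S; exact: measurable_atypical_at. Qed.

Lemma atypical_le (l : R) : 0 <= l <= 1 ->
  (W atypical <= \sum_(S | many S) (expR ('C(#|S|, 2)%:R *
     (l / 2 * (rho ^+ 2 + rho ^+ 4) + 4 * l ^+ 2 * rho ^+ 2) - l * theta S))%:E)%E.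
Proof.
move=> /andP[l0 l1].
apply: le_trans (measure_union_le _ _ measurable_atypical_at) _.
apply: lee_sum => S _.
have r16 : rho ^+ 2 <= 16^-1 by move: r64; lra.
have l01 : 0 <= l <= 1 by rewrite l0.
have h := mgf_power (p := bivariate rho) (E := edge n)
  (fun e => mgf_le_if (fun _ : inside S e => mgf_loglr rho1 r16 l01)).
rewrite -big_mkcond/= sumr_const in h.
have hc : #|[pred e | inside S e]| = 'C(#|S|, 2) by rewrite -card_inside.
have := mgf_le_markov (l * theta S) h; rewrite hc -[_ *+ 'C(#|S|, 2)]mulr_natl.
apply: le_trans; rewrite le_measure ?inE//.
- exact: measurable_atypical_at.
- by apply: measurable_le_set => //; exact: h.1.
- move=> u /= hu; rewrite -big_mkcond/= -mulr_sumr; exact: ler_wpM2l.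
Qed.

Lemma measurable_good s : measurable_fun setT (fun z => (good s z)%:R : R).
Proof.
rewrite (_ : (fun z => _) = fun z => \prod_S
    (\1_([set z | many S -> likelihood rho (inside S) s z <= expR (theta S)]) z : R)).
  apply: measurable_prod => S _; apply: measurable_indic.
  case: (boolP (many S)) => mS.
    rewrite (_ : mkset _ = [set z | likelihood rho (inside S) s z <= expR (theta S)]).
      by apply: measurable_le_set => //; exact: measurable_likelihood.
    by apply/seteqP; split => z /= h //; exact: h.
  by rewrite (_ : mkset _ = setT)//; apply/seteqP; split.
apply/funext => z; rewrite /good; case: forallP => h.
  rewrite big1// => S _; rewrite indicE mem_set//= => mS.
  by have := h S; rewrite mS.
move/boolp.existsNP: h => [S /negP]; rewrite negb_imply => /andP[mS hS].
rewrite (bigD1 S)//= indicE memNset ?mul0r//= => h.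
by rewrite h in hS.
Qed.

Lemma int_bad s : int_le G2 (fun z => (~~ good s z)%:R * likelihood rho predT s z)
  (fine (W atypical)).
Proof.
have mN : measurable_fun setT (fun z => (~~ good s z)%:R : R).
  rewrite (_ : (fun z => _) = fun z => 1 - (good s z)%:R).
    by apply: measurable_funB => //; exact: measurable_good.
  by apply/funext => z; case: (good s z); rewrite ?subrr ?subr0.
have mL := measurable_likelihood rho predT s.
split.
- exact: measurable_funM.
- by move=> z; rewrite mulr_ge0// likelihood_ge0.
rewrite fineK ?fin_num_measure//; last exact: measurable_atypical.
rewrite -(likelihood_law rho1 s measurable_atypical).
have mz : measurable_fun setT (fun z : obs n R * obs n R =>
    of_fun (fun e => (entry z.1 (perm_edge s e), entry z.2 e))).
  by apply: measurable_of_fun => e; exact: measurable_entry_pair.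
apply: ge0_le_integral => //.
- by move=> z _; rewrite lee_fin mulr_ge0// likelihood_ge0.
- by apply/measurable_EFinP; exact: measurable_funM.
- apply/measurable_EFinP; apply: measurable_funM => //.
  have mi : measurable_fun setT (\1_atypical : _ -> R).
    by apply: measurable_indic; exact: measurable_atypical.
  exact: (measurableT_comp mi mz).
move=> z _; rewrite lee_fin; apply: ler_wpM2r; first exact: likelihood_ge0.
case: (boolP (good s z)) => //=; rewrite negb_forall => /existsP[S].
rewrite negb_imply -ltNge => /andP[mS hS]; rewrite indicE mem_set//=.
exists S => //; rewrite -ler_expR expR_sum; apply: le_trans (ltW hS) _.
rewrite le_eqVlt; apply/orP; left; apply/eqP; apply: eq_bigr => e _.
by rewrite coord_of_fun lratio_exp.
Qed.

Lemma int_good s t : many (agree s t) ->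
  int_le G2 (fun z => expR (theta (agree s t)) *
     (likelihood rho predT s z * likelihood rho [predC inside (agree s t)] t z))
  (expR (theta (agree s t)) *
    expR (17 * (rho ^+ 2) ^+ 2 * #|{: edge n}|%:R + 4 * rho ^+ 2 * n%:R)).
Proof.
move=> ms; apply: int_leZ; first exact: expR_ge0.
split.
- by apply: measurable_funM; exact: measurable_likelihood.
- by move=> z; rewrite mulr_ge0// likelihood_ge0.
- exact: integral_cross_likelihood.
Qed.

(** The edges inside the agreement set occur in both likelihoods with the same factors;
    one of the two occurrences is replaced by the truncation level. *)
Lemma good_pair s t z : many (agree s t) -> good s z ->
  likelihood rho predT s z * likelihood rho predT t z <=
  expR (theta (agree s t)) *
     (likelihood rho predT s z * likelihood rho [predC inside (agree s t)] t z).
Proof.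
move=> ms /forallP/(_ (agree s t)); rewrite ms/= => h.
rewrite [likelihood rho predT t z](likelihood_split rho (agree s t)) -likelihood_agree.
rewrite mulrCA; apply: ler_wpM2r => //.
by rewrite mulr_ge0// likelihood_ge0.
Qed.

End truncation.

Section estimator_bound.
Context (R : realType) (n : nat) (d : measure_display) (T : measurableType d)
  (P : probability T R) (rho : R) (pi : {RV P >-> 'S_n}) (A B : {RV P >-> obs n R}).
Hypothesis hmodel : correlated_gaussian rho pi A B.
Hypotheses (r64 : rho ^+ 2 <= 64^-1) (n0 : (0 < n)%N).
Variable est : estimator n R.
Local Notation gamma := (@gauss R).
Local Notation G := (power gamma #|{: edge n}|).
Local Notation G2 := (G \x G)%E.
Local Notation W := (power (bivariate rho) #|{: edge n}|).
Variables (x y z delta : R) (theta : {set 'I_n} -> R).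
Hypotheses (x0 : 0 < x) (y0 : 0 <= y) (z0 : 0 < z) (delta0 : 0 < delta).

Let many (S : {set 'I_n}) := y * n%:R <= #|S|%:R.
Let cross := expR (17 * (rho ^+ 2) ^+ 2 * #|{: edge n}|%:R + 4 * rho ^+ 2 * n%:R).
Let rho1 : rho ^+ 2 < 1. Proof. by apply: le_lt_trans r64 _; rewrite invf_lt1// ltr1n. Qed.
Let nR : 0 < n%:R :> R. Proof. by rewrite ltr0n. Qed.
Let f0 : 0 < n`!%:R :> R. Proof. by rewrite ltr0n fact_gt0. Qed.

Let w (s : 'S_n) (u : obs n R * obs n R) := n`!%:R^-1 * likelihood rho predT s u.

Let w0 s u : 0 <= w s u.
Proof. by rewrite mulr_ge0 ?likelihood_ge0// invr_ge0 ltW. Qed.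

Let overlap_many s t : (y <= overlap R s t) = many (agree s t).
Proof.
rewrite /overlap ler_pdivlMr// /many; congr (_ <= _%:R).
by apply: eq_card => i; rewrite !inE.
Qed.

(** The truncated second-moment bound for a fixed size. Of its terms, [x], [y] and [z]
    are free parameters of the argument, [atypical] measures the bad observations, and the
    sum over [S] is the truncated second moment, in which #|~: S|! counts the permutations
    agreeing with a given one on [S]. *)
Lemma estimator_overlap_le :
  (P [set v | delta < overlap R (est (A v, B v)) (pi v)]%R <=
   (z + y / (z * delta ^+ 2) + (z * delta ^+ 2)^-1 *
     (x + fine (W (atypical rho y theta)) + x^-1 *
       (n`!%:R^-1 * \sum_(S | many S) (#|(~: S)%SET|)`!%:R * (expR (theta S) * cross))))%:E)%E.
Proof.
pose K s : set (obs n R * obs n R) := [set u | delta < overlap R (est u) s].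
have mK s : measurable (K s).
  rewrite (_ : K s = [set u | exists2 t, delta < overlap R t s & est u = t]).
    apply: measurable_exists2 => t.
    exact: (measurable_funPTI est (Y := [set t])).
  apply/seteqP; split => u /=; first by move=> h; exists (est u).
  by move=> [t h ht]; rewrite /K/= ht.
have hs s := joint_density rho1 hmodel s (mK s).
have mX s : measurable [set v | pi v = s /\ K s (A v, B v)].
  have mphi : measurable_fun setT (fun v => (A v, B v)).
    by apply: measurable_fun_pair; exact: measurable_funP.
  change (measurable (pi @^-1` [set s] `&` (fun v => (A v, B v)) @^-1` K s)).
  apply: measurableI; first exact: (measurable_funPTI pi (Y := [set s])).
  by rewrite -[X in measurable X]setTI; exact: mphi.
apply: (@le_trans _ _ (\sum_(s : 'S_n) P [set v | pi v = s /\ K s (A v, B v)])%E).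
  apply: le_trans (measure_union_le _ predT mX).
  rewrite le_measure ?inE//.
  - exact: (measurable_est_event _ _ _ _ (fun s t => delta < overlap R s t)).
  - exact: measurable_exists2.
  by move=> v /= h; exists (pi v).
pose F u := (z + y / (z * delta ^+ 2)) * (\sum_s w s u) + (z * delta ^+ 2)^-1 *
  (x + \sum_s n`!%:R^-1 * ((~~ good rho y theta s u)%:R * likelihood rho predT s u) +
   x^-1 * \sum_s \sum_(t | many (agree s t)) (n`!%:R^-1 * n`!%:R^-1) * (expR (theta (agree s t)) *
     (likelihood rho predT s u * likelihood rho [predC inside (agree s t)] t u))).
have z2 : 0 < z * delta ^+ 2 by rewrite mulr_gt0// exprn_gt0.
have c1 : 0 <= z + y / (z * delta ^+ 2) by rewrite addr_ge0 ?divr_ge0// ltW.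
have fV : 0 <= n`!%:R^-1 :> R by rewrite invr_ge0 ltW.
have hF : int_le G2 F (z + y / (z * delta ^+ 2) + (z * delta ^+ 2)^-1 *
     (x + fine (W (atypical rho y theta)) + x^-1 *
       (n`!%:R^-1 * \sum_(S | many S) (#|(~: S)%SET|)`!%:R * (expR (theta S) * cross)))).
  rewrite -[X in int_le _ _ (X + _)]mulr1; apply: int_leD.
    apply: int_leZ => //.
    have -> : 1 = \sum_(s : 'S_n) n`!%:R^-1 * 1 :> R.
      by rewrite sumr_const card_Sn mulr1 -[RHS]mulr_natl divff// gt_eqF.
    apply: int_le_sum => s _; apply: int_leZ => //; split.
    - exact: measurable_likelihood.
    - by move=> u; exact: likelihood_ge0.
    - by rewrite likelihood_total.
  apply: int_leZ; first by rewrite invr_ge0 ltW.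
  apply: int_leD; first (apply: int_leD; first exact: int_le_cst (ltW x0)).
    have -> : fine (W (atypical rho y theta)) =
        \sum_(s : 'S_n) n`!%:R^-1 * fine (W (atypical rho y theta)).
      by rewrite sumr_const card_Sn -[RHS]mulr_natl mulrA divff ?mul1r// gt_eqF.
    by apply: int_le_sum => s _; apply: int_leZ => //; exact: int_bad.
  apply: int_leZ; first by rewrite invr_ge0 ltW.
  apply: (int_le_mono (a := \sum_(s : 'S_n) \sum_(t | many (agree s t))
     (n`!%:R^-1 * n`!%:R^-1) * (expR (theta (agree s t)) * cross))).
    apply: (@le_trans _ _ (\sum_(s : 'S_n) n`!%:R^-1 * (n`!%:R^-1 *
        \sum_(S | many S) (#|(~: S)%SET|)`!%:R * (expR (theta S) * cross)))).
      apply: ler_sum => s _; rewrite -mulr_sumr -mulrA; apply: ler_wpM2l => //.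
      apply: ler_wpM2l => //.
      apply: (@sum_agree_le R n s many (fun S => expR (theta S) * cross)) => S.
      by rewrite mulr_ge0 ?expR_ge0.
    by rewrite sumr_const card_Sn -[leLHS]mulr_natl mulrA divff ?mul1r// gt_eqF.
  apply: int_le_sum => s _; apply: int_le_sum => t mt.
  apply: int_leZ; first exact: mulr_ge0.
  by have := int_good r64 theta mt; exact.
have [mF F0 IF] := hF; apply: le_trans IF.
under eq_bigr do rewrite hs.
have mKL s : measurable_fun setT (fun u => \1_(K s) u * likelihood rho predT s u).
  by apply: measurable_funM; [exact: measurable_indic|exact: measurable_likelihood].
have -> : (\sum_(s : 'S_n) n`!%:R^-1%:E * \int[G2]_u (\1_(K s) u * likelihood rho predT s u)%:E =
   \int[G2]_u (\sum_(s : 'S_n) \1_(K s) u * w s u)%:E)%E.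
  under [RHS]eq_integral do rewrite -sumEFin.
  rewrite ge0_integral_sum//.
  - apply: eq_bigr => s _; rewrite -ge0_integralZl//.
    + by apply: eq_integral => u _; rewrite -EFinM /w mulrCA.
    + exact/measurable_EFinP.
    + by move=> u _; rewrite lee_fin mulr_ge0// likelihood_ge0.
  - move=> s; apply/measurable_EFinP; apply: measurable_funM; first exact: measurable_indic.
    by apply: measurable_funM => //; exact: measurable_likelihood.
  - by move=> s u _; rewrite lee_fin mulr_ge0.
apply: ge0_le_integral => //.
- by move=> u _; rewrite lee_fin sumr_ge0// => s _; rewrite mulr_ge0.
- apply/measurable_EFinP; apply: measurable_sum => s; apply: measurable_funM.
    exact: measurable_indic.
  by apply: measurable_funM => //; exact: measurable_likelihood.
- exact/measurable_EFinP.
move=> u _; rewrite lee_fin.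
pose Z := \sum_s w s u.
have Z0 : 0 < Z.
  rewrite /Z (bigD1 1%g)//= ltr_wpDr//; first by apply: sumr_ge0.
  by rewrite mulr_gt0 ?invr_gt0// likelihood_gt0.
have -> : \sum_(s : 'S_n) \1_(K s) u * w s u = \sum_(s | delta < overlap R (est u) s) w s u.
  rewrite [RHS]big_mkcond/=; apply: eq_bigr => s _; rewrite indicE.
  case: ifP => h; first by rewrite mem_set// mul1r.
  by rewrite memNset ?mul0r//= /K/= h.
apply: le_trans (overlap_mass_le n0 (w0^~ u) (erefl Z) Z0 (est u) delta0 y0 z0) _.
rewrite /F lerD2l; apply: ler_wpM2l; first by rewrite invr_ge0 ltW.
apply: le_trans (near_mass_split (w0^~ u) (erefl Z) Z0 y (good rho y theta ^~ u) x0) _.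
apply: lerD; first rewrite lerD2l big_mkcond/=.
  apply: ler_sum => s _; case: (good rho y theta s u) => /=; first by rewrite mul0r mulr0.
  by rewrite mul1r.
apply: ler_wpM2l; first by rewrite invr_ge0 ltW.
rewrite big_mkcond/=; apply: ler_sum => s _.
have hp t : 0 <= (n`!%:R^-1 * n`!%:R^-1) * (expR (theta (agree s t)) *
     (likelihood rho predT s u * likelihood rho [predC inside (agree s t)] t u)).
  by rewrite !mulr_ge0 ?expR_ge0 ?likelihood_ge0.
case: ifP => hg; last by apply: sumr_ge0.
rewrite mulr_sumr (eq_bigl (fun t => many (agree s t))); last by move=> t; exact: overlap_many.
apply: ler_sum => t mt; rewrite /w mulrACA; apply: ler_wpM2l; first exact: mulr_ge0.
exact: good_pair mt hg.
Qed.

End estimator_bound.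

(** * Impossibility below the threshold *)

(** Chernoff at the parameter e / 128: the excess e / 8 of the threshold over the mean
    is of first order in it, the fluctuations of second order. *)
Lemma exponent_atypical (R : realFieldType) (e v r j b : R) :
  0 < e <= 1 -> 0 <= r <= v -> v <= e / 64 -> 0 <= b <= j ^+ 2 / 2 ->
  b * (e / 128 / 2 * (r + r ^+ 2) + 4 * (e / 128) ^+ 2 * r) -
    e / 128 * ((1 + e / 8) * v * j ^+ 2 / 4) <= - (e ^+ 2 * v * j ^+ 2 / (128 * 128)).
Proof.
move=> /andP[e0 e1] /andP[r0 rv] ve /andP[b0 bj].
have v0 : 0 <= v by apply: le_trans rv.
have h1 : e / 128 / 2 * (r + r ^+ 2) + 4 * (e / 128) ^+ 2 * r <=
    v * (e / 256 * (1 + 3 * e / 32)).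
  have -> : e / 128 / 2 * (r + r ^+ 2) + 4 * (e / 128) ^+ 2 * r =
      r * (e / 256 * (1 + r + e / 16)) by field.
  apply: ler_pM => //; first by apply: mulr_ge0; lra.
  by apply: ler_wpM2l; lra.
have h0 : 0 <= e / 128 / 2 * (r + r ^+ 2) + 4 * (e / 128) ^+ 2 * r.
  apply: addr_ge0; apply: mulr_ge0 => //; first by lra.
    by rewrite addr_ge0 ?sqr_ge0.
  by apply: mulr_ge0 => //; exact: sqr_ge0.
have := ler_pM b0 h0 bj h1.
set X := b * _.
have -> : j ^+ 2 / 2 * (v * (e / 256 * (1 + 3 * e / 32))) =
  e / 128 * ((1 + e / 8) * v * j ^+ 2 / 4) - e ^+ 2 * v * j ^+ 2 / (128 * 128) by field.
lra.
Qed.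

(** A weak form of the Stirling formula. *)
Lemma expn_le_fact_expR (R : realType) j : j%:R ^+ j <= j`!%:R * expR j%:R :> R.
Proof.
elim: j => [|j IH]; first by rewrite expr0 mul1r expR0.
have h : j.+1%:R ^+ j <= expR 1 * j%:R ^+ j :> R.
  case: j {IH} => [|j]; first by rewrite !expr0 mulr1 -[leLHS]expR0 ler_expR.
  have -> : j.+2%:R = (1 + j.+1%:R^-1) * j.+1%:R :> R.
    by rewrite mulrDl mul1r mulVf ?pnatr_eq0// natr1.
  rewrite exprMn; apply: ler_wpM2r; first exact: exprn_ge0.
  apply: (@le_trans _ _ (expR j.+1%:R^-1 ^+ j.+1)).
    by apply: lerXn2r; rewrite ?nnegrE ?expR_ge0 ?expR_ge1Dx// addr_ge0 ?invr_ge0.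
  by rewrite -expRM_natl mulfV ?pnatr_eq0.
rewrite exprS factS natrM -mulrA; apply: ler_wpM2l => //.
rewrite -natr1 [_ + 1]addrC expRD mulrCA nat1r; apply: le_trans h _.
by apply: ler_wpM2l => //; exact: expR_ge0.
Qed.

Lemma fact_ratio_le (R : realType) (n : nat) (y : R) (S : {set 'I_n}) :
  (0 < n)%N -> 0 < y -> y * n%:R <= #|S|%:R ->
  n`!%:R^-1 * (#|(~: S)%SET|)`!%:R <= expR (#|S|%:R * (1 - ln y - ln n%:R)) :> R.
Proof.
move=> n0 y0 hS; set j := #|S| in hS *.
have nR : 0 < n%:R :> R by rewrite ltr0n.
have jn : (j <= n)%N by rewrite -[leqRHS]card_ord max_card.
have jR : 0 < j%:R :> R by apply: lt_le_trans hS; exact: mulr_gt0.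
have -> : #|(~: S)%SET| = (n - j)%N by rewrite cardsCs finset.setCK card_ord.
have fE : n`!%:R = 'C(n, j)%:R * (j`!%:R * (n - j)`!%:R) :> R by rewrite -!natrM bin_fact.
have f0 m : 0 < m`!%:R :> R by rewrite ltr0n fact_gt0.
apply: (@le_trans _ _ (j`!%:R^-1)).
  rewrite ler_pdivrMl// ler_pdivlMr// fE mulrC ler_peMl ?mulr_ge0//.
  by rewrite ler1n bin_gt0.
have yn0 : 0 < y * n%:R by apply: mulr_gt0.
have -> : j%:R * (1 - ln y - ln n%:R) = j%:R - j%:R * ln (y * n%:R) :> R.
  by rewrite lnM ?posrE//; ring.
rewrite expRD expRN expRM_natl lnK ?posrE// -[leLHS]mulr1 ler_pdivrMl// mulrA.
rewrite ler_pdivlMr ?exprn_gt0// mul1r.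
apply: le_trans (expn_le_fact_expR R j).
by apply: lerXn2r; rewrite ?nnegrE// ltW.
Qed.

Section below_threshold.
Context (R : realType) (n : nat) (rho e y : R).
Local Notation L := (ln n%:R : R).
Local Notation W := (power (bivariate rho) #|{: edge n}|).
Hypotheses (e01 : 0 < e <= 1) (y0 : 0 < y) (n0 : (0 < n)%N) (L1 : 1 <= L)
  (nL : 256 / e * L <= n%:R) (nL2 : 288 * L ^+ 2 <= n%:R)
  (Le : 128 * 128 / (e ^+ 2 * y ^+ 2) <= L) (Ly : 8 * (4 / y + 1 + `|ln y|) / e <= L)
  (rhoL : rho ^+ 2 <= (4 - e) * L / n%:R).

Let v := (4 - e) * L / n%:R.
(** For [rho ^+ 2] at the largest allowed value [v], the log-likelihood of the edges
    inside [S] has mean about v |S|^2 / 4. The margin e / 8 makes larger values unlikely,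
    while (1 + e / 8) (1 - e / 4) <= 1 - e / 8 keeps the threshold below |S| log n. *)
Definition threshold (S : {set 'I_n}) := (1 + e / 8) * v * #|S|%:R ^+ 2 / 4.
Let many (S : {set 'I_n}) := y * n%:R <= #|S|%:R.

Let nR : 0 < n%:R :> R. Proof. by rewrite ltr0n. Qed.
Let e0 : 0 < e. Proof. by case/andP: e01. Qed.
Let e1 : e <= 1. Proof. by case/andP: e01. Qed.

Let v_le4 : v <= 4 * L / n%:R.
Proof.
rewrite /v ler_wpM2r ?invr_ge0// ?(ltW nR)// ler_wpM2r//; first by apply: le_trans L1.
by have := e0; lra.
Qed.

Let v_le : v <= e / 64.
Proof.
apply: le_trans v_le4 _; rewrite ler_pdivrMr//.
have : e * (256 / e * L) <= e * n%:R by apply: ler_wpM2l => //; exact: ltW.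
have -> : e * (256 / e * L) = 256 * L by field; rewrite gt_eqF.
lra.
Qed.

Lemma sqr_correlation_small : rho ^+ 2 <= 64^-1.
Proof. by apply: le_trans rhoL _; apply: le_trans v_le _; have := e1; lra. Qed.

Lemma atypical_small : fine (W (atypical rho y threshold)) <= expR (- n%:R).
Proof.
have l01 : 0 <= e / 128 <= 1 by have := e0; have := e1; lra.
rewrite -lee_fin fineK; last first.
  exact: fin_num_measure (measurable_atypical _ _ _).
apply: le_trans (atypical_le sqr_correlation_small y threshold l01) _.
rewrite sumEFin lee_fin; apply: sum_subsets_le => S mS; rewrite ler_expR.
have -> : rho ^+ 4 = (rho ^+ 2) ^+ 2 by rewrite -exprM.
have hb : 0 <= ('C(#|S|, 2)%:R : R) <= #|S|%:R ^+ 2 / 2.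
  rewrite ler0n natr_bin2 ler_wpM2r// expr2 ler_wpM2l//; lra.
have hr : 0 <= rho ^+ 2 <= v by rewrite sqr_ge0.
apply: le_trans (exponent_atypical e01 hr v_le hb) _; rewrite lerN2.
apply: (@le_trans _ _ (e ^+ 2 * v * (y * n%:R) ^+ 2 / (128 * 128))).
  have -> : e ^+ 2 * v * (y * n%:R) ^+ 2 / (128 * 128) =
      ((4 - e) * n%:R) * (L * (e ^+ 2 * y ^+ 2) / (128 * 128)).
    by rewrite /v; field; rewrite gt_eqF.
  have : 1 <= L * (e ^+ 2 * y ^+ 2) / (128 * 128).
    by rewrite ler_pdivlMr// mul1r -ler_pdivrMr// mulr_gt0// exprn_gt0.
  move=> h; apply: (@le_trans _ _ ((4 - e) * n%:R * 1)).
    by rewrite mulr1; apply: ler_wpM2r; [exact: ltW|have := e1; lra].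
  by apply: ler_wpM2l => //; rewrite mulr_ge0//; have := e1; lra.
rewrite ler_wpM2r// ler_wpM2l//.
  by rewrite mulr_ge0 ?sqr_ge0// (le_trans _ rhoL) ?sqr_ge0.
by apply: lerXn2r; rewrite ?nnegrE ?mulr_ge0// ltW.
Qed.

(** Each set contributes exp (|S| (1 - log y - log n)) by counting and exp ((1 - e / 8)
    |S| log n) by the threshold. The product is exp (- (e / 8) |S| log n + O (n)), and |S|
    >= y n. *)
Lemma cross_small :
  n`!%:R^-1 * \sum_(S | many S) (#|(~: S)%SET|)`!%:R * (expR (threshold S) *
    expR (17 * (rho ^+ 2) ^+ 2 * #|{: edge n}|%:R + 4 * rho ^+ 2 * n%:R)) <=
  expR (- n%:R).
Proof.
rewrite mulr_sumr; apply: sum_subsets_le => S mS; rewrite [leLHS]mulrA.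
set c := expR (threshold S) * _.
have c0 : 0 <= c by rewrite mulr_ge0 ?expR_ge0.
apply: le_trans (ler_wpM2r c0 (fact_ratio_le n0 y0 mS)) _.
rewrite {}/c in c0 *.
rewrite -!expRD ler_expR {c0}; set j : R := #|S|%:R.
have jn : j <= n%:R by rewrite ler_nat -[leqRHS]card_ord max_card.
have j0 : 0 <= j by [].
have cE : 17 * (rho ^+ 2) ^+ 2 * #|{: edge n}|%:R + 4 * rho ^+ 2 * n%:R <= n%:R.
  have hr : rho ^+ 2 * n%:R <= 4 * L by rewrite -ler_pdivlMr// (le_trans rhoL).
  have hE : #|{: edge n}|%:R <= n%:R ^+ 2 :> R.
    rewrite card_edge natr_bin2; have : 0 <= n%:R ^+ 2 :> R by exact: sqr_ge0.
    by have := nR; rewrite expr2; lra.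
  have h1 : (rho ^+ 2) ^+ 2 * #|{: edge n}|%:R <= (4 * L) ^+ 2.
    apply: le_trans (ler_wpM2l (sqr_ge0 _) hE) _.
    rewrite -exprMn; apply: lerXn2r => //; rewrite nnegrE.
      by rewrite mulr_ge0 ?sqr_ge0.
    by move: L1; lra.
  have h2 : L <= L ^+ 2 by rewrite expr2 ler_peMl// (le_trans _ L1).
  move: h1; rewrite exprMn; move: hr h2 nL2; lra.
have th : threshold S <= (1 - e / 8) * L * j.
  have -> : threshold S = (1 + e / 8) * (1 - e / 4) * L * j * (j / n%:R).
    by rewrite /threshold /v -/j; field; rewrite gt_eqF.
  have c0 : 0 <= (1 + e / 8) * (1 - e / 4) by apply: mulr_ge0; have := e0; have := e1; lra.
  have c1 : (1 + e / 8) * (1 - e / 4) <= 1 - e / 8 by have := sqr_ge0 e; rewrite expr2; lra.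
  have L0 : 0 <= L by apply: le_trans L1.
  apply: (@le_trans _ _ ((1 + e / 8) * (1 - e / 4) * L * j)).
    by apply: ler_piMr; [exact: (mulr_ge0 (mulr_ge0 c0 L0) j0)|rewrite ler_pdivrMr// mul1r].
  by do 2!apply: ler_wpM2r => //.
(* A gain of 4 / y for each of the at least y n points of S is a gain of 4 n in total,
   which pays for the cross moment, the number of sets and the rate of the conclusion. *)
have key : 1 - ln y - e / 8 * L <= - (4 / y).
  have : e / 8 * (8 * (4 / y + 1 + `|ln y|) / e) <= e / 8 * L.
    by apply: ler_wpM2l => //; apply: divr_ge0 => //; exact: ltW.
  have -> : e / 8 * (8 * (4 / y + 1 + `|ln y|) / e) = 4 / y + 1 + `|ln y|.
    by field; rewrite !gt_eqF.
  have : - ln y <= `|ln y| by rewrite -normrN; exact: ler_norm.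
  lra.
have : j * (1 - ln y - e / 8 * L) <= j * - (4 / y) by apply: ler_wpM2l.
have : 4 * n%:R <= j * (4 / y).
  have -> : j * (4 / y) = 4 * (j / y) by rewrite mulrCA.
  by rewrite ler_wpM2l// ler_pdivlMr// mulrC.
move: cE th; lra.
Qed.

End below_threshold.

(** * The theorem *)

(** The parameters of [estimator_overlap_le] are chosen in terms of the tolerance [t] so
    that the terms in [z], [y] and [x] are t/4, t/4 and t/8; the others vanish as n
    grows. *)
Lemma impossibility (R : realType) (eps : R) (rho : nat -> R)
    (d : nat -> measure_display) (T : forall n, measurableType (d n))
    (P : forall n, probability (T n) R) (pi : forall n, {RV (P n) >-> 'S_n})
    (A B : forall n, {RV (P n) >-> obs n R}) :
  0 < eps ->
  (forall n, correlated_gaussian (rho n) (pi n) (A n) (B n)) ->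
  (\forall n \near \oo, rho n ^+ 2 <= (4 - eps) * ln n%:R / n%:R) ->
  forall (est : forall n, estimator n R) (delta : R), 0 < delta ->
  P n [set w | overlap R (est n (A n w, B n w)) (pi n w) <= delta] @[n --> \oo] --> 1%E.
Proof.
move=> eps0 hmodel hrho est delta delta0.
apply: cvg_prob1 => [n|t t0].
  exact: (measurable_est_event _ _ _ _ (fun s t => overlap R s t <= delta)).
(* Below the threshold, decreasing eps only weakens the hypothesis, so eps <= 1 may be
   assumed. *)
pose e := Num.min eps 1.
have e0 : 0 < e by rewrite lt_min eps0 ltr01.
have e1 : e <= 1 by rewrite ge_min lexx orbT.
have ee : e <= eps by rewrite ge_min lexx.
have e01 : 0 < e <= 1 by rewrite e0.
(* k is the denominator occurring in the second-moment bound. *)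
pose z := t / 4; pose k := z * delta ^+ 2; pose y := k * t / 4; pose x := k * t / 8.
have z0 : 0 < z by rewrite /z; lra.
have k0 : 0 < k by rewrite /k mulr_gt0// exprn_gt0.
have kt0 : 0 < k * t by exact: mulr_gt0.
have y0 : 0 < y by rewrite /y; lra.
have x0 : 0 < x by rewrite /x; lra.
pose a1 := 256 / e; pose a2 := 128 * 128 / (e ^+ 2 * y ^+ 2).
pose a3 := 8 * (4 / y + 1 + `|ln y|) / e; pose a4 := 8 * (1 + x^-1) / (k * t).
have a1p : 0 <= a1 by rewrite divr_ge0// ltW.
have a2p : 0 <= a2 by rewrite divr_ge0// mulr_ge0// exprn_ge0// ltW.
have a3p : 0 <= a3.
  have : 0 < 4 / y by exact: divr_gt0.
  by move=> h; rewrite divr_ge0 ?(ltW e0)// mulr_ge0// addr_ge0//; lra.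
have a4p : 0 <= a4.
  have : 0 < x^-1 by rewrite invr_gt0.
  by move=> h; rewrite divr_ge0 ?(ltW kt0)//; lra.
have hK := near_ln (288 + a1 + a2 + a3 + a4).
near=> n.
have [LK nK n0] : [/\ 288 + a1 + a2 + a3 + a4 <= ln n%:R,
  (288 + a1 + a2 + a3 + a4) * ln n%:R ^+ 2 <= n%:R & (0 < n)%N] by near: n.
have hr : rho n ^+ 2 <= (4 - eps) * ln n%:R / n%:R by near: n.
set L : R := ln n%:R in LK nK hr.
have L1 : 1 <= L by lra.
have LL : L <= L ^+ 2 by rewrite expr2 ler_peMl// (le_trans _ L1).
have L21 : 1 <= L ^+ 2 by apply: le_trans LL.
have nR : 0 < n%:R :> R by rewrite ltr0n.
have b1 : 0 <= a1 * (L ^+ 2 - L) by apply: mulr_ge0; lra.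
have b2 : 0 <= a2 * L ^+ 2 by apply: mulr_ge0; lra.
have b3 : 0 <= a3 * L ^+ 2 by apply: mulr_ge0; lra.
have b4 : 0 <= a4 * (L ^+ 2 - 1) by apply: mulr_ge0; lra.
have b5 : 0 <= a1 * L by apply: mulr_ge0; lra.
have nL : a1 * L <= n%:R by move: nK; lra.
have nL2 : 288 * L ^+ 2 <= n%:R by move: nK; lra.
have na4 : a4 <= n%:R by move: nK; lra.
have La2 : a2 <= L by lra.
have La3 : a3 <= L by lra.
have hr1 : rho n ^+ 2 <= (4 - e) * L / n%:R.
  apply: le_trans hr _; apply: ler_wpM2r; first by rewrite invr_ge0 ltW.
  by apply: ler_wpM2r; lra.
have r64 := sqr_correlation_small e01 n0 L1 nL hr1.
have hA := atypical_small e01 y0 n0 L1 nL La2 hr1.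
have hC := cross_small e01 y0 n0 L1 nL2 La3 hr1.
rewrite (_ : ~` _ = [set w | delta < overlap R (est n (A n w, B n w)) (pi n w)]); last first.
  by apply/seteqP; split => w /=; rewrite ltNge => /negP.
apply: le_trans (estimator_overlap_le (hmodel n) r64 n0 (est n) (@threshold R n e) x0 (ltW y0) z0 delta0) _.
rewrite lee_fin -/k.
have hN : expR (- n%:R) * (1 + x^-1) <= k * t / 8.
  have x1 : 0 < 1 + x^-1 by rewrite addr_gt0 ?invr_gt0.
  rewrite expRN ler_pdivrMl ?expR_gt0//.
  rewrite -ler_pdivrMr; last by lra.
  have -> : (1 + x^-1) / (k * t / 8) = a4.
    by rewrite /a4 invf_div mulrCA mulrA.
  by apply: (le_trans na4); apply: le_trans (expR_ge1Dx _); lra.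
have xV : 0 <= x^-1 by rewrite invr_ge0 ltW.
have hX := ler_wpM2l xV hC.
have hI : x + fine (power (bivariate (rho n)) #|{: edge n}| (atypical (rho n) y (@threshold R n e))) +
   x^-1 * (n`!%:R^-1 * \sum_(S : {set 'I_n} | y * n%:R <= #|S|%:R) (#|(~: S)%SET|)`!%:R *
     (expR (@threshold R n e S) *
      expR (17 * (rho n ^+ 2) ^+ 2 * #|{: edge n}|%:R + 4 * rho n ^+ 2 * n%:R))) <= k * (t / 4).
  move: hN hX hA; rewrite /x; lra.
have kV : 0 <= k^-1 by rewrite invr_ge0 ltW.
have := ler_wpM2l kV hI; rewrite [leRHS]mulrA mulVf ?gt_eqF// mul1r => hJ.
have yk : y / k = t / 4 by rewrite /y; field; rewrite gt_eqF.
rewrite yk; move: hJ; rewrite /z; lra.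
Unshelve. all: by end_near.
Qed.

Theorem theorem1 (R : realType) (eps : R) (rho : nat -> R)
    (d : nat -> measure_display) (T : forall n, measurableType (d n))
    (P : forall n, probability (T n) R)
    (pi : forall n, {RV (P n) >-> 'S_n})
    (A B : forall n, {RV (P n) >-> obs n R})
    (heps : 0 < eps)
    (hrho : forall n, 0 < rho n <= 1)
    (hmodel : forall n, correlated_gaussian (rho n) (pi n) (A n) (B n)) :
  ((\forall n \near \oo, (4 + eps) * ln n%:R / n%:R <= rho n ^+ 2) ->
    forall ml : (forall n, estimator n R), (forall n, is_ML (ml n)) ->
    P n [set w | overlap R (ml n (A n w, B n w)) (pi n w) = 1]
      @[n --> \oo] --> 1%E)
  /\
  ((\forall n \near \oo, rho n ^+ 2 <= (4 - eps) * ln n%:R / n%:R) ->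
    forall (est : forall n, estimator n R) (delta : R), 0 < delta ->
    P n [set w | overlap R (est n (A n w, B n w)) (pi n w) <= delta]
      @[n --> \oo] --> 1%E).
Proof.
split; first exact: ml_exact_recovery.
exact: impossibility.
Qed.
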